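(* Let $d\ge 2$ and $\lambda\in(0,1)$. There exists a constant $C=C(d,\lambda)<\infty$, depending only on $d$ and $\lambda$, such that for every stationary probability measure on $\Omega=[\lambda,1]^{\mathbb{E}^d}$, with expectation denoted by $\langle\cdot\rangle$, one has $$\big\langle |\nabla G(e,y)|^{2}\big\rangle^{\frac12}\le C\,(|e-y|+1)^{1-d}$$ and $$\big\langle |\nabla\nabla G(e,b)|\big\rangle\le C\,(|e-b|+1)^{-d}$$ for all edges $e,b\in\mathbb{E}^d$ and all vertices $y\in\mathbb{Z}^d$, where $G=G(a;\cdot,\cdot)$ is the Green function of the operator $\nabla^* a\nabla$ on $\mathbb{Z}^d$ associated with the random coefficient field $a\in\Omega$.
   Context: Lattice and discrete calculus. $\mathbb{E}^d$ is the set of edges $[x,x+e_i]$, $x\in\mathbb{Z}^d$, $i=1,\dots,d$, of $\mathbb{Z}^d$, where $e_1,\dots,e_d$ is the canonical basis of $\mathbb{R}^d$. For $\zeta:\mathbb{Z}^d\to\mathbb{R}$ and $\xi:\mathbb{E}^d\to\mathbb{R}$, $$\nabla\zeta([x,x+e_i])=\zeta(x+e_i)-\zeta(x),\qquad \nabla^*\xi(x)=\sum_{i=1}^d\big(\xi([x-e_i,x])-\xi([x,x+e_i])\big).$$ Coefficient fields. Fix the ellipticity ratio $\lambda\in(0,1)$. $\Omega:=[\lambda,1]^{\mathbb{E}^d}$ (with its product Borel $\sigma$-algebra) is the set of coefficient fields $a:\mathbb{E}^d\to[\lambda,1]$. For an edge $e$ and $x\in\mathbb{Z}^d$, $e+x$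 denotes the edge $e$ translated by $x$. A probability measure on $\Omega$ is called stationary if, for every $x\in\mathbb{Z}^d$, the fields $a$ and $a(\cdot+x)$ have the same distribution under it. No further probabilistic assumption is made. Green function. For $a\in\Omega$ and $y\in\mathbb{Z}^d$, $G(\cdot,y)=G(a;\cdot,y)$ is the fundamental solution, i.e. the solution of $$\nabla^*\big(a\nabla G(\cdot,y)\big)(x)=\delta(x-y)\quad\text{for all }x\in\mathbb{Z}^d,$$ where $\delta(0)=1$ and $\delta(x)=0$ for $x\neq0$. For $d\ge3$ it is the solution that decays to $0$ at infinity. In all dimensions $d\ge 2$, $\nabla G(e,y)=\lim_{T\to\infty}\nabla G_T(e,y)$, where for $T>0$, $G_T(\cdot,y)\in\ell^1(\mathbb{Z}^d)$ is the solution of $\frac1T G_T(\cdot,y)+\nabla^*a\nabla G_T(\cdot,y)=\delta(\cdot-y)$; for $d=2$ this limit is taken as the definition of $\nabla G(e,y)$. Derivatives of $G$. $\nabla G(e,y)$ is the discrete derivative of $G(\cdot,y)$ in the first variable along the edge $e$. $\nabla\nabla G(e,b)$ is the second mixed derivative: one discrete derivative in the first variable along $e$ and one in the second variable along $b$, i.e. $\nabla\nabla G(e,b)=\nabla G(e,z+e_i)-\nabla G(e,z)$ for $b=[z,z+e_i]$. Distances. $|e-y|$ is the Euclidean distance from the midpoint of the edge $e$ to the vertex $y$, and $|e-b|$ is the Euclidean distance between the midpoints of the edges $e$ and $b$. *)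

(* Defs.v *)
From HB Require Import structures.
From mathcomp Require Import all_boot all_order all_algebra.
From mathcomp Require Import all_classical all_reals all_analysis.

Set Implicit Arguments.
Unset Strict Implicit.
Unset Printing Implicit Defensive.

Import Order.TTheory GRing.Theory Num.Theory.
Import numFieldNormedType.Exports.

Local Open Scope classical_set_scope.
Local Open Scope ring_scope.

Definition vertex (d : nat) := 'rV[int]_d.

Definition basis (d : nat) (i : 'I_d) : vertex d := delta_mx 0 i.

(* [(x, i)] encodes the edge [x, x + e_i]; every edge has exactly one code. *)
Definition edge (d : nat) := (vertex d * 'I_d)%type.

Definition shift_edge (d : nat) (x : vertex d) (e : edge d) : edge d :=
  (e.1 + x, e.2).

Section DiscreteCalculus.
Variables (R : realType) (d : nat).

Definition grad (zeta : vertex d -> R) (e : edge d) : R :=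
  zeta (e.1 + basis e.2) - zeta e.1.

Definition grad_adj (xi : edge d -> R) (x : vertex d) : R :=
  \sum_(i < d) (xi (x - basis i, i) - xi (x, i)).

(* The library's norm on ['rV[R]_d] is the sup norm. *)
Definition euclidean_norm (v : 'rV[R]_d) : R :=
  Num.sqrt (\sum_(i < d) v 0 i ^+ 2).

Definition point_of (x : vertex d) : 'rV[R]_d := map_mx intr x.

Definition midpoint (e : edge d) : 'rV[R]_d :=
  2^-1 *: (point_of e.1 + point_of (e.1 + basis e.2)).

Definition dist_edge_vertex (e : edge d) (y : vertex d) : R :=
  euclidean_norm (midpoint e - point_of y).

Definition dist_edge_edge (e b : edge d) : R :=
  euclidean_norm (midpoint e - midpoint b).

Definition vanishes_at_infinity (zeta : vertex d -> R) : Prop :=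
  forall eps : R, 0 < eps -> exists r : R, forall x : vertex d,
    r < euclidean_norm (point_of x) -> `|zeta x| < eps.

End DiscreteCalculus.

Section CoefficientFields.
Variables (R : realType) (d : nat) (lambda : R).

(* The argument [lambda01] is only there so that the type is inhabited: the
   library requires measurable types to be pointed. *)
Definition Omega (lambda01 : 0 < lambda < 1) : Type :=
  set_type [set a : edge d -> R | forall e, lambda <= a e <= 1].

Variable lambda01 : 0 < lambda < 1.

Definition coef (a : Omega lambda01) : edge d -> R := sval a.

Lemma coefP (a : Omega lambda01) (e : edge d) : lambda <= coef a e <= 1.
Proof. by case: a => a aP; move: (set_mem aP); exact. Qed.

Definition mkOmega (a : edge d -> R) (aP : forall e, lambda <= a e <= 1) :
  Omega lambda01 := SigSub (mem_set (A := [set a | forall e, lambda <= a e <= 1]) aP).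

Lemma one_elliptic (e : edge d) : lambda <= (1 : R) <= 1.
Proof. by case/andP: lambda01 => _ /ltW ->; rewrite lexx. Qed.

HB.instance Definition _ := Choice.on (Omega lambda01).
HB.instance Definition _ :=
  isPointed.Build (Omega lambda01) (mkOmega one_elliptic).

(* Preimages of Borel sets under the coordinate maps; they generate the
   product Borel sigma-algebra. *)
Definition cylinders : set (set (Omega lambda01)) :=
  [set A | exists e (B : set R),
     measurable B /\ A = (fun a => coef a e) @^-1` B].

HB.instance Definition _ := @isMeasurable.Build (sigma_display cylinders)
  (Omega lambda01) <<s cylinders >>
  (@sigma_algebra0 _ setT cylinders) (@sigma_algebraC _ cylinders)
  (@sigma_algebra_bigcup _ setT cylinders).

Definition shift (x : vertex d) (a : Omega lambda01) : Omega lambda01 :=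
  mkOmega (fun e => coefP a (shift_edge x e)).

Definition stationary (P : probability (Omega lambda01) R) : Prop :=
  forall (x : vertex d) (A : set (Omega lambda01)),
    measurable A -> pushforward P (shift x) A = P A.

End CoefficientFields.

Arguments Omega {R} d {lambda} lambda01.

Section Green.
Variables (R : realType) (d : nat).
Implicit Types (a : edge d -> R) (T : R) (y : vertex d) (e b : edge d).

Definition elliptic_op a (g : vertex d -> R) (x : vertex d) : R :=
  grad_adj (fun e => a e * grad g e) x.

Definition is_massive_green a T y (g : vertex d -> R) : Prop :=
  summable [set: vertex d] (EFin \o g) /\
  forall x, T^-1 * g x + elliptic_op a g x = (x == y)%:R.

Definition massive_green a T y : vertex d -> R :=
  xget (fun=> 0) [set g | is_massive_green a T y g].

Definition is_decaying_green a y (g : vertex d -> R) : Prop :=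
  vanishes_at_infinity g /\ forall x, elliptic_op a g x = (x == y)%:R.

Definition decaying_green a y : vertex d -> R :=
  xget (fun=> 0) [set g | is_decaying_green a y g].

Definition grad_green a e y : R :=
  if (3 <= d)%N then grad (decaying_green a y) e
  else lim (grad (massive_green a T y) e @[T --> +oo]).

Definition mixed_grad_green a e b : R :=
  grad_green a e (b.1 + basis b.2) - grad_green a e b.1.

End Green.

(* Main.v *)
(* Let [P = 1 - kappa * elliptic_op a] with [kappa = 1 / (4 d)], the generator of
   a lazy symmetric random walk, and let [p_n] be its kernel; the Green function
   is [kappa * \sum_n p_n], in two dimensions after taking gradients.
   - Nash's inequality gives [\sum_x p_n(x, y)^2 <= C n^(-d/2)], and a weighted
     energy estimate with the weight [(1 + |x - y|^2)^(d+2)] propagates this to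
     weighted second moments and weighted energies of [p_n].
   - By the semigroup property, the gradient of [p_{n+m}] at [(e, y)] is
     [\sum_z grad p_n(e, z) p_m(z, y)]; Cauchy-Schwarz leaves the sum over [z] of
     [|grad p_n(e, z)|^2], a sum over the second variable. Stationarity turns
     its expectation into that of the sum over the first variable, which is the
     energy just estimated. The mixed derivative is
     [\sum_z grad p_n(e, z) grad p_m(b, z)] and is treated in the same way.
   - This gives [<|grad p_n|^2>^(1/2) <= C n^(-(d+1)/2) (1 + |e-y|^2/n)^(-(d+2)/2)]
     and [<|grad grad p_n|> <= C n^(-d/2-1) (1 + |e-b|^2/n)^(-(d+2)/2)], and
     summing over [n] yields the two bounds. *)
Require Import Defs.
From HB Require Import structures.
From mathcomp Require Import all_boot all_order all_algebra.
From mathcomp Require Import all_classical all_reals all_analysis.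
From mathcomp Require Import measurable_realfun ring lra zify.
Import Order.TTheory GRing.Theory Num.Theory.
Import numFieldNormedType.Exports.
(* [all_analysis] shadows [basis] and [shift]. *)
Import Defs.
Local Open Scope classical_set_scope.
Local Open Scope ring_scope.

Set Implicit Arguments.
Unset Strict Implicit.
Unset Printing Implicit Defensive.

(** * Sums of finitely supported functions *)

(** For coefficients that are merely elliptic, the energy estimate bounds the gradient of the kernel
    only after summation over space and over time, never at one edge and one time. Stationarity
    supplies the sum over space. The sum over time comes from using the semigroup identity at every
    splitting time of a window of length comparable to [k]. For the gradient, the other
    Cauchy-Schwarz factor is bounded for every field, so the square can be averaged; for the mixed
    derivative both factors are random, and their geometric mean is controlled in first moment only.
    Discrete time keeps each kernel finitely supported, inside a set independent of the field, so
    lattice sums are finite and measurable. The Green function enters late, through absolutely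
    convergent gradient series: a maximum principle identifies it for [d >= 3], Abel summation in
    the mass [1/T] for [d = 2]. At fields where convergence is not secured the majorant is [+oo], so
    the pointwise inequalities hold for all fields and no null set has to be removed. *)

Section LatticeSums.
Variables (R : realType) (d : nat).
Implicit Types (f g : vertex d -> R) (x y z : vertex d).

Definition fsupp f := exists r : seq (vertex d), forall x, x \notin r -> f x = 0.

(** This finitary sum is 0 on an infinite support: scaling, translation and positivity hold for
    every function, whereas additivity and monotonicity ask for [fsupp]. *)
Definition lsum f : R := \sum_(x \in [set: vertex d]) f x.

Lemma lsumE (r : seq (vertex d)) f : uniq r -> (forall x, x \notin r -> f x = 0) ->
  lsum f = \sum_(x <- r) f x.
Proof.
move=> ur fr; rewrite /lsum (fsbigE r)// => [|x _ /fr//].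
by apply: eq_bigl => x; rewrite in_setT.
Qed.

Lemma fsupp2 f g : fsupp f -> fsupp g ->
  exists r, [/\ uniq r, forall x, x \notin r -> f x = 0
    & forall x, x \notin r -> g x = 0].
Proof.
move=> [r fr] [s gs]; exists (undup (r ++ s)); split; first exact: undup_uniq.
- by move=> x; rewrite mem_undup mem_cat negb_or => /andP[/fr].
- by move=> x; rewrite mem_undup mem_cat negb_or => /andP[_ /gs].
Qed.

Lemma fsupp_le f g : fsupp f -> (forall x, f x = 0 -> g x = 0) -> fsupp g.
Proof. by move=> [r fr] fg; exists r => x /fr /fg. Qed.

Lemma fsuppMl f g : fsupp f -> fsupp (fun x => f x * g x).
Proof. by move=> /fsupp_le; apply => x ->; rewrite mul0r. Qed.

Lemma fsuppMr f g : fsupp g -> fsupp (fun x => f x * g x).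
Proof. by move=> /fsupp_le; apply => x ->; rewrite mulr0. Qed.

Lemma fsuppD f g : fsupp f -> fsupp g -> fsupp (fun x => f x + g x).
Proof.
move=> ff fg; have [r [_ fr gr]] := fsupp2 ff fg.
by exists r => x xr; rewrite fr ?gr ?addr0.
Qed.

Lemma fsuppN f : fsupp f -> fsupp (fun x => - f x).
Proof. by move=> /fsupp_le; apply => x ->; rewrite oppr0. Qed.

Lemma fsuppX f n : fsupp f -> fsupp (fun x => f x ^+ n.+1).
Proof. by move=> /fsupp_le; apply => x ->; rewrite expr0n. Qed.

Lemma fsupp_shift f z : fsupp f -> fsupp (fun x => f (x + z)).
Proof.
move=> [r fr]; exists [seq x - z | x <- r] => x xr; apply: fr.
by apply: contra xr => xr; apply/mapP; exists (x + z); rewrite // addrK.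
Qed.

Lemma fsupp_sum (I : Type) (s : seq I) (F : I -> vertex d -> R) :
  (forall i, fsupp (F i)) -> fsupp (fun x => \sum_(i <- s) F i x).
Proof.
move=> FF; elim: s => [|i s IH].
  by exists [::] => x _; rewrite big_nil.
by apply: fsupp_le (fsuppD (FF i) IH) _ => x; rewrite big_cons.
Qed.

Lemma fsupp_delta y : fsupp (fun x => (x == y)%:R).
Proof. by exists [:: y] => x; rewrite inE => /negbTE ->. Qed.

Lemma eq_lsum f g : f =1 g -> lsum f = lsum g.
Proof. by move=> fg; apply: eq_fsbigr => x _. Qed.

Lemma lsumD f g : fsupp f -> fsupp g ->
  lsum (fun x => f x + g x) = lsum f + lsum g.
Proof.
move=> ff fg; have [r [ur fr gr]] := fsupp2 ff fg.
rewrite !(@lsumE r) ?big_split// => x xr; first by rewrite fr ?gr ?addr0.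
Qed.

Lemma lsumZ c f : lsum (fun x => c * f x) = c * lsum f.
Proof. by rewrite /lsum mulr_fsumr. Qed.

Lemma lsumN f : lsum (fun x => - f x) = - lsum f.
Proof. by rewrite -mulN1r -lsumZ; apply: eq_lsum => x; rewrite mulN1r. Qed.

Lemma lsumB f g : fsupp f -> fsupp g ->
  lsum (fun x => f x - g x) = lsum f - lsum g.
Proof. by move=> ff fg; rewrite lsumD ?lsumN//; exact: fsuppN. Qed.

Lemma lsum_sum (I : Type) (s : seq I) (F : I -> vertex d -> R) :
  (forall i, fsupp (F i)) ->
  lsum (fun x => \sum_(i <- s) F i x) = \sum_(i <- s) lsum (F i).
Proof.
move=> FF; elim: s => [|i s IH].
  by rewrite big_nil /lsum fsbig1// => x _; rewrite big_nil.
rewrite big_cons -IH -lsumD//; last exact: fsupp_sum.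
by apply: eq_lsum => x; rewrite big_cons.
Qed.

Lemma lsum_shift f z : lsum (fun x => f (x + z)) = lsum f.
Proof.
rewrite /lsum [RHS](@reindex_fsbigT _ _ _ _ _ (fun x => x + z))//.
by exists (fun x => x - z) => x; rewrite ?addrK ?subrK.
Qed.

Lemma lsum_ge0 f : (forall x, 0 <= f x) -> 0 <= lsum f.
Proof. by move=> f0; apply: fsumr_ge0. Qed.

Lemma ler_lsum f g : fsupp f -> fsupp g -> (forall x, f x <= g x) ->
  lsum f <= lsum g.
Proof.
move=> ff fg fleg; rewrite -subr_ge0 -lsumB//.
by apply: lsum_ge0 => x; rewrite subr_ge0.
Qed.

Lemma lsum_delta y f : lsum (fun x => (x == y)%:R * f x) = f y.
Proof.
rewrite (@lsumE [:: y])// ?big_seq1 ?eqxx ?mul1r// => x.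
by rewrite inE => /negbTE ->; rewrite mul0r.
Qed.

Lemma ler_lsum_seq (r : seq (vertex d)) f : fsupp f -> (forall x, 0 <= f x) ->
  uniq r -> \sum_(x <- r) f x <= lsum f.
Proof.
move=> ff f0 ur.
have fg : fsupp (fun x => (x \in r)%:R * f x) by exact: fsuppMr.
rewrite (_ : \sum_(x <- r) f x = lsum (fun x => (x \in r)%:R * f x)).
  apply: ler_lsum => // x; case: (x \in r); rewrite ?mul1r ?mul0r//.
rewrite (@lsumE r)//; last by move=> x /negbTE ->; rewrite mul0r.
by apply: eq_big_seq => x ->; rewrite mul1r.
Qed.

End LatticeSums.

Ltac fsupp_tac := lazymatch goal with
  | |- fsupp (fun x => _ + _) => apply: fsuppD; fsupp_tac
  | |- fsupp (fun x => - _) => apply: fsuppN; fsupp_tac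
  | |- fsupp (fun x => _ ^+ _) => apply: fsuppX; fsupp_tac
  | |- fsupp (fun x => (x == ?y)%:R) => exact: (@fsupp_delta _ _ y)
  | |- fsupp (fun x => \sum_(i <- _) _) => apply: fsupp_sum => ?; fsupp_tac
  | |- fsupp (fun x => _ * _) =>
      first [apply: fsuppMl; solve [fsupp_tac] | apply: fsuppMr; solve [fsupp_tac]]
  | |- fsupp (fun x => ?f (x + ?z)) => apply: (@fsupp_shift _ _ f z); fsupp_tac
  | |- _ => solve [auto]
  end.

Section CauchySchwarz.
Variables (R : realType) (d : nat).

(** The nonnegative form [quad] is evaluated at [(- B, A)] or [(C, - B)], its minimisers up to
    scaling; if [A = C = 0], its values at [(1, 1)] and [(1, -1)] force [B = 0]. *)
Lemma lsum_CS (f g : vertex d -> R) : fsupp f -> fsupp g ->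
  lsum (fun x => f x * g x) ^+ 2 <=
  lsum (fun x => f x ^+ 2) * lsum (fun x => g x ^+ 2).
Proof.
move=> ff fg.
set A := lsum (fun x => f x ^+ 2); set B := lsum _; set C := lsum _.
have quad (s t : R) : 0 <= s ^+ 2 * A + 2 * s * t * B + t ^+ 2 * C.
  rewrite /A /B /C -!lsumZ -!lsumD; try fsupp_tac.
  apply: lsum_ge0 => x.
  by rewrite (_ : _ + _ = (s * f x + t * g x) ^+ 2) ?sqr_ge0//; ring.
have A0 : 0 <= A by apply: lsum_ge0 => x; exact: sqr_ge0.
have C0 : 0 <= C by apply: lsum_ge0 => x; exact: sqr_ge0.
have [A1|A1] := ltP 0 A.
  have := quad (- B) A.
  rewrite (_ : _ + _ = A * (A * C - B ^+ 2)); last by ring.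
  by rewrite pmulr_rge0// subr_ge0.
have AE : A = 0 by apply/eqP; rewrite eq_le A1.
have [C1|C1] := ltP 0 C.
  have := quad C (- B).
  rewrite (_ : _ + _ = C * (A * C - B ^+ 2)); last by ring.
  by rewrite pmulr_rge0// subr_ge0.
have CE : C = 0 by apply/eqP; rewrite eq_le C1.
have := quad 1 1; have := quad 1 (- 1); rewrite AE CE => h1 h2.
have -> : B = 0 by lra.
by rewrite expr0n mulr0.
Qed.

End CauchySchwarz.

(** * The lazy walk and its weighted energy inequality *)

Lemma sqr_sum_le (R : realFieldType) (n : nat) (t : 'I_n -> R) :
  (\sum_(i < n) t i) ^+ 2 <= n%:R * \sum_(i < n) t i ^+ 2.
Proof.
elim: n t => [|n IH] t; first by rewrite !big_ord0 expr0n mul0r.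
rewrite !big_ord_recr /=; set A := \sum_(i < n) _; set B := \sum_(i < n) _.
have AB : A ^+ 2 <= n%:R * B by exact: IH.
have B0 : 0 <= B by apply: sumr_ge0 => i _; exact: sqr_ge0.
set u := t ord_max; rewrite -natr1.
(* AM-GM for [B] and [n u^2], proved on squares: [A^2 <= n B] turns [(2 A u)^2] into at most
   [4 B n u^2]. *)
suff : 2 * A * u <= B + n%:R * u ^+ 2 by nra.
have : 0 <= (B + n%:R * u ^+ 2) ^+ 2 - (2 * A * u) ^+ 2.
  have n0 : 0 <= n%:R :> R by [].
  have : A ^+ 2 * u ^+ 2 <= n%:R * B * u ^+ 2 by rewrite ler_wpM2r ?sqr_ge0.
  have := sqr_ge0 (B - n%:R * u ^+ 2); nra.
rewrite subr_ge0 => h.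
have X0 : 0 <= B + n%:R * u ^+ 2 by rewrite addr_ge0// mulr_ge0// sqr_ge0.
by rewrite (le_trans (ler_norm _))// -(ger0_norm X0) -ler_sqr ?nnegrE// !real_normK// num_real.
Qed.

Section Walk.
Variables (R : realType) (d : nat) (a : edge d -> R).
Implicit Types (f g w v : vertex d -> R) (x y z : vertex d).

(** With [a <= 1] the jump rates at a vertex add up to at most [2 d], so the walk stays put with
    probability at least 1/2. This gives positivity, and makes the second-order term of an energy
    step cost at most half of the energy. *)
Definition kappa : R := (4 * d%:R)^-1.

Definition walk_op f x : R := f x - kappa * elliptic_op a f x.

(** An edge carries the sum of the weights of its ends because of the product rule [2 grad (w f)
    grad f = (w + w') (grad f)^2 + (f + f') grad w grad f], where primes denote values at the far
    end. *)
Definition energy w f : R :=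
  lsum (fun x => \sum_(i < d)
    (w x + w (x + basis i)) * (a (x, i) * grad f (x, i) ^+ 2)).

Lemma gradE f x i : grad f (x, i) = f (x + basis i) - f x.
Proof. by []. Qed.

Lemma elliptic_opE f x : elliptic_op a f x = \sum_(i < d)
  (a (x - basis i, i) * grad f (x - basis i, i) - a (x, i) * grad f (x, i)).
Proof. by []. Qed.

Lemma fsupp_grad f i : fsupp f -> fsupp (fun x => grad f (x, i)).
Proof. by move=> ff; rewrite /grad /=; fsupp_tac. Qed.

Lemma fsupp_elliptic f : fsupp f -> fsupp (elliptic_op a f).
Proof.
move=> ff; rewrite /elliptic_op /grad_adj; apply: fsupp_sum => i.
have h : fsupp (fun x => a (x, i) * grad f (x, i)).
  by apply: fsuppMr; exact: fsupp_grad.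
exact: (fsuppD (fsupp_shift (- basis i) h) (fsuppN h)).
Qed.

Lemma fsupp_walk f : fsupp f -> fsupp (walk_op f).
Proof.
move=> ff; have := fsupp_elliptic ff; rewrite /walk_op => fe.
by fsupp_tac.
Qed.

Lemma lsum_by_parts g (xi : edge d -> R) :
  (forall i, fsupp (fun x => g x * xi (x, i))) ->
  (forall i, fsupp (fun x => g (x + basis i) * xi (x, i))) ->
  lsum (fun x => g x * grad_adj xi x) =
  lsum (fun x => \sum_(i < d) grad g (x, i) * xi (x, i)).
Proof.
move=> f1 f2.
have f3 i : fsupp (fun x => g x * xi (x - basis i, i)).
  apply: fsupp_le (fsupp_shift (- basis i) (f2 i)) _ => x.
  by rewrite subrK.
transitivity (\sum_(i < d) (lsum (fun x => g (x + basis i) * xi (x, i))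
   - lsum (fun x => g x * xi (x, i)))).
  rewrite (eq_lsum (g := fun x => \sum_(i < d)
    (g x * xi (x - basis i, i) - g x * xi (x, i)))); last first.
    by move=> x; rewrite /grad_adj mulr_sumr; apply: eq_bigr => i _; rewrite mulrBr.
  rewrite lsum_sum; last by move=> i; apply: fsuppD => //; exact: fsuppN.
  apply: eq_bigr => i _; rewrite lsumB//; congr (_ - _).
  by rewrite -(lsum_shift _ (basis i)); apply: eq_lsum => x; rewrite addrK.
rewrite lsum_sum; last first.
  move=> i; apply: fsupp_le (fsuppD (f2 i) (fsuppN (f1 i))) _ => x.
  by rewrite gradE mulrBl.
apply: eq_bigr => i _; rewrite -lsumB//; apply: eq_lsum => x.
by rewrite gradE mulrBl.
Qed.

(** Finite support of either function is enough: conservation of mass tests against the constant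
    1. *)
Lemma lsum_elliptic g f : fsupp f \/ fsupp g ->
  lsum (fun x => g x * elliptic_op a f x) =
  lsum (fun x => \sum_(i < d) grad g (x, i) * (a (x, i) * grad f (x, i))).
Proof.
move=> fg; apply: lsum_by_parts => i.
  by case: fg => ff; rewrite /grad /=; fsupp_tac.
by case: fg => ff; rewrite /grad /=; fsupp_tac.
Qed.

Lemma lsum_elliptic_sym g f : fsupp f \/ fsupp g ->
  lsum (fun x => g x * elliptic_op a f x) =
  lsum (fun x => elliptic_op a g x * f x).
Proof.
move=> fg; rewrite lsum_elliptic//.
rewrite [RHS](eq_lsum (g := fun x => f x * elliptic_op a g x)); last first.
  by move=> x; rewrite mulrC.
rewrite lsum_elliptic; last by case: fg; [right|left].
by apply: eq_lsum => x; apply: eq_bigr => i _; ring.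
Qed.

Lemma walk_op_sym g f : fsupp f -> fsupp g ->
  lsum (fun x => g x * walk_op f x) = lsum (fun x => walk_op g x * f x).
Proof.
move=> ff fg; rewrite /walk_op.
have fe := fsupp_elliptic ff; have ge := fsupp_elliptic fg.
transitivity (lsum (fun x => g x * f x) - kappa * lsum (fun x => g x * elliptic_op a f x)).
  by rewrite -lsumZ -lsumB; try fsupp_tac; apply: eq_lsum => x; ring.
rewrite lsum_elliptic_sym; last by left.
by rewrite -lsumZ -lsumB; try fsupp_tac; apply: eq_lsum => x; ring.
Qed.

Lemma lsum_walk f : fsupp f -> lsum (walk_op f) = lsum f.
Proof.
move=> ff; have fe := fsupp_elliptic ff.
rewrite /walk_op lsumB; try fsupp_tac.
rewrite lsumZ (eq_lsum (f := elliptic_op a f) (g := fun x => 1 * elliptic_op a f x)); last first.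
  by move=> x; rewrite mul1r.
rewrite (@lsum_elliptic (fun=> 1)); last by left.
rewrite [X in _ * X](_ : _ = 0) ?mulr0 ?subr0// /lsum fsbig1// => x _.
by rewrite big1// => i _; rewrite gradE subrr mul0r.
Qed.

Lemma sqr_elliptic_le f x :
  elliptic_op a f x ^+ 2 <= 2 * d%:R * \sum_(i < d)
   ((a (x - basis i, i) * grad f (x - basis i, i)) ^+ 2 + (a (x, i) * grad f (x, i)) ^+ 2).
Proof.
rewrite elliptic_opE; apply: le_trans (sqr_sum_le _) _.
rewrite [2 * _]mulrC -mulrA ler_wpM2l// mulr_sumr; apply: ler_sum => i _.
set p := _ * grad _ _; set q := a (x, i) * _.
have := sqr_ge0 (p + q); nra.
Qed.

Hypothesis d_gt0 : (0 < d)%N.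
Hypothesis a01 : forall e, 0 <= a e <= 1.

Lemma kappa_gt0 : 0 < kappa.
Proof. by rewrite invr_gt0 mulr_gt0// ltr0n. Qed.

Lemma kappaE : kappa * (4 * d%:R) = 1.
Proof. by rewrite mulVf// mulf_neq0// pnatr_eq0 -lt0n. Qed.

(** This form displays an average with nonnegative coefficients of total mass 1, the source of
    positivity, of the sup-norm bound and of the maximum principle. *)
Lemma walk_opE f x : walk_op f x = kappa * \sum_(i < d)
  ((4 - a (x - basis i, i) - a (x, i)) * f x + a (x - basis i, i) * f (x - basis i)
    + a (x, i) * f (x + basis i)).
Proof.
rewrite /walk_op elliptic_opE.
have fE : f x = kappa * (4 * d%:R * f x) by rewrite mulrA kappaE mul1r.
rewrite [X in X - _]fE -mulrBr; congr (_ * _).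
have -> : 4 * d%:R * f x = \sum_(i < d) 4 * f x.
  by rewrite sumr_const card_ord -[RHS]mulr_natl; ring.
rewrite -sumrB.
by apply: eq_bigr => i _; rewrite !gradE subrK; ring.
Qed.

Lemma walk_ge0 f : (forall x, 0 <= f x) -> forall x, 0 <= walk_op f x.
Proof.
move=> f0 x; rewrite walk_opE mulr_ge0 ?(ltW kappa_gt0)//.
apply: sumr_ge0 => i _.
have /andP[p0 p1] := a01 (x - basis i, i); have /andP[q0 q1] := a01 (x, i).
by rewrite !addr_ge0// mulr_ge0//; lra.
Qed.

(** Expanding [w (f - kappa L f)^2], with [L] the elliptic operator, the first-order term yields
    [- kappa] times the energy and a commutator [X] containing [grad w]. The second-order term gives
    back half of that energy ([E2], [E4]) and Young's inequality for [X] a quarter ([E3]), so a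
    quarter survives, at the price of the term in [v]. *)
Lemma energy_step w v f c : fsupp f -> (forall x, 0 <= w x) -> (forall x, 0 <= v x) -> 0 <= c ->
  (forall x i, grad w (x, i) ^+ 2 <= c * (w x + w (x + basis i)) * v x) ->
  (forall x i, grad w (x, i) ^+ 2 <= c * (w x + w (x + basis i)) * v (x + basis i)) ->
  lsum (fun x => w x * walk_op f x ^+ 2) + kappa / 4 * energy w f <=
  lsum (fun x => w x * f x ^+ 2) + c * lsum (fun x => v x * f x ^+ 2).
Proof.
move=> ff w0 v0 c0 wv1 wv2.
have fe := fsupp_elliptic ff.
have fg i := fsupp_grad i ff.
have k0 := kappa_gt0.
set M := lsum (fun x => w x * f x ^+ 2).
pose X := lsum (fun x => \sum_(i < d)
  a (x, i) * ((f x + f (x + basis i)) * grad w (x, i) * grad f (x, i))).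
have fX : fsupp (fun x => \sum_(i < d)
  a (x, i) * ((f x + f (x + basis i)) * grad w (x, i) * grad f (x, i))).
  by apply: fsupp_sum => i; apply: fsuppMr; apply: fsuppMr.
have fE : fsupp (fun x => \sum_(i < d)
    (w x + w (x + basis i)) * (a (x, i) * grad f (x, i) ^+ 2)).
  by apply: fsupp_sum => i; apply: fsuppMr; apply: fsuppMr; apply: fsuppX.
have E1 : lsum (fun x => w x * walk_op f x ^+ 2) =
    M - kappa * (energy w f + X) + kappa ^+ 2 * lsum (fun x => w x * elliptic_op a f x ^+ 2).
  have -> : energy w f + X = 2 * lsum (fun x => (w x * f x) * elliptic_op a f x).
    rewrite lsum_elliptic; last by left.
    rewrite -lsumD// -lsumZ; apply: eq_lsum => x; rewrite mulr_sumr -big_split/=.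
    by apply: eq_bigr => i _; rewrite !gradE; ring.
  rewrite /M mulrA -!lsumZ -lsumB; try fsupp_tac; rewrite -lsumD; try fsupp_tac.
  by apply: eq_lsum => x; rewrite /walk_op; ring.
(* Translating the term of the incoming edge collects the weights of both ends on one edge; [a <= 1]
   then turns [a^2] into [a]. *)
have E2 : lsum (fun x => w x * elliptic_op a f x ^+ 2) <= 2 * d%:R * energy w f.
  pose xi (e : edge d) := (a e * grad f e) ^+ 2.
  have fxi i : fsupp (fun x => xi (x, i)) by apply: fsuppX; apply: fsuppMr.
  have fxi' i : fsupp (fun x => xi (x - basis i, i)).
    exact: (fsupp_shift (- basis i) (fxi i)).
  apply: (@le_trans _ _ (2 * d%:R * lsum (fun x => \sum_(i < d)
     (w x * xi (x - basis i, i) + w x * xi (x, i))))).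
    rewrite -lsumZ; apply: ler_lsum; first by fsupp_tac.
      by apply: fsuppMr; apply: fsupp_sum => i; apply: fsuppD; apply: fsuppMr.
    move=> x; under eq_bigr do rewrite -mulrDr.
    rewrite -mulr_sumr [leRHS]mulrCA ler_wpM2l//; exact: sqr_elliptic_le.
  rewrite ler_wpM2l// ?mulr_ge0//.
  apply: (@le_trans _ _ (lsum (fun x => \sum_(i < d) (w x + w (x + basis i)) * xi (x, i)))).
    rewrite lsum_sum; last by move=> i; apply: fsuppD; apply: fsuppMr.
    rewrite lsum_sum; last by move=> i; apply: fsuppMr.
    apply: ler_sum => i _; rewrite lsumD; try by apply: fsuppMr.
    rewrite -(lsum_shift _ (basis i)) -lsumD; last 2 first.
    - by apply: fsuppMr; apply: fsupp_le (fxi i) _ => x; rewrite addrK.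
    - by apply: fsuppMr.
    rewrite (eq_lsum (g := fun x => (w x + w (x + basis i)) * xi (x, i)))// => x.
    by rewrite addrK; ring.
  apply: ler_lsum => //; first by apply: fsupp_sum => i; apply: fsuppMr.
  move=> x; apply: ler_sum => i _; rewrite ler_wpM2l ?addr_ge0//.
  have /andP[p0 p1] := a01 (x, i); rewrite /xi exprMn ler_wpM2r ?sqr_ge0//.
  by rewrite expr2 ler_piMl.
have E3 : - X <= energy w f / 4 + 4 * d%:R * c * lsum (fun x => v x * f x ^+ 2).
  have -> : 4 * d%:R * c * lsum (fun x => v x * f x ^+ 2) =
    lsum (fun x => \sum_(i < d) (2 * c * (v x * f x ^+ 2)
      + 2 * c * (v (x + basis i) * f (x + basis i) ^+ 2))).
    rewrite lsum_sum; last by move=> i; fsupp_tac.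
    rewrite (eq_bigr (fun=> 4 * c * lsum (fun x => v x * f x ^+ 2))).
      by rewrite sumr_const card_ord -mulr_natl; ring.
    move=> i _; rewrite lsumD; try fsupp_tac.
    rewrite (lsum_shift (fun x => 2 * c * (v x * f x ^+ 2))) lsumZ; ring.
  rewrite mulrC -lsumN -lsumZ -lsumD//; try fsupp_tac.
  apply: ler_lsum; try fsupp_tac.
  move=> x; rewrite -sumrN mulr_sumr -big_split/=; apply: ler_sum => i _.
  set W := w x + w _; have W0 : 0 <= W by rewrite addr_ge0.
  set g := grad f _; set dw := grad w _; set f' := f (x + _); set v' := v (x + _).
  have /andP[p0 p1] := a01 (x, i); set p := a _ in p0 p1 *.
  have h1 : dw ^+ 2 <= c * W * v x := wv1 x i.
  have h2 : dw ^+ 2 <= c * W * v' := wv2 x i.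
  pose Z := 2 * c * (v x * f x ^+ 2) + 2 * c * (v' * f' ^+ 2).
  have WZ : (dw * (f x + f')) ^+ 2 <= W * Z.
    have -> : W * Z = 2 * (f x ^+ 2 * (c * W * v x)) + 2 * (f' ^+ 2 * (c * W * v')).
      by rewrite /Z; ring.
    have := ler_wpM2l (sqr_ge0 (f x)) h1; have := ler_wpM2l (sqr_ge0 f') h2.
    have := mulr_ge0 (sqr_ge0 dw) (sqr_ge0 (f x - f')).
    nra.
  have v'0 : 0 <= v' := v0 _.
  have Z0 : 0 <= Z.
    by rewrite /Z addr_ge0// mulr_ge0// ?(mulr_ge0 ler0n c0)// mulr_ge0// sqr_ge0.
  have A0 : 0 <= W * g ^+ 2 / 4 + Z.
    by rewrite addr_ge0// divr_ge0// mulr_ge0// sqr_ge0.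
  (* Young's inequality on squares: [WZ] bounds the square of the left side by [W Z g^2], which is
     at most [(W g^2 / 4 + Z)^2]. *)
  have h : - (dw * (f x + f') * g) <= W * g ^+ 2 / 4 + Z.
    apply: ler_normlW; rewrite normrN -ler_sqr ?nnegrE//.
    rewrite real_normK ?num_real// exprMn.
    have := ler_wpM2r (sqr_ge0 g) WZ; have := sqr_ge0 (W * g ^+ 2 / 4 - Z); nra.
  have := ler_wpM2l p0 h; have := ler_piMl Z0 p1; rewrite -/Z; lra.
have E4 : kappa ^+ 2 * (2 * d%:R * energy w f) = kappa / 2 * energy w f.
  transitivity (kappa * (4 * d%:R) * (kappa / 2 * energy w f)); first by field.
  by rewrite kappaE mul1r.
rewrite E1.
have k2 : 0 <= kappa ^+ 2 by exact: sqr_ge0.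
have := ler_wpM2l k2 E2; rewrite E4 => h2.
have := ler_wpM2l (ltW k0) E3; rewrite mulrDr.
set Sv := lsum (fun x => v x * _); have -> : kappa * (4 * d%:R * c * Sv) = c * Sv.
  transitivity (kappa * (4 * d%:R) * (c * Sv)); first by ring.
  by rewrite kappaE mul1r.
lra.
Qed.

End Walk.

(** * The heat kernel and Nash's inequality *)

Section HeatKernel.
Variables (R : realType) (d : nat) (a : edge d -> R).
Implicit Types (f g w v : vertex d -> R) (x y z : vertex d) (e b : edge d).

(* [heat n y x] is the probability that the lazy walk with generator
   [- kappa * elliptic_op a] goes from [x] to [y] in [n] steps. *)
Definition heat n y : vertex d -> R :=
  iter n (walk_op a) (fun x => (x == y)%:R).

Lemma heatS n y : heat n.+1 y = walk_op a (heat n y).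
Proof. by []. Qed.

Lemma fsupp_iter_walk n f : fsupp f -> fsupp (iter n (walk_op a) f).
Proof. by move=> ff; elim: n => [//|n IH] /=; exact: fsupp_walk. Qed.

Lemma fsupp_heat n y : fsupp (heat n y).
Proof. by apply: fsupp_iter_walk; exact: fsupp_delta. Qed.

Lemma iter_walk_sym n f g : fsupp f -> fsupp g ->
  lsum (fun x => g x * iter n (walk_op a) f x) =
  lsum (fun x => iter n (walk_op a) g x * f x).
Proof.
elim: n f => [//|n IH] f ff fg.
rewrite iterSr IH//; last exact: fsupp_walk.
by rewrite walk_op_sym//; exact: fsupp_iter_walk.
Qed.

Lemma heatD n m y x :
  heat (n + m) y x = lsum (fun z => heat n x z * heat m y z).
Proof.
rewrite /heat iterD -iter_walk_sym; last exact: fsupp_delta.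
  by rewrite lsum_delta.
exact: fsupp_heat.
Qed.

Lemma heat_sym n y x : heat n y x = heat n x y.
Proof.
rewrite -[n in LHS]addn0 heatD -[RHS](lsum_delta y).
by apply: eq_lsum => z; rewrite mulrC.
Qed.

Lemma fsupp_grad_heat n e : fsupp (fun z => grad (heat n z) e).
Proof.
have h x : fsupp (fun z => heat n z x).
  by apply: fsupp_le (fsupp_heat n x) _ => z; rewrite heat_sym.
by apply: fsuppD => //; apply: fsuppN.
Qed.

Lemma grad_heatD n m y e :
  grad (heat (n + m) y) e = lsum (fun z => grad (heat n z) e * heat m y z).
Proof.
rewrite /grad !heatD -lsumB; try by apply: fsuppMr; exact: fsupp_heat.
by apply: eq_lsum => z; rewrite -mulrBl !(heat_sym n z).
Qed.

Lemma mixed_grad_heatD n m e b :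
  grad (heat (n + m) (b.1 + basis b.2)) e - grad (heat (n + m) b.1) e =
  lsum (fun z => grad (heat n z) e * grad (heat m z) b).
Proof.
rewrite !grad_heatD -lsumB; try by apply: fsuppMr; exact: fsupp_heat.
by apply: eq_lsum => z; rewrite -mulrBr /grad !(heat_sym m z).
Qed.

Hypothesis d_gt0 : (0 < d)%N.
Hypothesis a01 : forall e, 0 <= a e <= 1.

Lemma heat_ge0 n y x : 0 <= heat n y x.
Proof.
elim: n x => [|n IH] x; first exact: ler0n.
by rewrite heatS; exact: walk_ge0.
Qed.

Lemma lsum_heat n y : lsum (heat n y) = 1.
Proof.
elim: n => [|n IH]; last by rewrite heatS lsum_walk//; exact: fsupp_heat.
rewrite -[RHS](lsum_delta y (fun=> 1)).
by apply: eq_lsum => x; rewrite mulr1.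
Qed.

End HeatKernel.

Section Nash.
Variables (R : realType) (d : nat).
Implicit Types (f : vertex d -> R) (u x : vertex d).

Definition dirichlet f : R := lsum (fun x => \sum_(i < d) grad f (x, i) ^+ 2).

Lemma dirichlet_ge0 f : 0 <= dirichlet f.
Proof. by apply: lsum_ge0 => x; apply: sumr_ge0 => i _; exact: sqr_ge0. Qed.

(** The triangle inequality in l2, in squared form: each additional unit step costs at most the
    square root of the Dirichlet energy. *)
Lemma shift_energy_basis f u i (k : R) : fsupp f -> 0 <= k ->
  lsum (fun x => (f (x + u) - f x) ^+ 2) <= k ^+ 2 * dirichlet f ->
  lsum (fun x => (f (x + (u + basis i)) - f x) ^+ 2) <=
    (k + 1) ^+ 2 * dirichlet f.
Proof.
move=> ff k0 Nu; set D := dirichlet f in Nu *.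
pose h x := f (x + u) - f x; pose g x := grad f (x + u, i).
have fh : fsupp h by rewrite /h; fsupp_tac.
have fg : fsupp g by exact: (fsupp_shift u (fsupp_grad i ff)).
have -> : lsum (fun x => (f (x + (u + basis i)) - f x) ^+ 2) =
    lsum (fun x => g x ^+ 2) + 2 * lsum (fun x => g x * h x) + lsum (fun x => h x ^+ 2).
  rewrite -lsumZ -!lsumD; try fsupp_tac; apply: eq_lsum => x.
  by rewrite /g /h gradE addrA; ring.
have gD : lsum (fun x => g x ^+ 2) <= D.
  rewrite (lsum_shift (fun x => grad f (x, i) ^+ 2)).
  have fgi j := fsupp_grad j ff.
  apply: ler_lsum; try fsupp_tac.
  by move=> x; rewrite (bigD1 i)//= lerDl sumr_ge0// => j _; exact: sqr_ge0.
have D0 : 0 <= D by exact: dirichlet_ge0.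
have := lsum_CS fg fh; set B := lsum (fun x => g x * h x) => BD.
have B2 : B <= k * D.
  apply: ler_normlW; rewrite -ler_sqr ?nnegrE ?mulr_ge0// real_normK ?num_real//.
  apply: le_trans BD _; rewrite (_ : (k * D) ^+ 2 = D * (k ^+ 2 * D)); last by ring.
  by apply: ler_pM => //; apply: lsum_ge0 => x; exact: sqr_ge0.
have {}Nu : lsum (fun x => h x ^+ 2) <= k ^+ 2 * D := Nu.
lra.
Qed.

Definition cube_point r (z : {ffun 'I_d -> 'I_r}) : vertex d :=
  \row_i (z i : nat)%:Z.

Lemma cube_point_inj r : injective (@cube_point r).
Proof.
move=> z t /rowP zt; apply/ffunP => i; have := zt i; rewrite !mxE => /eqP.
by rewrite eqz_nat => /eqP/val_inj.
Qed.

Lemma cube_pointE r (z : {ffun 'I_d -> 'I_r}) :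
  cube_point z = \sum_(i < d) basis i *+ z i.
Proof.
apply/rowP => j; rewrite !mxE summxE (bigD1 j)//= mulmxnE !mxE !eqxx.
rewrite big1 ?addr0 ?natz// => i ij.
by rewrite mulmxnE !mxE eqxx eq_sym (negbTE ij) mul0rn.
Qed.

(** A coordinate path joins 0 to a point of the cube in [\sum_i z i <= d r] unit steps. *)
Lemma shift_energy_cube f r (z : {ffun 'I_d -> 'I_r}) : fsupp f ->
  lsum (fun x => (f (x + cube_point z) - f x) ^+ 2) <=
  (d * r)%:R ^+ 2 * dirichlet f.
Proof.
move=> ff; pose N u := lsum (fun x => (f (x + u) - f x) ^+ 2).
have step n u i k : N u <= k%:R ^+ 2 * dirichlet f ->
    N (u + basis i *+ n) <= (k + n)%:R ^+ 2 * dirichlet f.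
  move=> Nu; elim: n => [|n IH]; first by rewrite mulr0n !addr0 addn0.
  rewrite mulrSr addrA addnS -natr1; exact: shift_energy_basis.
have sumN (s : seq 'I_d) : N (\sum_(i <- s) basis i *+ z i) <=
    (\sum_(i <- s) z i)%:R ^+ 2 * dirichlet f.
  elim: s => [|i s IH].
    rewrite !big_nil expr0n mul0r /N /lsum fsbig1// => x _.
    by rewrite addr0 subrr expr0n.
  by rewrite !big_cons addrC addnC; exact: step.
rewrite cube_pointE; apply: le_trans (sumN _) _.
rewrite ler_wpM2r ?dirichlet_ge0// ler_sqr ?nnegrE// ler_nat.
rewrite -[d in leqRHS](card_ord d) -sum_nat_const.
by apply: leq_sum => i _; exact/ltnW/ltn_ord.
Qed.

(* Compare [f] with its averages over the translates by a cube of side [r]. *)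
Lemma nash f r : fsupp f -> (forall x, 0 <= f x) ->
  (r ^ d)%:R * lsum (fun x => f x ^+ 2) <=
  lsum f ^+ 2 + (r ^ d)%:R * (d * r)%:R ^+ 2 * dirichlet f.
Proof.
move=> ff f0; pose I := {ffun 'I_d -> 'I_r}.
have cardI : #|{: I}| = (r ^ d)%N by rewrite card_ffun !card_ord.
set S := lsum (fun x => f x ^+ 2).
(* Sum over the cube of the identity [f^2 + f'^2 = 2 f f' + (f' - f)^2], where [f'] is the translate
   of [f]. *)
have E : \sum_(z : I) 2 * S =
  2 * lsum (fun x => f x * \sum_(z : I) f (x + cube_point z)) +
  \sum_(z : I) lsum (fun x => (f (x + cube_point z) - f x) ^+ 2).
  rewrite (eq_lsum (f := fun x => f x * _) (g := fun x => \sum_(z : I) f x * f (x + cube_point z))); last first.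
    by move=> x; rewrite mulr_sumr.
  rewrite lsum_sum; last by move=> z; fsupp_tac.
  rewrite [X in _ = X + _]mulr_sumr -big_split /=; apply: eq_bigr => z _.
  have -> : 2 * S = S + lsum (fun x => f (x + cube_point z) ^+ 2).
    by rewrite (lsum_shift (fun x => f x ^+ 2)) -/S; ring.
  rewrite -lsumZ -!lsumD; try fsupp_tac; apply: eq_lsum => x; ring.
(* The translates of [x] by the cube are distinct points, so the inner sum is at most the total mass
   of [f]. *)
have le1 : lsum (fun x => f x * \sum_(z : I) f (x + cube_point z)) <= lsum f ^+ 2.
  rewrite expr2 -lsumZ; apply: ler_lsum; try fsupp_tac.
  move=> x; rewrite [leRHS]mulrC ler_wpM2l//.
  rewrite -(lsum_shift f x) -(big_map (@cube_point r) xpredT (fun u => f (x + u))).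
  under eq_bigr do rewrite addrC.
  apply: (@ler_lsum_seq _ _ _ (fun u => f (u + x))); first by fsupp_tac.
    by move=> u; exact: f0.
  by rewrite map_inj_uniq ?index_enum_uniq//; exact: cube_point_inj.
have le2 : \sum_(z : I) lsum (fun x => (f (x + cube_point z) - f x) ^+ 2) <=
    (r ^ d)%:R * ((d * r)%:R ^+ 2 * dirichlet f).
  rewrite -cardI mulr_natl -sumr_const; apply: ler_sum => z _.
  exact: shift_energy_cube.
have D0 : 0 <= (r ^ d)%:R * ((d * r)%:R ^+ 2 * dirichlet f).
  by rewrite !mulr_ge0// ?dirichlet_ge0// sqr_ge0.
move: E; rewrite sumr_const cardI -[LHS]mulr_natl; lra.
Qed.

End Nash.

(** * Recursive inequalities *)

Section Iterations.
Variable R : realType.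

(** The diffusive length at time [n]; the shift by one keeps it at least 1, also at time 0. *)
Definition rootS n : R := Num.sqrt n.+1%:R.

Lemma rootS_ge1 n : 1 <= rootS n.
Proof. by rewrite -[leLHS]sqrtr1 ler_sqrt// ler1n. Qed.

Lemma rootS_gt0 n : 0 < rootS n.
Proof. exact: lt_le_trans (rootS_ge1 n). Qed.

Lemma sqr_rootS n : rootS n ^+ 2 = n.+1%:R.
Proof. by rewrite sqr_sqrtr. Qed.

Lemma ler_rootS m n : (m <= n)%N -> rootS m <= rootS n.
Proof. by move=> mn; rewrite ler_sqrt// ler_nat. Qed.

Lemma bernoulli_le (x : R) n : 0 <= x <= 1 -> 1 - n%:R * x <= (1 - x) ^+ n.
Proof.
move=> /andP[x0 x1]; elim: n => [|n IH]; first by rewrite mul0r subr0 expr0.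
rewrite exprS; have x2 : 0 <= 1 - x by lra.
have := ler_wpM2l x2 IH; have n0 : 0 <= n%:R :> R by [].
have := mulr_ge0 n0 (sqr_ge0 x); rewrite -natr1; nra.
Qed.

(** A discrete form of Nash's differential inequality. With [r] proportional to the diffusive length
    [s] and [t = K r^2], one step gains the factor [1 - 1/(2t)] relative to the bound [A / s^d]; a
    small enough proportion makes this gain beat the growth of [s^d]. *)
Lemma nash_iteration (K : R) d : 1 <= K ->
  exists2 A : R, 0 < A & forall S : nat -> R,
    S 0%N <= 1 -> (forall n, S n.+1 <= S n) ->
    (forall n r, (0 < r)%N ->
       (r ^ d)%:R * S n <= 1 + (r ^ d)%:R * (K * r%:R ^+ 2 * (S n - S n.+1))) ->
    forall n, S n <= A / rootS n ^+ d.
Proof.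
move=> K1; pose rho := (Num.bound (2 * K * d%:R)).+1.
have rhoP : 2 * K * d%:R <= rho%:R ^+ 2.
  have : 2 * K * d%:R <= rho%:R.
    rewrite /rho -natr1; have := archi_boundP (x := 2 * K * d%:R).
    by rewrite !mulr_ge0 ?(le_trans ler01 K1)// => /(_ isT); lra.
  have : (1 : R) <= rho%:R by rewrite ler1n.
  nra.
have rho1 : (1 : R) <= rho%:R by rewrite ler1n.
(* The power [(2 rho)^d] covers the times with [s < rho], where [S <= 1] is enough; beyond them
   [s <= 2 rho r] gives [s^d <= (A / 2) r^d], so the constant 1 in Nash's inequality uses only half
   of [A]. *)
pose A : R := 2 * (2 * rho%:R) ^+ d.
have A0 : 0 < A by rewrite mulr_gt0// exprn_gt0// mulr_gt0// ltr0n.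
exists A => // S S0 Sdecr SN.
have S1 n : S n <= 1 by elim: n => // n; exact: le_trans.
elim=> [|n IH].
  rewrite ler_pdivlMr ?exprn_gt0 ?rootS_gt0// /rootS sqrtr1 expr1n mulr1.
  apply: le_trans S0 _; rewrite /A.
  have : 1 <= (2 * rho%:R) ^+ d :> R by apply: exprn_ege1; lra.
  lra.
set s := rootS n in IH *; set s' := rootS n.+1.
have s0 : 0 < s by exact: rootS_gt0.
have s'0 : 0 < s' by exact: rootS_gt0.
have s1 : 1 <= s by exact: rootS_ge1.
have s'E : s' ^+ 2 = s ^+ 2 + 1 by rewrite !sqr_rootS natr1.
have [srho|rhos] := ltP s rho%:R.
  rewrite ler_pdivlMr ?exprn_gt0//.
  have : s' ^+ d <= (2 * rho%:R) ^+ d.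
    rewrite lerXn2r ?nnegrE ?mulr_ge0 ?(ltW s'0)//.
    rewrite -ler_sqr ?nnegrE ?mulr_ge0 ?(ltW s'0)//; nra.
  have X0 : 0 <= s' ^+ d by rewrite exprn_ge0// ltW.
  have := S1 n.+1; rewrite /A; nra.
pose r := Num.truncn (s / rho%:R).
have rho0 : 0 < rho%:R :> R by rewrite ltr0n.
have sr1 : 1 <= s / rho%:R by rewrite ler_pdivlMr// mul1r.
have /andP[r1 r2] : r%:R <= s / rho%:R < r.+1%:R.
  by apply: truncn_itv; apply: le_trans sr1.
have r0 : (0 < r)%N by rewrite truncn_gt0.
have r3 : r%:R * rho%:R <= s by rewrite -ler_pdivlMr.
have r4 : s <= 2 * rho%:R * r%:R.
  move: r2; rewrite ltr_pdivrMr// -natr1 => r2.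
  have : (1 : R) <= r%:R by rewrite ler1n.
  nra.
have rR1 : (1 : R) <= r%:R by rewrite ler1n.
have := SN n r r0; rewrite natrX.
set rd := r%:R ^+ d; set t := K * _ => h.
have rd0 : 0 < rd by rewrite exprn_gt0// ltr0n.
have t1 : 1 <= t by rewrite /t; have := exprn_ege1 2 rR1; nra.
have sd0 : 0 < s ^+ d by rewrite exprn_gt0.
have s'd0 : 0 < s' ^+ d by rewrite exprn_gt0.
have rds : s ^+ d <= A / 2 * rd.
  have -> : A / 2 = (2 * rho%:R) ^+ d by rewrite /A mulrAC mulfV// mul1r.
  by rewrite -exprMn lerXn2r ?nnegrE ?mulr_ge0// ltW.
have IH' : S n * s ^+ d <= A by rewrite -ler_pdivlMr.
(* after multiplication by [s ^+ d]: t S' <= (t - 1/2) A *)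
have h2 : t * (S n.+1 * s ^+ d) <= (t - 2^-1) * A.
  have h3 : rd * (t * S n.+1) <= 1 + rd * ((t - 1) * S n) by lra.
  have h4 := ler_wpM2r (ltW sd0) h3.
  have h5 : rd * ((t - 1) * (S n * s ^+ d)) <= rd * ((t - 1) * A).
    by rewrite ler_wpM2l ?(ltW rd0)// ler_wpM2l// subr_ge0.
  rewrite -(ler_pM2l rd0); lra.
rewrite ler_pdivlMr//.
(* Here [(s / s')^2 = 1 - 1 / s'^2]. Bounding [s / s'] below by its square makes Bernoulli's
   inequality applicable with exponent [d], whatever its parity. *)
have key : (1 - (2 * t)^-1) * s' ^+ d <= s ^+ d.
  have t0 : 0 < t by lra.
  have b : 1 - d%:R * (s' ^+ 2)^-1 <= (1 - (s' ^+ 2)^-1) ^+ d.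
    apply: bernoulli_le; rewrite invr_ge0 sqr_ge0/= invf_le1 ?exprn_gt0//.
    by rewrite s'E; have := sqr_ge0 s; lra.
  have e1 : 1 - (s' ^+ 2)^-1 = (s / s') ^+ 2.
    rewrite expr_div_n s'E; field; rewrite -s'E; exact/lt0r_neq0/exprn_gt0.
  have ss' : s / s' <= 1.
    by rewrite ler_pdivrMr// mul1r ler_rootS.
  have ss'0 : 0 <= s / s' by rewrite divr_ge0// ltW.
  have e2 : (1 - (s' ^+ 2)^-1) ^+ d <= (s / s') ^+ d.
    by rewrite e1 lerXn2r ?nnegrE ?exprn_ge0// expr2 ler_piMl.
  have e3 : d%:R * (s' ^+ 2)^-1 <= (2 * t)^-1.
    rewrite ler_pdivrMr ?exprn_gt0// mulrC ler_pdivlMr; last by lra.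
    have : (r%:R * rho%:R) ^+ 2 <= s ^+ 2 by rewrite lerXn2r ?nnegrE ?mulr_ge0// ltW.
    have := ler_wpM2r (sqr_ge0 (r%:R : R)) rhoP.
    rewrite s'E /t; nra.
  have : 1 - (2 * t)^-1 <= (s / s') ^+ d.
    by apply: le_trans (le_trans b e2); rewrite lerD2l lerN2.
  by rewrite expr_div_n ler_pdivlMr.
have t0 : 0 < t by lra.
rewrite -(ler_pM2r sd0) -(ler_pM2l t0).
have -> : t * (S n.+1 * s' ^+ d * s ^+ d) = t * (S n.+1 * s ^+ d) * s' ^+ d by ring.
apply: (@le_trans _ _ ((t - 2^-1) * A * s' ^+ d)); first by rewrite ler_wpM2r// ltW.
have -> : (t - 2^-1) * A * s' ^+ d = t * (A * ((1 - (2 * t)^-1) * s' ^+ d)).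
  by field; lra.
by rewrite ler_pM2l// ler_pM2l.
Qed.

(** Discrete Gronwall. If [M] is at most [(1 + 2 C) s^(k+2)], one step adds at most
    [((1 + 2 C) / 2 + C) s^k <= (1 + 2 C) s^k], while [s^(k+2)] grows by at least [s^k] because
    [s^2] grows by 1. The factor 1/2 in the hypothesis leaves the room for [C]. *)
Lemma moment_iteration (C : R) k (M : nat -> R) : 0 <= C -> M 0%N <= 1 ->
  (forall n, M n.+1 <= M n + M n / (2 * n.+1%:R) + C * rootS n ^+ k) ->
  forall n, M n <= (1 + 2 * C) * rootS n ^+ k.+2.
Proof.
move=> C0 M0 Mstep; elim=> [|n IH].
  by rewrite /rootS sqrtr1 expr1n mulr1; lra.
apply: le_trans (Mstep n) _; rewrite -(sqr_rootS n).
set s := rootS n in IH *; set s' := rootS n.+1.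
have s0 : 0 < s by exact: rootS_gt0.
have s'E : s' ^+ 2 = s ^+ 2 + 1 by rewrite !sqr_rootS natr1.
have sk : s ^+ k <= s' ^+ k.
  by rewrite lerXn2r ?nnegrE ?(ltW (rootS_gt0 _))// ler_rootS.
have expX x : x ^+ k.+2 = x ^+ k * x ^+ 2 :> R by rewrite -exprD addn2.
have h : M n / (2 * s ^+ 2) <= (1 + 2 * C) / 2 * s ^+ k.
  rewrite ler_pdivrMr ?mulr_gt0 ?exprn_gt0//; apply: le_trans IH _.
  by rewrite expX; lra.
have := ler_wpM2r (sqr_ge0 s') sk; rewrite !expX s'E in IH * => sk2.
have sk0 : 0 <= s ^+ k by rewrite exprn_ge0// ltW.
have C1 : 0 <= 1 + 2 * C by lra.
have := ler_wpM2l C1 sk2; have := mulr_ge0 C0 sk0; move: IH h sk0.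
move: (s ^+ k) (s' ^+ k) (s ^+ 2) (M n / _) => p p' q D.
lra.
Qed.

Lemma ler_pow_sub (u v b : R) k : 0 <= u <= b -> 0 <= v <= b ->
  `|u ^+ k.+1 - v ^+ k.+1| <= k.+1%:R * `|u - v| * b ^+ k.
Proof.
move=> /andP[u0 ub] /andP[v0 vb]; rewrite subrXX normrM [k.+1%:R * _]mulrC -mulrA ler_wpM2l//.
apply: le_trans (ler_norm_sum _ _ _) _.
rewrite mulr_natl -[X in _ *+ X](card_ord k.+1) -sumr_const; apply: ler_sum => i _.
have ik : (i <= k)%N by rewrite -ltnS.
rewrite /= ?subSS ?subn1 /= ger0_norm ?mulr_ge0 ?exprn_ge0// -[in leRHS](subnK ik) exprD.
by rewrite ler_pM ?exprn_ge0// lerXn2r ?nnegrE// (le_trans _ ub).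
Qed.

(** Meant for the values of [bracket2] at the ends of an edge. The difference of powers is of order
    [u^k |u - v|], whose square is of order [u^(2k+1)], that is a weight times a power one lower:
    the hypothesis of [energy_step]. *)
Lemma sqr_pow_sub (u v : R) k : 1 <= u -> 1 <= v ->
  (u - v) ^+ 2 <= 8 * u -> u <= 3 * v -> v <= 3 * u ->
  (u ^+ k.+1 - v ^+ k.+1) ^+ 2 <=
   8 * k.+1%:R ^+ 2 * 3 ^+ k * (u ^+ k.+1 + v ^+ k.+1) * u ^+ k.
Proof.
move=> u1 v1 uv uv3 vu3; set b := Num.max u v.
have u0 : 0 <= u by lra.
have v0 : 0 <= v by lra.
have ub : u <= b by rewrite le_max lexx.
have vb : v <= b by rewrite le_max lexx orbT.
have b0 : 0 <= b by exact: le_trans ub.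
have b3 : b ^+ k <= 3 ^+ k * u ^+ k.
  by rewrite -exprMn lerXn2r ?nnegrE ?mulr_ge0// ge_max vu3 andbT; lra.
have bk : b ^+ k.+1 <= u ^+ k.+1 + v ^+ k.+1.
  rewrite /b /Num.max; case: ifP => _; first by rewrite lerDr exprn_ge0.
  by rewrite lerDl exprn_ge0.
have h : `|u ^+ k.+1 - v ^+ k.+1| <= k.+1%:R * `|u - v| * b ^+ k.
  by apply: ler_pow_sub; rewrite ?u0 ?v0.
have {}h := lerXn2r 2 (normr_ge0 _) (le_trans (normr_ge0 _) h) h.
rewrite -[leLHS]real_normK ?num_real//; apply: le_trans h _.
rewrite !exprMn real_normK ?num_real//.
apply: (@le_trans _ _ (k.+1%:R ^+ 2 * (8 * b) * b ^+ k ^+ 2)).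
  rewrite ler_wpM2r ?sqr_ge0// ler_wpM2l ?sqr_ge0// (le_trans uv)//.
  by rewrite ler_wpM2l.
have -> : k.+1%:R ^+ 2 * (8 * b) * b ^+ k ^+ 2 =
    8 * k.+1%:R ^+ 2 * (b ^+ k.+1 * b ^+ k).
  by rewrite (exprS b); move: (b ^+ k) (k.+1%:R) => p c; ring.
set w := u ^+ k.+1 + _ in bk *.
have -> : 8 * k.+1%:R ^+ 2 * 3 ^+ k * w * u ^+ k =
    8 * k.+1%:R ^+ 2 * (w * (3 ^+ k * u ^+ k)).
  by move: (3 ^+ k) (u ^+ k) (k.+1%:R) => p q c; ring.
by rewrite ler_wpM2l ?mulr_ge0 ?sqr_ge0// ler_pM ?exprn_ge0.
Qed.

End Iterations.

(** * Weighted bounds on the heat kernel *)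

Section Weights.
Variables (R : realType) (d : nat).
Implicit Types (u x y z : vertex d) (f w v : vertex d -> R).

Definition bracket2 x : R := 1 + \sum_(i < d) (x 0 i)%:~R ^+ 2.

Lemma sqr_coord_le x i : ((x 0 i)%:~R : R) ^+ 2 <= bracket2 x - 1.
Proof.
rewrite /bracket2 addrC addKr (bigD1 i)//= lerDl.
by apply: sumr_ge0 => j _; exact: sqr_ge0.
Qed.

Lemma bracket2_ge1 x : 1 <= bracket2 x.
Proof. by rewrite lerDl; apply: sumr_ge0 => i _; exact: sqr_ge0. Qed.

Lemma bracket2_gt0 x : 0 < bracket2 x.
Proof. exact: lt_le_trans (bracket2_ge1 x). Qed.

Lemma bracket2N x : bracket2 (- x) = bracket2 x.
Proof. by congr (1 + _); apply: eq_bigr => i _; rewrite mxE rmorphN sqrrN. Qed.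

Lemma bracket2_basis x i :
  bracket2 (x + basis i) = bracket2 x + 2 * (x 0 i)%:~R + 1.
Proof.
rewrite /bracket2 (bigD1 i)//= [in RHS](bigD1 i)//= !mxE !eqxx.
rewrite (eq_bigr (fun j => (x 0 j)%:~R ^+ 2)); last first.
  by move=> j ji; rewrite !mxE eqxx (negbTE ji) addr0.
by rewrite rmorphD rmorph1; ring.
Qed.

Lemma bracket2D x y : bracket2 (x + y) <= 2 * (bracket2 x + bracket2 y).
Proof.
rewrite /bracket2 -[leLHS]addr0.
have : \sum_(i < d) ((x + y) 0 i)%:~R ^+ 2 <=
    2 * (\sum_(i < d) (x 0 i)%:~R ^+ 2 + \sum_(i < d) (y 0 i)%:~R ^+ 2) :> R.
  rewrite -big_split/= mulr_sumr; apply: ler_sum => i _.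
  rewrite !mxE rmorphD; have := sqr_ge0 ((x 0 i)%:~R - (y 0 i)%:~R : R); lra.
lra.
Qed.

Lemma sqr_bracket2_sub x i :
  [/\ (bracket2 x - bracket2 (x + basis i)) ^+ 2 <= 8 * bracket2 x,
      (bracket2 (x + basis i) - bracket2 x) ^+ 2 <= 8 * bracket2 (x + basis i),
      bracket2 x <= 3 * bracket2 (x + basis i)
    & bracket2 (x + basis i) <= 3 * bracket2 x].
Proof.
have h1 := sqr_coord_le x i; have h2 := sqr_coord_le (x + basis i) i.
move: h2; rewrite !mxE !eqxx rmorphD rmorph1 bracket2_basis.
have := bracket2_ge1 x; move: (bracket2 x) ((x 0 i)%:~R : R) h1 => q t h1 h2 h3.
have := sqr_ge0 (2 * t - 1); have := sqr_ge0 (2 * t + 3).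
by move=> h4 h5; split; lra.
Qed.

(** The square root of this weight grows like the distance [D] to the power [d + 2]. The mixed
    derivative is thus of order [D^(-d-2)] at each of the about [D^2] times before diffusion reaches
    that distance, and these add up to the required [D^(-d)]. *)
Definition weight y x : R := bracket2 (x - y) ^+ d.+2.

Lemma weight_ge0 y x : 0 <= weight y x.
Proof. by rewrite exprn_ge0// ltW// bracket2_gt0. Qed.

Definition cweight : R := 8 * d.+2%:R ^+ 2 * 3 ^+ d.+1.

Lemma cweight_gt0 : 0 < cweight.
Proof. by rewrite /cweight !mulr_gt0// exprn_gt0. Qed.

Lemma sqr_grad_weight y x i :
  grad (weight y) (x, i) ^+ 2 <=
    cweight * (weight y x + weight y (x + basis i)) * bracket2 (x - y) ^+ d.+1
  /\ grad (weight y) (x, i) ^+ 2 <=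
    cweight * (weight y x + weight y (x + basis i)) *
      bracket2 (x + basis i - y) ^+ d.+1.
Proof.
have [h1 h2 h3 h4] := sqr_bracket2_sub (x - y) i.
rewrite gradE /weight addrAC; split.
  rewrite -sqrrN opprB; apply: sqr_pow_sub => //; exact: bracket2_ge1.
rewrite [bracket2 (x - y) ^+ _ + _]addrC.
apply: sqr_pow_sub => //; exact: bracket2_ge1.
Qed.

Definition wdirichlet w f : R :=
  lsum (fun x => \sum_(i < d) w x * grad f (x, i) ^+ 2).

Lemma fsupp_wdirichlet w f : fsupp f ->
  fsupp (fun x => \sum_(i < d) w x * grad f (x, i) ^+ 2).
Proof.
move=> ff; have fg i := fsupp_grad i ff.
by apply: fsupp_sum => i; apply: fsuppMr; apply: fsuppX.
Qed.

Lemma wdirichletD w v f : fsupp f ->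
  wdirichlet (fun x => w x + v x) f = wdirichlet w f + wdirichlet v f.
Proof.
move=> ff; rewrite /wdirichlet -lsumD; try exact: fsupp_wdirichlet.
apply: eq_lsum => x; rewrite -big_split/=; apply: eq_bigr => i _.
by rewrite mulrDl.
Qed.

Lemma wdirichlet_cst c f : wdirichlet (fun=> c) f = c * dirichlet f.
Proof.
by rewrite -lsumZ; apply: eq_lsum => x; rewrite mulr_sumr.
Qed.

Lemma wdirichlet_ge0 w f : (forall x, 0 <= w x) -> 0 <= wdirichlet w f.
Proof.
move=> w0; apply: lsum_ge0 => x; apply: sumr_ge0 => i _.
by rewrite mulr_ge0 ?sqr_ge0.
Qed.

End Weights.

Section HeatKernelBounds.
Variables (R : realType) (d : nat) (lambda : R).
Hypotheses (d_gt0 : (0 < d)%N) (lambda_gt0 : 0 < lambda).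
Implicit Types (a : edge d -> R) (x y z : vertex d) (f w : vertex d -> R).

Let elliptic a := forall e, lambda <= a e <= 1.

Lemma elliptic01 a : elliptic a -> forall e, 0 <= a e <= 1.
Proof. by move=> ea e; have /andP[/(le_trans (ltW lambda_gt0)) -> ->] := ea e. Qed.

Lemma wdirichlet_energy a w f : elliptic a -> fsupp f -> (forall x, 0 <= w x) ->
  lambda * wdirichlet w f <= energy a w f.
Proof.
move=> ea ff w0; have fg i := fsupp_grad i ff.
rewrite -lsumZ; apply: ler_lsum.
- by apply: fsuppMr; exact: fsupp_wdirichlet.
- by apply: fsupp_sum => i; apply: fsuppMr; apply: fsuppMr; apply: fsuppX.
move=> x; rewrite mulr_sumr; apply: ler_sum => i _.
have /andP[l _] := ea (x, i).
rewrite mulrCA; apply: ler_pM => //.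
- by rewrite mulr_ge0 ?sqr_ge0// ltW.
- by rewrite lerDl.
- by rewrite ler_wpM2r ?sqr_ge0.
Qed.

Local Notation kap := (kappa R d).
Let kap_gt0 : 0 < kap := kappa_gt0 R d_gt0.

Definition heat2 a n y := lsum (fun x => heat a n y x ^+ 2).

Lemma heat2_step a n y : elliptic a ->
  heat2 a n.+1 y + kap / 4 * lambda * dirichlet (heat a n y) <= heat2 a n y.
Proof.
move=> ea.
set p := heat a n y; have fp : fsupp p by exact: fsupp_heat.
have : lsum (fun x => 1 * walk_op a p x ^+ 2) + kap / 4 * energy a (fun=> 1) p <=
    lsum (fun x => 1 * p x ^+ 2) + 0 * lsum (fun x => 0 * p x ^+ 2).
  apply: energy_step => //; first exact: elliptic01.
  - by move=> x i; rewrite gradE subrr expr0n !mul0r.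
  - by move=> x i; rewrite gradE subrr expr0n !mul0r.
rewrite mul0r addr0 !lsumZ !mul1r; apply: le_trans.
rewrite lerD2l -mulrA ler_wpM2l ?divr_ge0 ?(ltW kap_gt0)//.
rewrite -[dirichlet _]mul1r -wdirichlet_cst.
by apply: wdirichlet_energy => //; exact: fsupp_heat.
Qed.

Lemma heat2_le : exists2 A : R, 0 < A &
  forall a, elliptic a -> forall n y, heat2 a n y <= A / rootS R n ^+ d.
Proof.
(* The factor [d^2] comes from [nash], the inverse from trading the Dirichlet energy for the
   decrease of [heat2]; the summand 1 secures [1 <= K]. *)
pose K := 1 + d%:R ^+ 2 * (kap / 4 * lambda)^-1.
have kl0 : 0 < kap / 4 * lambda by rewrite mulr_gt0// divr_gt0.
have K1 : 1 <= K.
  by rewrite lerDl mulr_ge0 ?sqr_ge0// invr_ge0 ltW.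
have [A A0 HA] := nash_iteration d K1; exists A => // a ea n y.
apply: (HA (fun n => heat2 a n y)) => {n}.
- rewrite /heat2 (eq_lsum (g := fun x => (x == y)%:R * 1)) ?lsum_delta// => x.
  by rewrite /heat/=; case: eqP; rewrite ?expr1n ?expr0n ?mulr1.
- move=> n; apply: le_trans (heat2_step n y ea).
  by rewrite lerDl mulr_ge0 ?(ltW kl0)// dirichlet_ge0.
move=> n r r0.
have := nash r (fsupp_heat a n y) (heat_ge0 d_gt0 (elliptic01 ea) n y).
rewrite lsum_heat expr1n -/(heat2 a n y) => h.
apply: le_trans h _; rewrite lerD2l -mulrA ler_wpM2l//.
have := heat2_step n y ea; rewrite -lerBrDl => h.
have D0 : 0 <= dirichlet (heat a n y) by exact: dirichlet_ge0.
have h2 : dirichlet (heat a n y) <=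
    (kap / 4 * lambda)^-1 * (heat2 a n y - heat2 a n.+1 y).
  by rewrite mulrC ler_pdivlMr// mulrC.
rewrite natrM exprMn.
have rr : 0 <= r%:R ^+ 2 :> R by exact: sqr_ge0.
have dd : 0 <= d%:R ^+ 2 :> R by exact: sqr_ge0.
have h3 := ler_wpM2l (mulr_ge0 dd rr) h2.
have h4 : 0 <= r%:R ^+ 2 * (heat2 a n y - heat2 a n.+1 y).
  by rewrite mulr_ge0// (le_trans _ h)// mulr_ge0// ltW.
rewrite /K; lra.
Qed.

Definition moment a n y := lsum (fun x => weight R y x * heat a n y x ^+ 2).

Lemma moment_step : exists2 C : R, 0 < C & forall a, elliptic a -> forall n y,
  moment a n.+1 y + kap / 4 * lambda * wdirichlet (weight R y) (heat a n y) <=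
  moment a n y + moment a n y / (2 * n.+1%:R) + C * rootS R n ^+ d.+2.
Proof.
have [A A0 HA] := heat2_le.
have [c cE c0] : exists2 c : R, c = cweight R d & 0 < c.
  by exists (cweight R d); rewrite ?cweight_gt0.
exists (c * (2 * c) ^+ d.+1 * A) => [|a ea n y].
  by rewrite !mulr_gt0// exprn_gt0// mulr_gt0.
set p := heat a n y; have fp : fsupp p by exact: fsupp_heat.
pose v x : R := bracket2 R (x - y) ^+ d.+1.
have v0 x : 0 <= v x by rewrite exprn_ge0// ltW// bracket2_gt0.
have h1 : moment a n.+1 y + kap / 4 * energy a (weight R y) p <=
    moment a n y + c * lsum (fun x => v x * p x ^+ 2).
  apply: energy_step => //; first exact: elliptic01.
  - exact: weight_ge0.
  - exact: ltW c0.
  - by move=> x i; rewrite cE; have [] := sqr_grad_weight R y x i.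
  - by move=> x i; rewrite cE; have [] := sqr_grad_weight R y x i.
have h2 : kap / 4 * lambda * wdirichlet (weight R y) p <=
    kap / 4 * energy a (weight R y) p.
  rewrite -mulrA ler_wpM2l ?divr_ge0 ?(ltW kap_gt0)//.
  by apply: wdirichlet_energy => //; exact: weight_ge0.
(* The lower-order weight is split at [bracket2 = t]: above, it is at most [weight / t]; below, at
   most [t^(d+1)], where [heat2_le] applies. This [t] makes the first part exactly the
   [moment / (2 (n + 1))] that [moment_iteration] tolerates. *)
pose t : R := 2 * c * n.+1%:R.
have t0 : 0 < t by rewrite /t !mulr_gt0.
have h3 : lsum (fun x => v x * p x ^+ 2) <= t^-1 * moment a n y + t ^+ d.+1 * heat2 a n y.
  rewrite -!lsumZ -lsumD; try fsupp_tac; apply: ler_lsum; try fsupp_tac.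
  move=> x; rewrite mulrA -mulrDl ler_wpM2r ?sqr_ge0// /weight /v.
  set q := bracket2 _ _; have q0 : 0 < q by exact: bracket2_gt0.
  have [qt|tq] := leP q t.
    rewrite -[leLHS]add0r lerD//.
      by apply: mulr_ge0; [rewrite invr_ge0 ltW|rewrite exprn_ge0// ltW].
    by rewrite lerXn2r ?nnegrE ?(ltW t0) ?(ltW q0).
  rewrite -[leLHS]addr0 lerD ?exprn_ge0 ?(ltW t0)//.
  rewrite [leRHS]mulrC ler_pdivlMr// [leRHS]exprSr.
  by rewrite ler_wpM2l ?exprn_ge0 ?(ltW q0)// ltW.
have h4 : c * (t^-1 * moment a n y) = moment a n y / (2 * n.+1%:R).
  have : n.+1%:R != 0 :> R by rewrite pnatr_eq0.
  by rewrite /t; move: (n.+1%:R) => N N0; field; rewrite N0 lt0r_neq0.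
have h5 : c * (t ^+ d.+1 * heat2 a n y) <= c * (2 * c) ^+ d.+1 * A * rootS R n ^+ d.+2.
  rewrite -!mulrA ler_wpM2l ?(ltW c0)// /t exprMn -mulrA ler_wpM2l//.
    by rewrite exprn_ge0// mulr_ge0// ltW.
  rewrite -(sqr_rootS R n) -exprM.
  have s0 := rootS_gt0 R n.
  apply: le_trans (ler_wpM2l _ (HA a ea n y)) _; first by rewrite exprn_ge0// ltW.
  rewrite mulrCA ler_wpM2l ?(ltW A0)// ler_pdivrMr ?exprn_gt0// -exprD.
  by rewrite (_ : (d.+2 + d)%N = (2 * d.+1)%N)//; lia.
apply: le_trans (lerD (lexx _) h2) _; apply: le_trans h1 _.
rewrite -addrA lerD2l; apply: le_trans (ler_wpM2l (ltW c0) h3) _.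
by rewrite mulrDr h4 lerD2l.
Qed.

Lemma moment_le : exists2 B : R, 0 < B &
  forall a, elliptic a -> forall n y, moment a n y <= B * rootS R n ^+ d.+4.
Proof.
have [C C0 HC] := moment_step; exists (1 + 2 * C); first by lra.
move=> a ea n y; apply: (@moment_iteration R C d.+2 (fun n => moment a n y)).
- exact: ltW.
- rewrite /moment (eq_lsum (g := fun x => (x == y)%:R * weight R y x)).
    by rewrite lsum_delta /weight /bracket2 subrr big1 ?addr0 ?expr1n// => i _; rewrite mxE expr0n.
  by move=> x; rewrite /heat/=; case: eqP; rewrite ?expr1n ?expr0n ?mulr1 ?mul1r ?mulr0 ?mul0r.
- move=> {}n; apply: le_trans (HC a ea n y); rewrite lerDl mulr_ge0//.
    by rewrite mulr_ge0 ?(ltW lambda_gt0)// divr_ge0// ltW.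
  by apply: wdirichlet_ge0; exact: weight_ge0.
Qed.

Lemma sqr_rootS_X n k : n.+1%:R ^+ k = rootS R n ^+ (2 * k).
Proof. by rewrite exprM sqr_rootS. Qed.

(* The weight at scale [sqrt k.+1]. *)
Definition sweight k (u : vertex d) : R := bracket2 R u ^+ d.+2 + k.+1%:R ^+ d.+2.

Lemma sweight_gt0 k (u : vertex d) : 0 < sweight k u.
Proof. by rewrite addr_gt0// exprn_gt0// bracket2_gt0. Qed.

Lemma sweightN k (u : vertex d) : sweight k (- u) = sweight k u.
Proof. by rewrite /sweight bracket2N. Qed.

(** Submultiplicativity, up to a constant, of the weight divided by [(k + 1)^(d+2)]. In the
    constant, one factor 2 comes from [bracket2D] and one from replacing a sum by a maximum. *)
Lemma sweightD k (u v : vertex d) :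
  k.+1%:R ^+ d.+2 * sweight k (u + v) <= 4 ^+ d.+2 * (sweight k u * sweight k v).
Proof.
rewrite /sweight; set N := _ ^+ d.+2; have N0 : 0 < N by rewrite exprn_gt0.
set p := bracket2 R u; set q := bracket2 R v.
have p0 : 0 < p by exact: bracket2_gt0.
have q0 : 0 < q by exact: bracket2_gt0.
have P0 : 0 < p ^+ d.+2 by rewrite exprn_gt0.
have Q0 : 0 < q ^+ d.+2 by rewrite exprn_gt0.
have pq : bracket2 R (u + v) ^+ d.+2 <= 4 ^+ d.+2 * (p ^+ d.+2 + q ^+ d.+2).
  apply: (@le_trans _ _ ((4 * Num.max p q) ^+ d.+2)).
    rewrite lerXn2r ?nnegrE ?mulr_ge0 ?le_max ?(ltW p0) ?(ltW (bracket2_gt0 _ _))//.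
    apply: le_trans (bracket2D _ _ _) _; rewrite -/p -/q.
    have h1 : p <= Num.max p q by rewrite le_max lexx.
    have h2 : q <= Num.max p q by rewrite le_max lexx orbT.
    lra.
  rewrite exprMn ler_wpM2l ?exprn_ge0//.
  by rewrite /Num.max; case: ifP => _; rewrite ?lerDl ?lerDr ltW.
have f1 : 1 <= 4 ^+ d.+2 :> R by apply: exprn_ege1; rewrite ler1n.
move: pq P0 Q0 f1; move: (p ^+ _) (q ^+ _) (bracket2 _ _ ^+ _) (4 ^+ _) => P Q T c.
move=> h P0 Q0 c1.
have h1 : N * T <= N * (c * (P + Q)) by rewrite ler_wpM2l// ltW.
have h2 : N * N <= c * (N * N) by rewrite ler_peMl// mulr_ge0// ltW.
have h3 : 0 <= c * (P * Q) by rewrite !mulr_ge0 ?(ltW P0) ?(ltW Q0)//; lra.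
lra.
Qed.

(** Cauchy-Schwarz for [s f] and [g / s], with [s] the root of the weight between [u] and [z];
    [sweightD] then moves the rest of the weight to the pair [z], [v]. *)
Lemma sweight_CS k u v (f g : vertex d -> R) : fsupp f -> fsupp g ->
  k.+1%:R ^+ d.+2 * sweight k (u - v) * lsum (fun z => f z * g z) ^+ 2 <=
  4 ^+ d.+2 * (lsum (fun z => sweight k (u - z) * f z ^+ 2) *
    lsum (fun z => sweight k (z - v) * g z ^+ 2)).
Proof.
move=> ff fg; pose s z := Num.sqrt (sweight k (u - z)).
have s0 z : 0 < s z by rewrite sqrtr_gt0 sweight_gt0.
have s2 z : s z ^+ 2 = sweight k (u - z) by rewrite sqr_sqrtr// ltW// sweight_gt0.
have -> : lsum (fun z => f z * g z) = lsum (fun z => (s z * f z) * ((s z)^-1 * g z)).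
  by apply: eq_lsum => z; rewrite mulrACA mulfV ?lt0r_neq0// mul1r.
have ff' : fsupp (fun z => s z * f z) by fsupp_tac.
have fg' : fsupp (fun z => (s z)^-1 * g z) by fsupp_tac.
set K := k.+1%:R ^+ d.+2 * sweight k (u - v).
have K0 : 0 <= K by rewrite mulr_ge0 ?exprn_ge0// ltW// sweight_gt0.
apply: le_trans (ler_wpM2l K0 (lsum_CS ff' fg')) _.
rewrite (eq_lsum (g := fun z => sweight k (u - z) * f z ^+ 2)); last first.
  by move=> z; rewrite exprMn s2.
rewrite mulrCA [leRHS]mulrCA ler_wpM2l//.
  by apply: lsum_ge0 => z; rewrite mulr_ge0 ?sqr_ge0// ltW// sweight_gt0.
rewrite -!lsumZ; apply: ler_lsum; try fsupp_tac.
move=> z; have -> : K * ((s z)^-1 * g z) ^+ 2 = K / sweight k (u - z) * g z ^+ 2.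
  by rewrite exprMn exprVn s2 mulrA.
rewrite (mulrA (4 ^+ _)) ler_wpM2r ?sqr_ge0//.
rewrite ler_pdivrMr ?sweight_gt0// mulrAC -mulrA /K.
have -> : u - v = (u - z) + (z - v) by rewrite addrA subrK.
exact: sweightD.
Qed.

Lemma sweight_heat_le : exists2 C : R, 0 < C & forall a, elliptic a ->
  forall k n y, (n <= k)%N -> (k.+1 <= 4 * n.+1)%N ->
  lsum (fun z => sweight k (z - y) * heat a n y z ^+ 2) <= C * rootS R k ^+ d.+4.
Proof.
have [A A0 HA] := heat2_le; have [B B0 HB] := moment_le.
exists (B + 2 ^+ d * A) => [|a ea k n y nk kn].
  by rewrite addr_gt0// mulr_gt0// exprn_gt0.
have -> : lsum (fun z => sweight k (z - y) * heat a n y z ^+ 2) =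
    moment a n y + k.+1%:R ^+ d.+2 * heat2 a n y.
  have fp := fsupp_heat a n y.
  rewrite -lsumZ -lsumD; try fsupp_tac.
  by apply: eq_lsum => z; rewrite /sweight mulrDl.
have s0 := rootS_gt0 R n; have t0 := rootS_gt0 R k.
rewrite mulrDl lerD//.
  apply: le_trans (HB a ea n y) _; rewrite ler_wpM2l ?(ltW B0)//.
  by rewrite lerXn2r ?nnegrE ?(ltW s0) ?(ltW t0)// ler_rootS.
apply: le_trans (ler_wpM2l _ (HA a ea n y)) _; first by rewrite exprn_ge0.
rewrite sqr_rootS_X mulrA ler_pdivrMr ?exprn_gt0//.
have ts : rootS R k <= 2 * rootS R n.
  rewrite -ler_sqr ?nnegrE ?mulr_ge0 ?(ltW s0) ?(ltW t0)// exprMn !sqr_rootS.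
  by rewrite -natrX -natrM ler_nat.
have : rootS R k ^+ d <= (2 * rootS R n) ^+ d.
  by rewrite lerXn2r ?nnegrE ?mulr_ge0 ?(ltW s0) ?(ltW t0).
rewrite exprMn (_ : (2 * d.+2)%N = (d + d.+4)%N); last by lia.
rewrite exprD => h.
have : 0 <= A * rootS R k ^+ d.+4 by rewrite mulr_ge0 ?exprn_ge0 ?(ltW A0) ?(ltW t0).
move=> /ler_wpM2l/(_ _ _ h); lra.
Qed.

(** The dissipation is controlled through a telescoping sum in time: [V] grows by at most [F] per
    step, and at most [k + 1] steps are taken. A window of times appears because this argument does
    not bound the energy at an individual time well enough. *)
Lemma sweight_energy_le : exists2 C : R, 0 < C & forall a, elliptic a ->
  forall k n l y, (n <= k)%N -> (n + l <= k.+1)%N -> (k.+1 <= 4 * n.+1)%N ->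
  \sum_(j < l) wdirichlet (fun x => sweight k (x - y)) (heat a (n + j) y) <=
  C * rootS R k ^+ d.+4.
Proof.
have [B B0 HB] := moment_le; have [C C0 HC] := moment_step.
have [H H0 HH] := sweight_heat_le.
pose eta := kap / 4 * lambda.
have eta0 : 0 < eta by rewrite /eta mulr_gt0// divr_gt0.
exists (eta^-1 * (H + B / 2 + C)) => [|a ea k n l y nk nlk kn].
  by rewrite mulr_gt0 ?invr_gt0// !addr_gt0// divr_gt0.
rewrite -mulrA mulrC ler_pdivlMr// mulrC mulr_sumr.
pose V j := moment a j y + k.+1%:R ^+ d.+2 * heat2 a j y.
pose F := (B / 2 + C) * rootS R k ^+ d.+2.
have t0 := rootS_gt0 R k.
have V0 j : 0 <= V j.
  apply: addr_ge0.
    by apply: lsum_ge0 => x; rewrite mulr_ge0 ?sqr_ge0// weight_ge0.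
  by apply: mulr_ge0; [exact: exprn_ge0|apply: lsum_ge0 => x; exact: sqr_ge0].
have step j : (j <= k)%N -> V j.+1 +
    eta * wdirichlet (fun x => sweight k (x - y)) (heat a j y) <= V j + F.
  move=> jk; rewrite wdirichletD ?wdirichlet_cst; last exact: fsupp_heat.
  have h1 := HC a ea j y; have h2 := heat2_step j y ea.
  have N0 : 0 <= k.+1%:R ^+ d.+2 :> R by rewrite exprn_ge0.
  have {}h2 := ler_wpM2l N0 h2.
  have sj : rootS R j ^+ d.+2 <= rootS R k ^+ d.+2.
    by rewrite lerXn2r ?nnegrE ?(ltW (rootS_gt0 _ _))// ler_rootS.
  have h3 : moment a j y / (2 * j.+1%:R) <= B / 2 * rootS R k ^+ d.+2.
    rewrite -(sqr_rootS R j) ler_pdivrMr ?mulr_gt0 ?exprn_gt0 ?rootS_gt0//.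
    apply: le_trans (HB a ea j y) _.
    rewrite (_ : _ * (2 * _) = B * (rootS R k ^+ d.+2 * rootS R j ^+ 2)); last first.
      by field.
    rewrite ler_wpM2l ?(ltW B0)// -[d.+4]addn2 exprD ler_wpM2r ?sqr_ge0//.
  have h4 : C * rootS R j ^+ d.+2 <= C * rootS R k ^+ d.+2 by rewrite ler_wpM2l ?(ltW C0).
  rewrite /V /F; move: h1 h2 h3 h4; rewrite -/eta.
  move: (rootS R k ^+ _) (rootS R j ^+ _) (k.+1%:R ^+ _) (wdirichlet _ _) (dirichlet _).
  move: (moment _ _ _) (moment _ _ _) (moment _ _ _ / _) (heat2 _ _ _) (heat2 _ _ _).
  by move=> *; lra.
have sum_le : (l <= k.+1 - n)%N -> \sum_(j < l)
    eta * wdirichlet (fun x => sweight k (x - y)) (heat a (n + j) y) <=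
    V n - V (n + l)%N + l%:R * F.
  elim: l {nlk} => [|l IH] lk; first by rewrite big_ord0 addn0 subrr mul0r addr0.
  rewrite big_ord_recr/=.
  have := step (n + l)%N; rewrite addnS -natr1.
  have := IH (ltnW lk) => h1 /(_ ltac:(lia)) h2; lra.
apply: le_trans (sum_le ltac:(lia)) _.
have VH : V n <= H * rootS R k ^+ d.+4.
  have := HH a ea k n y nk kn; congr (_ <= _).
  have fp := fsupp_heat a n y.
  rewrite /V -lsumZ -lsumD; try fsupp_tac.
  by apply: eq_lsum => z; rewrite /sweight mulrDl.
have lF : l%:R * F <= (B / 2 + C) * rootS R k ^+ d.+4.
  rewrite /F mulrCA ler_wpM2l ?addr_ge0 ?divr_ge0 ?(ltW B0) ?(ltW C0)//.
  rewrite -[d.+4]addn2 exprD mulrC ler_wpM2l ?exprn_ge0 ?(ltW t0)// sqr_rootS ler_nat.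
  by lia.
have := V0 (n + l)%N; move: VH lF; move: (rootS R k ^+ _) => s4; lra.
Qed.

End HeatKernelBounds.

(** * Bounds through the semigroup property, and locality *)

(* Splitting times for [k] steps: [n] runs over [win_start k + j] with
   [j < win_size k], so that [n] and [k - n] are both comparable to [k]. *)
Definition win_start k := k./2./2.
Definition win_size k := (k./2 - k./2./2).+1.

Lemma win_bounds k j : (j < win_size k)%N ->
  (win_start k + j <= k)%N /\ (k < 4 * (k - (win_start k + j)).+1)%N.
Proof. by rewrite /win_size /win_start; lia. Qed.

Lemma win_start_bounds k : [/\ (win_start k <= k)%N,
  (win_start k + win_size k <= k.+1)%N & (k.+1 <= 4 * (win_start k).+1)%N].
Proof. by rewrite /win_size /win_start; split; lia. Qed.

(** When [n] runs over the window starting at [win_start k], the complementary times [k - n] run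
    over the one starting at [k - k./2]. *)
Lemma win_end_bounds k : [/\ (k - k./2 <= k)%N,
  (k - k./2 + win_size k <= k.+1)%N & (k.+1 <= 4 * (k - k./2).+1)%N].
Proof. by rewrite /win_size; split; lia. Qed.

Lemma win_size_ge (R : realType) k : k.+1%:R / 4 <= (win_size k)%:R :> R.
Proof.
rewrite ler_pdivrMr// -natrM ler_nat /win_size; lia.
Qed.

Section QuenchedBounds.
Variables (R : realType) (d : nat) (lambda : R).
Hypotheses (d_gt0 : (0 < d)%N) (lambda_gt0 : 0 < lambda).
Implicit Types (a : edge d -> R) (x y z : vertex d) (e b : edge d).

Let elliptic a := forall e, lambda <= a e <= 1.

(* Energy density of the kernel at [e], the vertex argument being summed;
   by stationarity its expectation is that of the total energy. *)
Definition edge_energy k a n e : R :=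
  lsum (fun z => sweight R k (e.1 - z) * grad (heat a n z) e ^+ 2).

Lemma edge_energy_ge0 k a n e : 0 <= edge_energy k a n e.
Proof.
by apply: lsum_ge0 => z; rewrite mulr_ge0 ?sqr_ge0// ltW// sweight_gt0.
Qed.

(** The weighted semigroup estimate is added over all splitting times of the window. The left side
    does not depend on the splitting time, so it gains the window size, at least [(k + 1) / 4],
    while the energies appear summed over time as [sweight_energy_le] requires. *)
Lemma sqr_grad_heat_le : exists2 C : R, 0 < C & forall a, elliptic a ->
  forall k e y,
  rootS R k ^+ d.+2 * (sweight R k (e.1 - y) * grad (heat a k y) e ^+ 2) <=
  C * \sum_(j < win_size k) edge_energy k a (win_start k + j) e.
Proof.
have [H H0 HH] := sweight_heat_le d_gt0 lambda_gt0.
exists (4 * (4 ^+ d.+2 * H)) => [|a ea k e y]; first by rewrite mulr_gt0// mulr_gt0// exprn_gt0.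
have t0 := rootS_gt0 R k; set t := rootS R k in t0 *.
set W := sweight R k _; set g := grad _ _.
have W0 : 0 < W by exact: sweight_gt0.
set S := \sum_(j < _) _.
have : \sum_(j < win_size k) (k.+1%:R ^+ d.+2 * W * g ^+ 2) <=
    4 ^+ d.+2 * (S * (H * t ^+ d.+4)).
  rewrite mulr_suml mulr_sumr; apply: ler_sum => j _.
  have [] := win_bounds (ltn_ord j).
  move: (win_start k + j)%N => n nk kn.
  have gE : g = lsum (fun z => grad (heat a n z) e * heat a (k - n) y z).
    by rewrite -grad_heatD subnKC.
  rewrite gE; apply: le_trans (sweight_CS _ _ _ _ _) _.
  - exact: fsupp_grad_heat.
  - exact: fsupp_heat.
  rewrite ler_wpM2l ?exprn_ge0// ler_wpM2l ?edge_energy_ge0//.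
  by apply: HH => //; exact: leq_subr.
rewrite sumr_const card_ord -[leLHS]mulr_natl sqr_rootS_X -/t => h.
have t4 : 0 < t ^+ d.+4 by rewrite exprn_gt0.
have t2 : 0 < t ^+ d.+2 by rewrite exprn_gt0.
have g0 : 0 <= g ^+ 2 by exact: sqr_ge0.
rewrite -(ler_pM2r t4).
have -> : 4 * (4 ^+ d.+2 * H) * S * t ^+ d.+4 = 4 * (4 ^+ d.+2 * (S * (H * t ^+ d.+4))).
  by move: (4 ^+ _) (t ^+ _) => *; ring.
apply: (le_trans _ (ler_wpM2l (ler0n R 4) h)).
have -> : 4 * ((win_size k)%:R * (t ^+ (2 * d.+2) * W * g ^+ 2)) =
    4 * (win_size k)%:R * (t ^+ (2 * d.+2) * W * g ^+ 2) by rewrite mulrA.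
have -> : t ^+ d.+2 * (W * g ^+ 2) * t ^+ d.+4 = k.+1%:R * (t ^+ (2 * d.+2) * W * g ^+ 2).
  rewrite -(sqr_rootS R k) -/t (_ : d.+4 = (2 + d.+2)%N)// exprD mul2n -addnn (exprD _ d.+2).
  by move: (t ^+ d.+2) => p; ring.
rewrite ler_wpM2r//.
  exact: mulr_ge0 (mulr_ge0 (exprn_ge0 _ (ltW t0)) (ltW W0)) g0.
by have := win_size_ge R k; rewrite ler_pdivrMr// mulrC.
Qed.

(** Cauchy-Schwarz leaves the root of a product of two random energies. Bounding it by their sum
    makes the expectation see each energy separately; this is why only a first moment is reached. *)
Lemma mixed_grad_heat_le : exists2 C : R, 0 < C & forall a, elliptic a ->
  forall k e b,
  rootS R k ^+ d.+4 * (Num.sqrt (sweight R k (e.1 - b.1)) *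
    `|grad (heat a k (b.1 + basis b.2)) e - grad (heat a k b.1) e|) <=
  C * (\sum_(j < win_size k) edge_energy k a (win_start k + j) e +
       \sum_(j < win_size k) edge_energy k a (k - k./2 + j) b).
Proof.
exists (4 * 4 ^+ d.+2) => [|a ea k e b]; first by rewrite mulr_gt0// exprn_gt0.
have t0 := rootS_gt0 R k; set t := rootS R k in t0 *.
set W := sweight R k _; set g := _ - _.
have W0 : 0 < W by exact: sweight_gt0.
(* The times complementary to the first window traverse the second one backwards. *)
have -> : \sum_(j < win_size k) edge_energy k a (k - k./2 + j) b =
    \sum_(j < win_size k) edge_energy k a (k - (win_start k + j)) b.
  rewrite (reindex_inj rev_ord_inj); apply: eq_bigr => j _; congr edge_energy.
  have jw := ltn_ord j; rewrite /win_size in jw.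
  by rewrite /= /win_size /win_start; lia.
rewrite -big_split/=; set S := \sum_(j < _) _.
have : \sum_(j < win_size k) (t ^+ d.+2 * (Num.sqrt W * `|g|)) <= 4 ^+ d.+2 * S.
  rewrite mulr_sumr; apply: ler_sum => j _.
  have [] := win_bounds (ltn_ord j).
  move: (win_start k + j)%N => n nk kn.
  have gE : g = lsum (fun z => grad (heat a n z) e * grad (heat a (k - n) z) b).
    by rewrite -mixed_grad_heatD subnKC.
  have := @sweight_CS R d k e.1 b.1 (fun z => grad (heat a n z) e)
    (fun z => grad (heat a (k - n) z) b) (fsupp_grad_heat a n e) (fsupp_grad_heat a (k - n) b).
  rewrite -gE -/W -/(edge_energy k a n e).
  rewrite (eq_lsum (f := fun z => sweight R k (z - b.1) * _)
     (g := fun z => sweight R k (b.1 - z) * grad (heat a (k - n) z) b ^+ 2)); last first.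
    by move=> z; rewrite -sweightN opprB.
  rewrite -/(edge_energy k a (k - n) b).
  have := edge_energy_ge0 k a n e; have := edge_energy_ge0 k a (k - n) b.
  move: (edge_energy _ _ _ _) (edge_energy _ _ _ _) => X Y Y0 X0 h.
  have f1 : 1 <= 4 ^+ d.+2 :> R by apply: exprn_ege1; rewrite ler1n.
  have f0 : 0 <= 4 ^+ d.+2 :> R by lra.
  have LHS0 : 0 <= t ^+ d.+2 * (Num.sqrt W * `|g|).
    exact: mulr_ge0 (exprn_ge0 _ (ltW t0)) (mulr_ge0 (sqrtr_ge0 _) (normr_ge0 _)).
  have RHS0 : 0 <= 4 ^+ d.+2 * (X + Y) := mulr_ge0 f0 (addr_ge0 X0 Y0).
  rewrite -ler_sqr ?nnegrE//.
  have -> : (t ^+ d.+2 * (Num.sqrt W * `|g|)) ^+ 2 = k.+1%:R ^+ d.+2 * W * g ^+ 2.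
    rewrite (exprMn _ (t ^+ _)) -exprM mulnC -sqr_rootS_X -mulrA; congr (_ * _).
    by rewrite exprMn sqr_sqrtr ?(ltW W0)// real_normK ?num_real.
  apply: le_trans h _; rewrite (exprMn _ (4 ^+ _)).
  apply: ler_pM => //; first exact: mulr_ge0.
    by rewrite expr2 ler_peMl.
  by have := mulr_ge0 X0 Y0; have := sqr_ge0 X; have := sqr_ge0 Y; lra.
rewrite sumr_const card_ord -[leLHS]mulr_natl => h.
have g0 : 0 <= t ^+ d.+2 * (Num.sqrt W * `|g|).
  exact: mulr_ge0 (exprn_ge0 _ (ltW t0)) (mulr_ge0 (sqrtr_ge0 _) (normr_ge0 _)).
rewrite -mulrA; apply: (le_trans _ (ler_wpM2l (ler0n R 4) h)).
have -> : t ^+ d.+4 = k.+1%:R * t ^+ d.+2.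
  by rewrite (_ : d.+4 = (2 + d.+2)%N)// exprD sqr_rootS.
rewrite -(mulrA k.+1%:R) (mulrA 4 (win_size k)%:R) ler_wpM2r//.
by have := win_size_ge R k; rewrite ler_pdivrMr// mulrC.
Qed.

End QuenchedBounds.

Section Locality.
Variables (R : realType) (d : nat).
Implicit Types (a : edge d -> R) (x y z : vertex d) (e b : edge d).

(** Finite speed of propagation, in a list that does not depend on the coefficients: sums over [z]
    become finite sums over a fixed range, measurable and exchangeable with the expectation. *)
Fixpoint reach n : seq (vertex d) :=
  if n is m.+1 then
    reach m ++ flatten [seq [:: u - basis i; u + basis i] | u <- reach m, i <- enum 'I_d]
  else [:: 0].

Lemma reachS n u : u \in reach n -> u \in reach n.+1.
Proof. by rewrite /= mem_cat => ->. Qed.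

Lemma reach_mono m n u : (m <= n)%N -> u \in reach m -> u \in reach n.
Proof.
move=> mn um; rewrite -(subnK mn); elim: (n - m)%N => // k IH.
by rewrite addSn; exact: reachS.
Qed.

Lemma reach_step n u i : u \in reach n ->
  (u - basis i \in reach n.+1) && (u + basis i \in reach n.+1).
Proof.
move=> un /=; rewrite !mem_cat; apply/andP; split; apply/orP; right;
  apply/flattenP; exists [:: u - basis i; u + basis i];
  rewrite ?inE ?eqxx ?orbT//; apply/allpairsP; exists (u, i);
  by rewrite mem_enum.
Qed.

Lemma heat_reach a n y x : x - y \notin reach n -> heat a n y x = 0.
Proof.
elim: n x => [|n IH] x; first by rewrite /= inE subr_eq0 /heat/= => /negbTE ->.
move=> xn; have IH' v : v - y \in reach n -> v != x.
  by move=> vn; apply: contra xn => /eqP <-; exact: reachS.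
have h0 : heat a n y x = 0.
  by apply: IH; apply: contra xn => /reachS.
have h1 i : heat a n y (x + basis i) = 0.
  apply: IH; apply: contra xn => /(@reach_step _ _ i)/andP[+ _].
  by rewrite addrAC addrK.
have h2 i : heat a n y (x - basis i) = 0.
  apply: IH; apply: contra xn => /(@reach_step _ _ i)/andP[_].
  by rewrite addrAC subrK.
rewrite heatS /walk_op h0 elliptic_opE big1 ?mulr0 ?subrr// => i _.
by rewrite !gradE subrK h0 h1 h2 subrr !mulr0 subrr.
Qed.

Definition reach_edge n e : seq (vertex d) :=
  undup ([seq e.1 - u | u <- reach n] ++ [seq e.1 + basis e.2 - u | u <- reach n]).

Lemma grad_heat_reach a n e z : z \notin reach_edge n e -> grad (heat a n z) e = 0.
Proof.
rewrite mem_undup mem_cat negb_or => /andP[z1 z2].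
rewrite /grad !heat_reach ?subrr//.
  by apply: contra z1 => zr; apply/mapP; exists (e.1 - z); rewrite // opprB addrC subrK.
by apply: contra z2 => zr; apply/mapP; exists (e.1 + basis e.2 - z); rewrite // opprB addrC subrK.
Qed.

End Locality.

(** * Measurability and stationarity *)

Section RealIntegrals.
Context dp (T : measurableType dp) (R : realType) (P : probability T R).
Implicit Types f g : T -> R.

Lemma integral_sumr (I : Type) (s : seq I) (F : I -> T -> R) :
  (forall i, measurable_fun setT (F i)) -> (forall i a, 0 <= F i a) ->
  (\int[P]_a (\sum_(i <- s) F i a)%:E = \sum_(i <- s) \int[P]_a (F i a)%:E)%E.
Proof.
move=> mF F0; under eq_integral do rewrite -sumEFin.
apply: ge0_integral_sum => //.
  by move=> i; apply/measurable_EFinP.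
by move=> i a _; rewrite lee_fin.
Qed.

Lemma le_integral_cst f (c : R) : measurable_fun setT f -> (forall a, 0 <= f a) ->
  (forall a, f a <= c) -> (\int[P]_a (f a)%:E <= c%:E)%E.
Proof.
move=> mf f0 fc; rewrite -[leRHS]mule1 -(probability_setT P) -integral_cst//.
apply: ge0_le_integral => //.
- by move=> a _; rewrite lee_fin.
- exact/measurable_EFinP.
- by move=> a _; rewrite lee_fin.
Qed.

Lemma le_integral_real f g : measurable_fun setT f -> measurable_fun setT g ->
  (forall a, 0 <= f a) -> (forall a, f a <= g a) ->
  (\int[P]_a (f a)%:E <= \int[P]_a (g a)%:E)%E.
Proof.
move=> mf mg f0 fg; apply: ge0_le_integral => //.
- by move=> a _; rewrite lee_fin.
- exact/measurable_EFinP.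
- exact/measurable_EFinP.
- by move=> a _; rewrite lee_fin.
Qed.

Lemma integral_scale f (c : R) : measurable_fun setT f -> (forall a, 0 <= f a) ->
  0 <= c -> (\int[P]_a (c * f a)%:E = c%:E * \int[P]_a (f a)%:E)%E.
Proof.
move=> mf f0 c0; under eq_integral do rewrite EFinM.
by apply: ge0_integralZl => //; [exact/measurable_EFinP|move=> a _; rewrite lee_fin].
Qed.

End RealIntegrals.

Lemma heat_translate (R : realType) d (a b : edge d -> R) x n y z :
  (forall e, b e = a (shift_edge x e)) -> heat b n y z = heat a n (y + x) (z + x).
Proof.
move=> ba; elim: n z => [|n IH] z; first by rewrite /heat/= (inj_eq (addIr x)).
rewrite !heatS /walk_op IH !elliptic_opE; congr (_ - _ * _).
apply: eq_bigr => i _; rewrite !ba /shift_edge /= !gradE !IH.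
by rewrite !subrK (addrAC z x (- basis i)) (addrAC z x (basis i)).
Qed.

Section AnnealedBounds.
Variables (R : realType) (d : nat) (lambda : R) (lambda01 : 0 < lambda < 1).
Local Notation Om := (Omega d lambda01).

Lemma measurable_coef e : measurable_fun [set: Om] (fun a => coef a e).
Proof.
by move=> _ B mB; rewrite setTI; apply: sub_sigma_algebra; exists e, B.
Qed.

Lemma measurable_heat n y x :
  measurable_fun [set: Om] (fun a : Om => heat (coef a) n y x).
Proof.
elim: n x => [|n IH] x; first exact: measurable_cst.
rewrite /heat /=; under eq_fun do rewrite -/(heat _ n y) /walk_op elliptic_opE.
apply: measurable_funB => //; apply: measurable_funM; first exact: measurable_cst.
apply: measurable_sum => i; under eq_fun do rewrite !gradE subrK.
by apply: measurable_funB; (apply: measurable_funM; first exact: measurable_coef);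
  apply: measurable_funB.
Qed.

Lemma measurable_grad_heat n y e :
  measurable_fun [set: Om] (fun a : Om => grad (heat (coef a) n y) e).
Proof. by apply: measurable_funB; exact: measurable_heat. Qed.

Lemma measurable_shift x : measurable_fun [set: Om] (@shift R d lambda lambda01 x).
Proof.
apply: (measurability (@cylinders R d lambda lambda01)) => //.
move=> _ [_ [e [B [mB ->]]] <-]; rewrite setTI; apply: sub_sigma_algebra.
by exists (shift_edge x e), B.
Qed.

Lemma grad_heat_shift (a : Om) n z e :
  grad (heat (coef a) n z) e = grad (heat (coef (shift z a)) n 0) (e.1 - z, e.2).
Proof.
have E y : heat (coef (shift z a)) n 0 y = heat (coef a) n z (y + z).
  by rewrite (@heat_translate _ _ (coef a) _ z)// add0r.
by rewrite /grad /= !E addrAC !subrK.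
Qed.

Variable P : probability Om R.
Hypothesis stP : stationary P.

Lemma integral_shift x (f : Om -> R) : measurable_fun setT f -> (forall a, 0 <= f a) ->
  (\int[P]_a (f (shift x a))%:E = \int[P]_a (f a)%:E)%E.
Proof.
move=> mf f0.
have := @ge0_integral_pushforward _ _ _ _ _ _ (measurable_shift x) P setT (EFin \o f).
rewrite preimage_setT => <-//; last 2 first.
- exact/measurable_EFinP.
- by move=> a _; rewrite lee_fin.
apply: eq_measure_integral; first exact: measurable_shift.
by move=> ? A mA _; exact: stP.
Qed.

Let shifted_energy k n e (a : Om) : R :=
  \sum_(z <- reach_edge n e)
    sweight R k (e.1 - z) * grad (heat (coef a) n 0) (e.1 - z, e.2) ^+ 2.

Lemma edge_energyE k (a : Om) n e : edge_energy k (coef a) n e =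
  \sum_(z <- reach_edge n e) sweight R k (e.1 - z) * grad (heat (coef a) n z) e ^+ 2.
Proof.
apply: lsumE; first exact: undup_uniq.
by move=> z /grad_heat_reach ->; rewrite expr0n mulr0.
Qed.

Lemma measurable_edge_energy k n e :
  measurable_fun setT (fun a : Om => edge_energy k (coef a) n e).
Proof.
under eq_fun do rewrite edge_energyE; apply: measurable_sum => z.
apply: measurable_funM; first exact: measurable_cst.
by apply: measurable_funX; exact: measurable_grad_heat.
Qed.

(** Each summand is translated by its own [z], which puts the pole at 0 and lets the edge vary.
    Stationarity is applied term by term, so the two sums agree in expectation and not field by
    field. *)
Lemma integral_edge_energy k n e :
  (\int[P]_a (edge_energy k (coef a) n e)%:E = \int[P]_a (shifted_energy k n e a)%:E)%E.
Proof.
have wt0 u : 0 <= sweight R k u by rewrite ltW// sweight_gt0.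
have mg y e' : measurable_fun [set: Om] (fun a : Om => grad (heat (coef a) n y) e' ^+ 2).
  by apply: measurable_funX; exact: measurable_grad_heat.
have mwg y e' u : measurable_fun [set: Om]
    (fun a : Om => sweight R k u * grad (heat (coef a) n y) e' ^+ 2).
  by apply: measurable_funM; first exact: measurable_cst.
under eq_integral do rewrite edge_energyE.
rewrite /shifted_energy !integral_sumr//; last 2 first.
- by move=> z a; rewrite mulr_ge0// sqr_ge0.
- by move=> z a; rewrite mulr_ge0// sqr_ge0.
apply: eq_bigr => z _.
rewrite -[RHS](integral_shift z)//; last by move=> a; rewrite mulr_ge0// sqr_ge0.
by apply: eq_integral => a _; rewrite grad_heat_shift.
Qed.

Lemma shifted_energy_le k n e a : shifted_energy k n e a <=
  wdirichlet (fun x => sweight R k (x - 0)) (heat (coef a) n 0).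
Proof.
pose F u := sweight R k (u - 0) * grad (heat (coef a) n 0) (u, e.2) ^+ 2.
have F0 u : 0 <= F u by rewrite mulr_ge0 ?sqr_ge0// ltW// sweight_gt0.
have fg i := fsupp_grad i (fsupp_heat (coef a) n 0).
have fF : fsupp F by apply: fsuppMr; apply: fsuppX.
apply: (@le_trans _ _ (lsum F)).
  have -> : shifted_energy k n e a = \sum_(u <- [seq e.1 - z | z <- reach_edge n e]) F u.
    by rewrite big_map; apply: eq_bigr => z _; rewrite /F subr0.
  apply: ler_lsum_seq => //; rewrite map_inj_uniq ?undup_uniq// => u v /=.
  by move/addrI/oppr_inj.
apply: ler_lsum => //; first by apply: fsupp_wdirichlet; exact: fsupp_heat.
move=> x; rewrite (bigD1 e.2)//= lerDl; apply: sumr_ge0 => i _.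
by rewrite mulr_ge0 ?sqr_ge0// ltW// sweight_gt0.
Qed.

Lemma integral_edge_energy_le k n l e (C : R) :
  (forall a : Om, \sum_(j < l)
    wdirichlet (fun x => sweight R k (x - 0)) (heat (coef a) (n + j) 0) <= C) ->
  (\int[P]_a (\sum_(j < l) edge_energy k (coef a) (n + j) e)%:E <= C%:E)%E.
Proof.
move=> HC.
have s0 j a : 0 <= shifted_energy k j e a.
  by apply: sumr_ge0 => z _; rewrite mulr_ge0 ?sqr_ge0// ltW// sweight_gt0.
have ms j : measurable_fun setT (shifted_energy k j e).
  apply: measurable_sum => z; apply: measurable_funM; first exact: measurable_cst.
  by apply: measurable_funX; exact: measurable_grad_heat.
rewrite integral_sumr; last 2 first.
- by move=> j; exact: measurable_edge_energy.
- by move=> j a; exact: edge_energy_ge0.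
rewrite (eq_bigr (fun j : 'I_l => \int[P]_a (shifted_energy k (n + j) e a)%:E)%E); last first.
  by move=> j _; exact: integral_edge_energy.
rewrite -integral_sumr//; apply: le_integral_cst.
- exact: measurable_sum.
- by move=> a; apply: sumr_ge0.
- by move=> a; apply: le_trans (HC a); apply: ler_sum => j _; exact: shifted_energy_le.
Qed.

End AnnealedBounds.

(** * Annealed bounds at a fixed time, and their sums over time *)

Section AnnealedHeatKernel.
Variables (R : realType) (d : nat) (lambda : R) (lambda01 : 0 < lambda < 1).
Hypothesis d_gt0 : (0 < d)%N.
Local Notation Om := (Omega d lambda01).

Let lambda_gt0 : 0 < lambda. Proof. by case/andP: lambda01. Qed.

(* The profile [s_k ^ (d+2) + |x| ^ (d+2)] of the decay at time [k]. *)
Definition profile k (x : vertex d) : R :=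
  rootS R k ^+ d.+2 + Num.sqrt (bracket2 R x) ^+ d.+2.

Lemma profile_gt0 k x : 0 < profile k x.
Proof.
by rewrite addr_gt0// exprn_gt0 ?rootS_gt0// sqrtr_gt0 bracket2_gt0.
Qed.

Lemma sqr_profile_le k x : profile k x ^+ 2 <= 2 * sweight R k x.
Proof.
rewrite /profile /sweight sqr_rootS_X -[in leRHS](@sqr_sqrtr _ (bracket2 R x)); last first.
  by rewrite ltW// bracket2_gt0.
rewrite -exprM ![(2 * _)%N]mulnC !exprM.
move: (rootS R k ^+ _) (Num.sqrt _ ^+ _) => p q.
by have := sqr_ge0 (p - q); lra.
Qed.

Lemma annealed_sqr_grad_heat : exists2 C : R, 0 < C &
  forall P : probability Om R, stationary P -> forall k e y,
  (\int[P]_a (grad (heat (coef a) k y) e ^+ 2)%:E <=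
    (C * (rootS R k / profile k (e.1 - y)) ^+ 2)%:E)%E.
Proof.
have [C1 C10 H1] := sqr_grad_heat_le d_gt0 lambda_gt0.
have [C2 C20 H2] := sweight_energy_le d_gt0 lambda_gt0.
exists (2 * (C1 * C2)) => [|P stP k e y]; first by rewrite !mulr_gt0.
have t0 := rootS_gt0 R k; set t := rootS R k in t0 *.
have pr0 := profile_gt0 k (e.1 - y); have prw := sqr_profile_le k (e.1 - y).
set W := sweight R k (e.1 - y) in prw; have W0 : 0 < W by exact: sweight_gt0.
have tW : 0 < t ^+ d.+2 * W by rewrite mulr_gt0// exprn_gt0.
have mg : measurable_fun [set: Om] (fun a : Om => grad (heat (coef a) k y) e ^+ 2).
  by apply: measurable_funX; exact: measurable_grad_heat.
pose S (a : Om) := \sum_(j < win_size k) edge_energy k (coef a) (win_start k + j) e.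
have mS : measurable_fun setT S.
  by apply: measurable_sum => j; exact: measurable_edge_energy.
have S0 a : 0 <= S a by apply: sumr_ge0 => j _; exact: edge_energy_ge0.
have IS : (\int[P]_a (S a)%:E <= (C2 * t ^+ d.+4)%:E)%E.
  apply: integral_edge_energy_le => // a; have [? ? ?] := win_start_bounds k.
  by apply: H2 => //; exact: coefP.
apply: (@le_trans _ _ (((C1 / (t ^+ d.+2 * W))%:E * \int[P]_a (S a)%:E)%E)).
  have c0 : 0 <= C1 / (t ^+ d.+2 * W) by rewrite divr_ge0// ltW.
  rewrite -integral_scale//; apply: le_integral_real => //.
  - by apply: measurable_funM => //; exact: measurable_cst.
  - by move=> a; exact: sqr_ge0.
  move=> a; rewrite mulrAC ler_pdivlMr// mulrC -mulrA.
  by apply: H1; exact: coefP.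
apply: le_trans (lee_wpmul2l _ IS) _; first by rewrite lee_fin divr_ge0// ltW.
rewrite -EFinM lee_fin.
have -> : C1 / (t ^+ d.+2 * W) * (C2 * t ^+ d.+4) = C1 * C2 * (t ^+ 2 / W).
  rewrite (_ : d.+4 = (2 + d.+2)%N)// exprD.
  have : t ^+ d.+2 != 0 by rewrite lt0r_neq0// exprn_gt0.
  by move: (t ^+ d.+2) => p p0; field; rewrite p0 lt0r_neq0.
rewrite -(mulrA 2) [leRHS]mulrCA ler_wpM2l ?mulr_ge0 ?(ltW C10) ?(ltW C20)//.
rewrite expr_div_n mulrCA ler_wpM2l ?sqr_ge0//.
by rewrite ler_pdivlMr ?exprn_gt0// mulrC ler_pdivrMr.
Qed.

Lemma annealed_mixed_grad_heat : exists2 C : R, 0 < C &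
  forall P : probability Om R, stationary P -> forall k e b,
  (\int[P]_a (`|grad (heat (coef a) k (b.1 + basis b.2)) e
               - grad (heat (coef a) k b.1) e|)%:E <=
    (C * (profile k (e.1 - b.1))^-1)%:E)%E.
Proof.
have [C1 C10 H1] := mixed_grad_heat_le d_gt0 lambda_gt0.
have [C2 C20 H2] := sweight_energy_le d_gt0 lambda_gt0.
exists (4 * (C1 * C2)) => [|P stP k e b]; first by rewrite !mulr_gt0.
have t0 := rootS_gt0 R k; set t := rootS R k in t0 *.
have pr0 := profile_gt0 k (e.1 - b.1); have prw := sqr_profile_le k (e.1 - b.1).
set W := sweight R k (e.1 - b.1) in prw; have W0 : 0 < W by exact: sweight_gt0.
have sW : 0 < Num.sqrt W by rewrite sqrtr_gt0.
have t4 : 0 < t ^+ d.+4 by rewrite exprn_gt0.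
have tW : 0 < t ^+ d.+4 * Num.sqrt W by rewrite mulr_gt0.
have mg : measurable_fun [set: Om] (fun a : Om =>
    `|grad (heat (coef a) k (b.1 + basis b.2)) e - grad (heat (coef a) k b.1) e|).
  apply: measurableT_comp; first exact: normr_measurable.
  by apply: measurable_funB; exact: measurable_grad_heat.
pose S n e (a : Om) := \sum_(j < win_size k) edge_energy k (coef a) (n + j) e.
have mS n e' : measurable_fun setT (S n e').
  by apply: measurable_sum => j; exact: measurable_edge_energy.
have S0 n e' a : 0 <= S n e' a by apply: sumr_ge0 => j _; exact: edge_energy_ge0.
have IS1 : (\int[P]_a (S (win_start k) e a)%:E <= (C2 * t ^+ d.+4)%:E)%E.
  apply: integral_edge_energy_le => // a; have [? ? ?] := win_start_bounds k.
  by apply: H2 => //; exact: coefP.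
have IS2 : (\int[P]_a (S (k - k./2)%N b a)%:E <= (C2 * t ^+ d.+4)%:E)%E.
  apply: integral_edge_energy_le => // a; have [? ? ?] := win_end_bounds k.
  by apply: H2 => //; exact: coefP.
set I1 := (\int[P]_a _)%E in IS1; set I2 := (\int[P]_a _)%E in IS2.
have I10 : (0 <= I1)%E by apply: integral_ge0 => a _; rewrite lee_fin.
have I20 : (0 <= I2)%E by apply: integral_ge0 => a _; rewrite lee_fin.
have c0 : 0 <= C1 / (t ^+ d.+4 * Num.sqrt W) by rewrite divr_ge0// ltW.
apply: (@le_trans _ _ (((C1 / (t ^+ d.+4 * Num.sqrt W))%:E * (I1 + I2))%E)).
  rewrite -ge0_integralD//; last 4 first.
  - by move=> a _; rewrite lee_fin.
  - exact/measurable_EFinP.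
  - by move=> a _; rewrite lee_fin.
  - exact/measurable_EFinP.
  under [X in (_ <= _ * X)%E]eq_integral do rewrite -EFinD.
  rewrite -integral_scale//; last 2 first.
  - exact: measurable_funD.
  - by move=> a; rewrite addr_ge0.
  apply: le_integral_real => //.
    by apply: measurable_funM => //; exact: measurable_funD.
  move=> a; rewrite mulrAC ler_pdivlMr// mulrC -mulrA.
  by apply: H1; exact: coefP.
apply: le_trans (lee_wpmul2l _ (leeD IS1 IS2)) _; first by rewrite lee_fin.
rewrite -EFinD -EFinM lee_fin.
have -> : C1 / (t ^+ d.+4 * Num.sqrt W) * (C2 * t ^+ d.+4 + C2 * t ^+ d.+4) =
    C1 * C2 * (2 / Num.sqrt W).
  by move: t4; move: (t ^+ d.+4) => p p0; field; rewrite !lt0r_neq0.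
rewrite -(mulrA 4) [leRHS]mulrCA ler_wpM2l ?mulr_ge0 ?(ltW C10) ?(ltW C20)//.
rewrite ler_pdivrMr// mulrAC ler_pdivlMr// mulrC.
have h : profile k (e.1 - b.1) <= 2 * Num.sqrt W.
  rewrite -ler_sqr ?nnegrE ?mulr_ge0 ?sqrtr_ge0 ?(ltW pr0)// exprMn sqr_sqrtr ?(ltW W0)//.
  by apply: le_trans prw _; lra.
lra.
Qed.

End AnnealedHeatKernel.

Section TimeSums.
Variables (R : realType) (d : nat).
Implicit Type x : vertex d.+2.

(** The dimension is [d.+2] here, so the profile has exponent [d + 4]. Only four powers are kept for
    time: the inverse of the lower bound is then comparable to a difference in [k], and time sums
    telescope. *)
Lemma profile_ge k x : let D := Num.sqrt (bracket2 R x) in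
  D ^+ d * (k.+1%:R + D ^+ 2) ^+ 2 <= 4 * profile R k x.
Proof.
rewrite /= /profile -(sqr_rootS R k); set D := Num.sqrt _; set s := rootS R k.
have s0 : 0 < s := rootS_gt0 R k.
have D0 : 0 < D by rewrite sqrtr_gt0 bracket2_gt0.
have expX (u : R) : u ^+ d.+4 = u ^+ d * u ^+ 4 by rewrite -exprD addn4.
have [sD|Ds] := leP s D.
  apply: (@le_trans _ _ (4 * D ^+ d.+4)).
    rewrite expX [leRHS]mulrCA ler_wpM2l ?exprn_ge0 ?(ltW D0)//.
    have : s ^+ 2 <= D ^+ 2 by rewrite lerXn2r ?nnegrE ?(ltW s0) ?(ltW D0).
    by have := sqr_ge0 s; have := sqr_ge0 D; nra.
  by rewrite ler_wpM2l// lerDr exprn_ge0// ltW.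
apply: (@le_trans _ _ (4 * s ^+ d.+4)).
  rewrite expX [leRHS]mulrCA; apply: ler_pM; rewrite ?sqr_ge0 ?(exprn_ge0 d (ltW D0))//.
    by rewrite lerXn2r ?nnegrE ?(ltW s0) ?(ltW D0) ?(ltW Ds).
  have : D ^+ 2 <= s ^+ 2 by rewrite lerXn2r ?nnegrE ?(ltW s0) ?(ltW D0) ?(ltW Ds).
  by have := sqr_ge0 s; have := sqr_ge0 D; nra.
by rewrite ler_wpM2l// lerDl exprn_ge0// ltW.
Qed.

Lemma sum_telescope_le (F u : nat -> R) n : (forall k, F k <= u k - u k.+1) ->
  (forall k, 0 <= u k) -> \sum_(0 <= k < n) F k <= u 0%N.
Proof.
move=> Fu u0; apply: (@le_trans _ _ (u 0%N - u n)); last by rewrite lerBlDr lerDl.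
elim: n => [|n IH]; first by rewrite big_nil subrr.
by rewrite big_nat_recr//=; have := Fu n; lra.
Qed.

Lemma sum_inv_profile x n :
  \sum_(0 <= k < n) (profile R k x)^-1 <= 4 / Num.sqrt (bracket2 R x) ^+ d.+2.
Proof.
pose D : R := Num.sqrt (bracket2 R x); rewrite -/D; have D0 : 0 < D by rewrite sqrtr_gt0 bracket2_gt0.
have Dd : 0 < D ^+ d by rewrite exprn_gt0.
have D2 : 0 < D ^+ 2 by rewrite exprn_gt0.
have D2k k : 0 < k%:R + D ^+ 2 by rewrite ltr_wpDl.
(* The difference [u k - u k.+1] has denominator [(k + D^2) (k + 1 + D^2)], smaller than the square
   in [profile_ge]. *)
pose u k : R := 4 / D ^+ d / (k%:R + D ^+ 2).
have -> : 4 / D ^+ d.+2 = u 0%N.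
  by rewrite /u add0r -mulrA -invfM -exprD addn2.
apply: sum_telescope_le => k; last by rewrite !divr_ge0// ltW.
have p0 := profile_gt0 R k x; have := profile_ge k x; rewrite /= -/D => h.
have E : u k - u k.+1 = 4 / D ^+ d / ((k%:R + D ^+ 2) * (k.+1%:R + D ^+ 2)).
  have := D2k k; have := D2k k.+1; rewrite /u -natr1.
  move: Dd (k%:R : R); move: (D ^+ d) (D ^+ 2) => p q p0' z h1 h2.
  by field; rewrite !lt0r_neq0.
rewrite E -mulrA -invfM -[leLHS]mul1r ler_pdivrMr// mulrAC ler_pdivlMr ?mulr_gt0//.
apply: le_trans h; rewrite mul1r ler_wpM2l ?(ltW Dd)// expr2.
by rewrite ler_wpM2r ?(ltW (D2k _))// lerD2r ler_nat.
Qed.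

Lemma sum_root_profile x n :
  \sum_(0 <= k < n) (rootS R k / profile R k x) <= 8 / Num.sqrt (bracket2 R x) ^+ d.+1.
Proof.
pose D : R := Num.sqrt (bracket2 R x); rewrite -/D; have D0 : 0 < D by rewrite sqrtr_gt0 bracket2_gt0.
have Dd : 0 < D ^+ d by rewrite exprn_gt0.
have D2 : 0 < D ^+ 2 by rewrite exprn_gt0.
have D2k k : 0 < k%:R + D ^+ 2 by rewrite ltr_wpDl.
pose v k : R := Num.sqrt (k%:R + D ^+ 2).
have v0 k : 0 < v k by rewrite sqrtr_gt0.
have v2 k : v k ^+ 2 = k%:R + D ^+ 2 by rewrite sqr_sqrtr// ltW.
(* By [profile_ge] the summand is at most [4 / (D^d v^3)] with [v = v k.+1], and differences of
   [1 / v] are at least [1 / (2 v^3)]; hence the 8. *)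
pose u k : R := 8 / D ^+ d / v k.
have -> : 8 / D ^+ d.+1 = u 0%N.
  by rewrite /u /v add0r sqrtr_sqr gtr0_norm// -mulrA -invfM -exprSr.
apply: sum_telescope_le => k; last by rewrite !divr_ge0// ltW.
have p0 := profile_gt0 R k x; have := profile_ge k x; rewrite /= -/D -v2 => h.
have sv : rootS R k <= v k.+1.
  by rewrite ler_sqrt ?(ltW (D2k _))// lerDl ltW.
have s0 := rootS_gt0 R k.
have vv : v k <= v k.+1 by rewrite ler_sqrt ?(ltW (D2k _))// lerD2r ler_nat.
have v1 : v k.+1 ^+ 2 = v k ^+ 2 + 1 by rewrite !v2 -natr1; ring.
have E : (v k)^-1 - (v k.+1)^-1 = (v k * v k.+1 * (v k + v k.+1))^-1.
  have e1 : (v k.+1 - v k) * (v k + v k.+1) = 1.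
    rewrite (_ : _ * _ = v k.+1 ^+ 2 - v k ^+ 2); last by ring.
    by rewrite v1 addrC addKr.
  apply: (@mulIf _ (v k * v k.+1 * (v k + v k.+1))).
    by rewrite !mulf_neq0 ?lt0r_neq0// addr_gt0.
  rewrite mulVf ?mulf_neq0 ?lt0r_neq0 ?addr_gt0// -[RHS]e1.
  by field; rewrite !lt0r_neq0.
rewrite /u -mulrBr E.
set V := v k * v k.+1 * (v k + v k.+1).
have V0 : 0 < V by rewrite /V !mulr_gt0// addr_gt0.
rewrite -mulrA -invfM ler_pdivrMr// mulrAC ler_pdivlMr ?(mulr_gt0 Dd V0)//.
have VD : V <= 2 * v k.+1 ^+ 3.
  have u0 := ltW (v0 k); have w0 := ltW (v0 k.+1).
  have : v k * (v k + v k.+1) <= v k.+1 * (2 * v k.+1).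
    apply: ler_pM => //; first exact: addr_ge0.
    by rewrite mulr_natl mulr2n lerD2r.
  by move=> /(ler_wpM2l w0); rewrite /V; lra.
have h1 : rootS R k * V <= v k.+1 * (2 * v k.+1 ^+ 3).
  by apply: ler_pM => //; exact: ltW.
have -> : rootS R k * (D ^+ d * V) = D ^+ d * (rootS R k * V) by rewrite mulrCA.
apply: le_trans (ler_wpM2l (ltW Dd) h1) _.
have -> : D ^+ d * (v k.+1 * (2 * v k.+1 ^+ 3)) = 2 * (D ^+ d * v k.+1 ^+ 2 ^+ 2).
  by move: (D ^+ d) (v k.+1) => p w; ring.
apply: le_trans (ler_wpM2l (ler0n _ 2) h) _.
by rewrite mulrA -natrM.
Qed.

End TimeSums.

(** * Partial sums of the Green function *)

Section Sequences.
Variable R : realType.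

Lemma cvgn_sum (I : Type) (s : seq I) (F : I -> R^nat) (l : I -> R) :
  (forall i, F i @ \oo --> l i) ->
  (fun n => \sum_(i <- s) F i n) @ \oo --> \sum_(i <- s) l i.
Proof.
move=> Fl; elim: s => [|i s IH].
  by rewrite big_nil; under eq_fun do rewrite big_nil; exact: cvg_cst.
by rewrite big_cons; under eq_fun do rewrite big_cons; exact: cvgD.
Qed.

Lemma is_cvg_normed_series (c : R^nat) (B : R) :
  (forall n, \sum_(0 <= k < n) `|c k| <= B) -> cvgn [normed series c].
Proof.
move=> cB; rewrite (_ : [normed series c] = fun n => \sum_(0 <= k < n) `|c k|)//.
apply: nondecreasing_is_cvgn.
  by apply/nondecreasing_seqP => n; rewrite big_nat_recr//= lerDl.
by exists B => _ [n _ <-]; exact: cB.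
Qed.

Lemma norm_lim_series_le (c : R^nat) (B : R) :
  (forall n, \sum_(0 <= k < n) `|c k| <= B) -> `|limn (series c)| <= B.
Proof.
move=> cB; have cc := is_cvg_normed_series cB.
apply: le_trans (lim_series_norm cc) _.
by apply: limr_le => //; exact: nearW.
Qed.

End Sequences.

Section GreenSeries.
Variables (R : realType) (d : nat) (a : edge d -> R).
Hypothesis d_gt0 : (0 < d)%N.
Hypothesis a01 : forall e, 0 <= a e <= 1.
Implicit Types (f g : vertex d -> R) (x y z : vertex d) (theta : R).
Local Notation kap := (kappa R d).
Let kap_gt0 : 0 < kap := kappa_gt0 R d_gt0.

(** A partial Neumann series. With [P] the walk operator and [theta = (1 + kappa / T)^-1], the
    massive operator is [(1 - theta P) / (kappa theta)], with inverse
    [kappa \sum_k theta^(k+1) P^k]; hence the shifted exponent. The massless case is [theta = 1]. *)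
Definition green_sum (theta : R) y n x : R :=
  \sum_(0 <= k < n) kap * (theta ^+ k.+1 * heat a k y x).

Lemma green_sumE theta y x n :
  green_sum theta y n x = kap * \sum_(0 <= k < n) theta ^+ k.+1 * heat a k y x.
Proof. by rewrite /green_sum -mulr_sumr. Qed.

Lemma elliptic_opDZ f g c x :
  elliptic_op a (fun x => f x + c * g x) x = elliptic_op a f x + c * elliptic_op a g x.
Proof.
rewrite !elliptic_opE mulr_sumr -big_split/=; apply: eq_bigr => i _.
by rewrite !gradE; ring.
Qed.

Lemma elliptic_op0 x : elliptic_op a (fun=> 0) x = 0.
Proof. by rewrite elliptic_opE big1// => i _; rewrite !gradE; ring. Qed.

Lemma green_sumP theta y n x : theta != 0 ->
  (theta^-1 - 1) / kap * green_sum theta y n x + elliptic_op a (green_sum theta y n) x =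
  (x == y)%:R - theta ^+ n * heat a n y x.
Proof.
move=> th0; elim: n => [|n IH].
  have -> : green_sum theta y 0 = fun=> 0.
    by apply/funext => z; rewrite /green_sum big_nil.
  by rewrite elliptic_op0 expr0 mul1r /heat/= subrr mulr0 addr0.
have E : green_sum theta y n.+1 =
    fun x => green_sum theta y n x + kap * theta ^+ n.+1 * heat a n y x.
  by apply/funext => z; rewrite /green_sum big_nat_recr//= mulrA.
rewrite E elliptic_opDZ heatS /walk_op exprS.
have : kap != 0 by rewrite lt0r_neq0.
move: IH; move: (heat a n y x) (elliptic_op _ _ _) (elliptic_op _ _ _) (theta ^+ n) => p L2 L1 q.
move: (green_sum _ _ _ _) ((_ == _)%:R : R) kap => G D k IH k0.
transitivity (((theta^-1 - 1) / k * G + L1) +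
  ((theta^-1 - 1) * theta * q * p + k * theta * q * L2)); first by field; rewrite ?k0 ?th0.
by rewrite IH; field; rewrite ?k0 ?th0.
Qed.

Lemma cvg_elliptic_op (F : nat -> vertex d -> R) f x :
  (forall z, F ^~ z @ \oo --> f z) ->
  (fun n => elliptic_op a (F n) x) @ \oo --> elliptic_op a f x.
Proof.
move=> Ff; under eq_fun do rewrite elliptic_opE; rewrite elliptic_opE.
apply: cvgn_sum => i.
by apply: cvgB; apply: cvgMr; under eq_fun do rewrite gradE; apply: cvgB.
Qed.

Lemma green_limP theta y g : theta != 0 ->
  (forall x, green_sum theta y ^~ x @ \oo --> g x) ->
  (forall x, (fun n => theta ^+ n * heat a n y x) @ \oo --> 0) ->
  forall x, (theta^-1 - 1) / kap * g x + elliptic_op a g x = (x == y)%:R.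
Proof.
move=> th0 Gg h0 x.
have h1 : (fun n => (theta^-1 - 1) / kap * green_sum theta y n x
    + elliptic_op a (green_sum theta y n) x) @ \oo -->
    (theta^-1 - 1) / kap * g x + elliptic_op a g x.
  by apply: cvgD; [apply: cvgMr; exact: Gg|exact: cvg_elliptic_op].
have h2 : (fun n => (x == y)%:R - theta ^+ n * heat a n y x) @ \oo --> ((x == y)%:R : R).
  rewrite -[X in _ --> X]subr0; apply: cvgB; [exact: cvg_cst|exact: h0].
rewrite (_ : (fun n => _ + _) = (fun n => (x == y)%:R - theta ^+ n * heat a n y x)) in h1.
  exact: cvg_unique h1 h2.
by apply/funext => n; exact: green_sumP.
Qed.

Lemma harmonic_walk theta f : theta != 0 ->
  (forall x, (theta^-1 - 1) / kap * f x + elliptic_op a f x = 0) ->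
  forall x, f x = theta * walk_op a f x.
Proof.
move=> th0 Lf x; rewrite /walk_op; have := Lf x.
have : kap != 0 by rewrite lt0r_neq0.
move: (f x) (elliptic_op _ _ _) kap => p L k k0 /eqP.
rewrite addrC addr_eq0 => /eqP ->; field; rewrite k0 th0 //.
Qed.

Lemma ler_norm_walk f B x : (forall z, `|f z| <= B) -> `|walk_op a f x| <= B.
Proof.
move=> fB; rewrite walk_opE// normrM gtr0_norm//.
rewrite -ler_pdivlMl//; apply: le_trans (ler_norm_sum _ _ _) _.
have -> : kap^-1 * B = \sum_(i < d) 4 * B.
  by rewrite sumr_const card_ord -[RHS]mulr_natl /kappa invrK; ring.
apply: ler_sum => i _.
have /andP[p0 p1] := a01 (x - basis i, i); have /andP[q0 q1] := a01 (x, i).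
have h0 : 0 <= 4 - a (x - basis i, i) - a (x, i) by lra.
apply: le_trans (ler_normD _ _) _; apply: le_trans (lerD (ler_normD _ _) (lexx _)) _.
rewrite !normrM (ger0_norm h0) (ger0_norm p0) (ger0_norm q0).
have := ler_wpM2l h0 (fB x); have := ler_wpM2l p0 (fB (x - basis i)).
have := ler_wpM2l q0 (fB (x + basis i)); lra.
Qed.

(** Uniqueness for the massive equation: [theta P] contracts the sup norm, and iterating the
    fixed-point identity sends the bound to 0. *)
Lemma harmonic_bounded theta f B : 0 < theta < 1 -> (forall x, `|f x| <= B) ->
  (forall x, f x = theta * walk_op a f x) -> forall x, f x = 0.
Proof.
move=> /andP[th0 th1] fB fE.
have fBn n x : `|f x| <= theta ^+ n * B.
  elim: n x => [|n IH] x; first by rewrite mul1r.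
  rewrite fE normrM gtr0_norm// exprS -mulrA ler_wpM2l ?(ltW th0)//.
  exact: ler_norm_walk.
move=> x; apply/eqP; rewrite -normr_le0.
have : (fun n => theta ^+ n * B) @ \oo --> 0 * B.
  by apply: cvgMl; apply: cvg_expr; rewrite gtr0_norm.
rewrite mul0r => h; apply: (@cvgr_to_ge _ _ _ _ _ _ _ h); exact: nearW.
Qed.

End GreenSeries.

(** * Identification of the massive and decaying Green functions *)

Lemma seq_argmax (R : realDomainType) (T : eqType) (s : seq T) (f : T -> R) x0 :
  x0 \in s -> exists2 x, x \in s & forall y, y \in s -> f y <= f x.
Proof.
elim: s x0 => // a s IH x0 _; case: s IH => [|b s] IH.
  by exists a => [|y]; rewrite ?inE// => /eqP ->.
have [x xs xmax] := IH b (mem_head _ _).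
have [fa|fa] := leP (f a) (f x).
  exists x => [|y]; first by rewrite inE xs orbT.
  by rewrite inE => /orP[/eqP -> //|/xmax].
exists a => [|y]; first exact: mem_head.
by rewrite inE => /orP[/eqP -> //|/xmax/le_trans]; apply; exact: ltW.
Qed.

Section LatticeNorm.
Variables (R : realType) (d : nat).
Implicit Type x : vertex d.

Lemma coord_le_norm x i : `|(x 0 i)%:~R| <= euclidean_norm (point_of R x).
Proof.
rewrite -sqrtr_sqr ler_sqrt; last by apply: sumr_ge0 => j _; exact: sqr_ge0.
by rewrite (bigD1 i)//= /point_of !mxE lerDl; apply: sumr_ge0 => j _; exact: sqr_ge0.
Qed.

Definition cube m : seq (vertex d) :=
  [seq \row_i ((f i : nat)%:Z - m%:Z)
    | f : {ffun 'I_d -> 'I_(2 * m).+1} <- enum {: {ffun 'I_d -> 'I_(2 * m).+1}}].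

Lemma mem_cube m x : (forall i, `|x 0 i| <= m%:Z) -> x \in cube m.
Proof.
move=> xm; apply/mapP.
have h i : (`|(x 0 i + m%:Z)%R|%N < (2 * m).+1)%N by have := xm i; lia.
exists [ffun i => Ordinal (h i)]; first by rewrite mem_enum.
by apply/rowP => i; rewrite !mxE ffunE /=; have := xm i; lia.
Qed.

Lemma finite_ball (r : R) : exists s : seq (vertex d),
  forall x, x \notin s -> r < euclidean_norm (point_of R x).
Proof.
pose m := Num.bound (Num.max r 0).
exists (cube m) => x; apply: contraR; rewrite -leNgt => xr.
apply: mem_cube => i; rewrite -(ler_int R) intr_norm.
apply: le_trans (coord_le_norm x i) _; apply: le_trans xr _.
have r0 : 0 <= Num.max r 0 by rewrite le_max lexx orbT.
apply: (@le_trans _ _ (Num.max r 0)); first by rewrite le_max lexx.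
exact: ltW (archi_boundP r0).
Qed.

Lemma bounded_norm (s : seq (vertex d)) : exists r : R,
  forall x, x \in s -> euclidean_norm (point_of R x) <= r.
Proof.
elim: s => [|a s [r rP]]; first by exists 0.
exists (Num.max (euclidean_norm (point_of R a)) r) => x.
by rewrite inE => /orP[/eqP ->|/rP xr]; rewrite le_max ?lexx// xr orbT.
Qed.

End LatticeNorm.

Section GreenIdentification.
Variables (R : realType) (d : nat) (lambda : R).
Hypotheses (d_gt0 : (0 < d)%N) (lambda_gt0 : 0 < lambda).
Implicit Types (a : edge d -> R) (f g : vertex d -> R) (x y z : vertex d) (e : edge d).
Let elliptic a := forall e, lambda <= a e <= 1.
Local Notation kap := (kappa R d).
Let kap_gt0 : 0 < kap := kappa_gt0 R d_gt0.

Lemma heat_le1 a n y x : elliptic a -> heat a n y x <= 1.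
Proof.
move=> ea; rewrite -(lsum_heat a n y).
have := @ler_lsum_seq R d [:: x] (heat a n y) (fsupp_heat a n y)
  (heat_ge0 d_gt0 (elliptic01 lambda_gt0 ea) n y).
by rewrite big_seq1; apply.
Qed.

(** An average of values of modulus at most [M] has modulus [M] only if every value of positive
    coefficient does, and ellipticity makes the coefficient of the neighbour positive. *)
Lemma max_principle a f x i M : elliptic a -> (forall z, `|f z| <= M) ->
  f x = walk_op a f x -> `|f x| = M -> `|f (x + basis i)| = M.
Proof.
move=> ea fM fx fxM; apply/eqP; rewrite eq_le fM/=.
have : M <= M - kap * (a (x, i) * (M - `|f (x + basis i)|)).
  have M0 : 0 <= M by rewrite -fxM.
  rewrite -[leLHS]fxM fx walk_opE// normrM gtr0_norm//.
  have {1}-> : M = kap * \sum_(j < d) 4 * M.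
    rewrite sumr_const card_ord -[_ *+ d]mulr_natl.
    transitivity (kap * (4 * d%:R) * M); last by ring.
    by rewrite (kappaE R d_gt0) mul1r.
  rewrite -mulrBr ler_wpM2l ?(ltW kap_gt0)//.
  apply: le_trans (ler_norm_sum _ _ _) _.
  rewrite (bigD1 i)//= [in leRHS](bigD1 i)//= [leRHS]addrAC lerD//.
    have /andP[/(le_trans (ltW lambda_gt0)) p0 p1] := ea (x - basis i, i).
    have /andP[/(le_trans (ltW lambda_gt0)) q0 q1] := ea (x, i).
    have h0 : 0 <= 4 - a (x - basis i, i) - a (x, i) by lra.
    apply: le_trans (ler_normD _ _) _; apply: le_trans (lerD (ler_normD _ _) (lexx _)) _.
    rewrite !normrM (ger0_norm h0) (ger0_norm p0) (ger0_norm q0).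
    have := ler_wpM2l h0 (fM x); have := ler_wpM2l p0 (fM (x - basis i)); lra.
  apply: ler_sum => j _.
  have /andP[/(le_trans (ltW lambda_gt0)) p0 p1] := ea (x - basis j, j).
  have /andP[/(le_trans (ltW lambda_gt0)) q0 q1] := ea (x, j).
  have h0 : 0 <= 4 - a (x - basis j, j) - a (x, j) by lra.
  apply: le_trans (ler_normD _ _) _; apply: le_trans (lerD (ler_normD _ _) (lexx _)) _.
  rewrite !normrM (ger0_norm h0) (ger0_norm p0) (ger0_norm q0).
  have := ler_wpM2l h0 (fM x); have := ler_wpM2l p0 (fM (x - basis j)).
  have := ler_wpM2l q0 (fM (x + basis j)); lra.
have /andP[/(lt_le_trans lambda_gt0) q0 _] := ea (x, i).
rewrite lerDl oppr_ge0 pmulr_rle0// pmulr_rle0//.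
by rewrite subr_le0.
Qed.

(** A nonzero function vanishing at infinity attains its maximal modulus, since all large values lie
    in a finite ball; the maximum principle carries this modulus along a ray to infinity, a
    contradiction. *)
Lemma harmonic_vanishing a f : elliptic a -> vanishes_at_infinity f ->
  (forall x, f x = walk_op a f x) -> forall x, f x = 0.
Proof.
move=> ea fv fE x0; apply/eqP; apply: contraT => fx0.
have M0 : 0 < `|f x0| by rewrite normr_gt0.
have [r rP] := fv _ M0; have [s sP] := finite_ball d r.
have x0s : x0 \in s.
  by apply: contraT => /sP/rP; rewrite ltxx.
have [x xs xmax] := seq_argmax (fun x => `|f x|) x0s.
have fM z : `|f z| <= `|f x|.
  have [zs|/sP/rP/ltW zs] := boolP (z \in s); first exact: xmax.
  by apply: le_trans zs _; exact: xmax.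
pose i : 'I_d := Ordinal d_gt0.
have fMn n : `|f (x + basis i *+ n)| = `|f x|.
  elim: n => [|n IH]; first by rewrite mulr0n addr0.
  by rewrite mulrSr addrA; apply: (max_principle (a := a)) => //; rewrite fE.
pose n := Num.bound (Num.max r 0 + `|(x 0 i)%:~R|).
have : r < euclidean_norm (point_of R (x + basis i *+ n)).
  apply: lt_le_trans (coord_le_norm R _ i).
  have r0 : 0 <= Num.max r 0 by rewrite le_max lexx orbT.
  have := archi_boundP (addr_ge0 r0 (normr_ge0 ((x 0 i)%:~R : R))); rewrite -/n => h.
  have rm : r <= Num.max r 0 by rewrite le_max lexx.
  rewrite !mxE mulmxnE !mxE !eqxx/= rmorphD rmorphMn rmorph1.
  have := ler_norm (- (x 0 i)%:~R : R); rewrite normrN.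
  have := ler_norm ((x 0 i)%:~R + n%:R : R); lra.
move=> /rP; rewrite fMn => /lt_le_trans/(_ (xmax _ x0s)).
by rewrite ltxx.
Qed.

(** A tail of the series of [k^(-3/2)], compared with differences of [1 / rootS]. It makes the
    kernel summable in time for [d >= 3], uniformly in space. *)
Lemma rootS_sum n m :
  \sum_(n <= k < n + m) (rootS R k ^+ 3)^-1 <= 6 / rootS R n.
Proof.
rewrite -{1}[n]add0n big_addn addnC addnK.
apply: (@sum_telescope_le R (fun k => (rootS R (k + n) ^+ 3)^-1)
   (fun k => 6 / rootS R (k + n))) => k; last by rewrite divr_ge0// ltW// rootS_gt0.
rewrite addSn; move: (k + n)%N => {m}j.
have := rootS_gt0 R j; have := rootS_gt0 R j.+1; have := rootS_ge1 R j.
have : rootS R j.+1 ^+ 2 = rootS R j ^+ 2 + 1 by rewrite !sqr_rootS natr1.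
move: (rootS R j) (rootS R j.+1) => u v vE u1 v0 u0.
have vu : v <= 2 * u.
  by rewrite -ler_sqr ?nnegrE ?mulr_ge0 ?(ltW u0) ?(ltW v0)// exprMn vE; nra.
have E : 6 / u - 6 / v = 6 / (u * v * (u + v)).
  have e1 : (v - u) * (u + v) = 1.
    rewrite (_ : _ * _ = v ^+ 2 - u ^+ 2); last by ring.
    by rewrite vE addrC addKr.
  transitivity (6 * ((v - u) * (u + v)) / (u * v * (u + v))); last by rewrite e1 mulr1.
  by field; rewrite !lt0r_neq0// addr_gt0.
have V0 : 0 < u * v * (u + v) by rewrite !mulr_gt0// addr_gt0.
rewrite E -[leLHS]mul1r ler_pdivrMr ?exprn_gt0// mulrAC ler_pdivlMr// mul1r.
have h : v * (u + v) <= (2 * u) * (3 * u).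
  by apply: ler_pM; lra.
by have := ler_wpM2l (ltW u0) h; lra.
Qed.

Lemma heat_le : exists2 C : R, 0 < C &
  forall a, elliptic a -> forall n y x, heat a n y x <= C / rootS R n ^+ d.
Proof.
have [A A0 HA] := heat2_le d_gt0 lambda_gt0.
exists (2 ^+ d * A) => [|a ea n y x]; first by rewrite mulr_gt0// exprn_gt0.
have [i [j [nij ni nj]]] : exists i j, [/\ n = (i + j)%N, (n.+1 <= 4 * i.+1)%N & (n.+1 <= 4 * j.+1)%N].
  by exists n./2, (n - n./2)%N; split; lia.
have fi : fsupp (heat a i x) by exact: fsupp_heat.
have fj : fsupp (heat a j y) by exact: fsupp_heat.
have s0 k : 0 < rootS R k ^+ d by rewrite exprn_gt0// rootS_gt0.
have h k z : (n.+1 <= 4 * k.+1)%N -> heat2 a k z <= 2 ^+ d * A / rootS R n ^+ d.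
  move=> nk; apply: le_trans (HA a ea k z) _.
  rewrite ler_pdivrMr// mulrAC ler_pdivlMr// mulrAC mulrC ler_wpM2r ?(ltW A0)//.
  rewrite -exprMn lerXn2r ?nnegrE ?mulr_ge0 ?(ltW (rootS_gt0 _ _))//.
  rewrite -ler_sqr ?nnegrE ?mulr_ge0 ?(ltW (rootS_gt0 _ _))// exprMn !sqr_rootS.
  by rewrite -natrX -natrM ler_nat.
rewrite nij heatD -nij.
apply: (@le_trans _ _ (2^-1 * (heat2 a i x + heat2 a j y))).
  rewrite /heat2 -lsumD; try fsupp_tac; rewrite -lsumZ; apply: ler_lsum; try fsupp_tac.
  by move=> z; have := sqr_ge0 (heat a i x z - heat a j y z); lra.
by have := h i x ni; have := h j y nj; lra.
Qed.

Lemma green_sum_cvg a theta y x (B : R) : elliptic a -> 0 <= theta ->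
  (forall n, green_sum a theta y n x <= B) ->
  cvgn (green_sum a theta y ^~ x).
Proof.
move=> ea th0 gB; apply: nondecreasing_is_cvgn.
  apply/nondecreasing_seqP => n; rewrite /green_sum big_nat_recr//= lerDl.
  rewrite mulr_ge0 ?(ltW kap_gt0)// mulr_ge0 ?exprn_ge0//.
  exact: (heat_ge0 d_gt0 (elliptic01 lambda_gt0 ea)).
by exists B => _ [n _ <-]; exact: gB.
Qed.

Lemma green_sum_ge0 a theta y n x : elliptic a -> 0 <= theta ->
  0 <= green_sum a theta y n x.
Proof.
move=> ea th0; apply: sumr_ge0 => k _.
rewrite mulr_ge0 ?(ltW kap_gt0)// mulr_ge0 ?exprn_ge0//.
exact: (heat_ge0 d_gt0 (elliptic01 lambda_gt0 ea)).
Qed.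

(** The limit of the series solves the equation, and it vanishes at infinity by finite speed of
    propagation: far from [y] only late times contribute, and their tail is uniformly small.
    [harmonic_vanishing] gives uniqueness, so [xget] returns this limit. *)
Lemma decaying_green_cvg a y x : (3 <= d)%N -> elliptic a ->
  green_sum a 1 y ^~ x @ \oo --> decaying_green a y x.
Proof.
move=> d3 ea; have [C C0 HC] := heat_le.
have h3 k z : heat a k y z <= C / rootS R k ^+ 3.
  apply: le_trans (HC a ea k y z) _; rewrite ler_wpM2l ?(ltW C0)//.
  rewrite lef_pV2 ?posrE ?exprn_gt0 ?rootS_gt0//.
  by apply: ler_weXn2l d3; exact: rootS_ge1.
have hsum n m z : \sum_(n <= k < n + m) kap * (1 ^+ k.+1 * heat a k y z) <=
    kap * C * (6 / rootS R n).
  apply: le_trans (ler_wpM2l _ (rootS_sum n m)); last by rewrite mulr_ge0// ltW.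
  rewrite mulr_sumr; apply: ler_sum => k _.
  by rewrite expr1n mul1r -mulrA ler_wpM2l ?(ltW kap_gt0).
have gB n z : green_sum a 1 y n z <= kap * C * (6 / rootS R 0).
  by have := hsum 0%N n z; rewrite add0n.
pose g z := limn (green_sum a 1 y ^~ z).
have Gg z : green_sum a 1 y ^~ z @ \oo --> g z.
  exact: (green_sum_cvg ea ler01 (gB ^~ z)).
have heat0 z : (fun n => 1 ^+ n * heat a n y z) @ \oo --> (0 : R).
  apply: (@squeeze_cvgr _ _ _ _ (fun=> 0) (fun n => C * harmonic n)).
  - apply: nearW => n; rewrite expr1n mul1r.
    rewrite (heat_ge0 d_gt0 (elliptic01 lambda_gt0 ea))/=.
    apply: le_trans (h3 n z) _; rewrite ler_wpM2l ?(ltW C0)// /harmonic/=.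
    rewrite lef_pV2 ?posrE ?exprn_gt0 ?rootS_gt0// -(sqr_rootS R n).
    by apply: (@ler_weXn2l _ _ (rootS_ge1 R n) 2 3).
  - exact: cvg_cst.
  - by rewrite -[X in _ --> X](mulr0 C); apply: cvgMr; exact: cvg_harmonic.
have gP z : elliptic_op a g z = (z == y)%:R.
  have := green_limP d_gt0 (oner_neq0 R) Gg heat0 z.
  by rewrite invr1 subrr mul0r mul0r add0r.
have gv : vanishes_at_infinity g.
  move=> eps eps0; pose K := kap * C * 6 / eps.
  have K0 : 0 < K by rewrite /K divr_gt0// mulr_gt0// mulr_gt0.
  (* This [m] brings the tail bound [kap * C * (6 / rootS R m)] below [eps]; points outside
     [y + reach m] see only that tail. *)
  pose m := Num.bound (K ^+ 2).
  have mK : K < rootS R m.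
    rewrite -ltr_sqr ?nnegrE ?(ltW K0) ?(ltW (rootS_gt0 _ _))// sqr_rootS.
    apply: lt_le_trans (archi_boundP (sqr_ge0 K)) _.
    by rewrite ler_nat.
  have [r rP] := bounded_norm R [seq y + u | u <- reach d m].
  exists r => z rz.
  have zr : z - y \notin reach d m.
    apply/negP => zm; have := rP z; rewrite leNgt rz => h.
    by have := h (introT mapP (ex_intro2 _ _ (z - y) zm (esym (subrKC y z)))).
  have gz : g z <= kap * C * (6 / rootS R m).
    apply: limr_le; first exact: Gg.
    near=> n; have mn : (m <= n)%N by near: n; exact: nbhs_infty_ge.
    rewrite /green_sum (@big_cat_nat _ _ _ m)//= big_nat big1 ?add0r.
      by rewrite -(subnKC mn); exact: hsum.
    move=> k /andP[_ km]; rewrite heat_reach ?mulr0//.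
    by apply: contra zr; apply: reach_mono; exact: ltnW.
  have g0 : 0 <= g z.
    apply: limr_ge; first exact: Gg.
    by apply: nearW => n; exact: green_sum_ge0.
  rewrite ger0_norm//; apply: le_lt_trans gz _.
  by move: mK; rewrite /K ltr_pdivrMr// mulrA ltr_pdivrMr ?rootS_gt0// [eps * _]mulrC.
suff -> : decaying_green a y = g by exact: Gg.
apply: xget_unique; first by split.
move=> g' [g'v g'P]; apply/funext => z; apply/eqP; rewrite -subr_eq0; apply/eqP.
apply: (@harmonic_vanishing a (fun z => g' z - g z)) => //.
  move=> eps eps0; have eps2 : 0 < eps / 2 by rewrite divr_gt0.
  have [r rP] := gv _ eps2; have [r' r'P] := g'v _ eps2.
  exists (Num.max r r') => {}z; rewrite gt_max => /andP[/rP h1 /r'P h2].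
  by apply: le_lt_trans (ler_normB _ _) _; lra.
move=> {}z; rewrite -[RHS]mul1r; apply: (harmonic_walk d_gt0 (oner_neq0 R)) => w.
 rewrite invr1 subrr mul0r mul0r add0r.
have -> : (fun z => g' z - g z) = (fun z => g' z + (-1) * g z).
  by apply/funext => v; rewrite mulN1r.
by rewrite elliptic_opDZ g'P gP mulN1r subrr.
Unshelve. all: by end_near. Qed.

(** Conservation of mass bounds the l1 norm of every partial sum by [T]. Two summable solutions are
    bounded, so their difference vanishes by [harmonic_bounded]. *)
Lemma massive_green_cvg a (T : R) y x : 0 < T -> elliptic a ->
  green_sum a (1 + kap / T)^-1 y ^~ x @ \oo --> massive_green a T y x.
Proof.
move=> T0 ea; set theta := (1 + kap / T)^-1.
have kT : 0 < kap / T by rewrite divr_gt0.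
have th0 : 0 < theta by rewrite invr_gt0; lra.
have th1 : theta < 1 by rewrite invf_lt1; lra.
have thN0 : theta != 0 by rewrite lt0r_neq0.
have thE : (theta^-1 - 1) / kap = T^-1.
  by rewrite /theta invrK addrC addKr; field; rewrite !lt0r_neq0.
(* As [kap = T (theta^-1 - 1)], each term equals [T theta^k - T theta^(k+1)]. *)
have geo n : \sum_(0 <= k < n) kap * theta ^+ k.+1 <= T.
  apply: le_trans (@sum_telescope_le R _ (fun k => T * theta ^+ k) n _ _) _.
  - move=> k; have -> : kap = T * (theta^-1 - 1).
      by rewrite -[LHS](mulfK (lt0r_neq0 T0)) mulrC /theta invrK addrC addKr; field; rewrite lt0r_neq0.
    by rewrite exprS; move: (theta ^+ k) => p; rewrite le_eqVlt; apply/orP; left; apply/eqP; field.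
  - by move=> k; rewrite mulr_ge0 ?exprn_ge0// ltW.
  - by rewrite expr0 mulr1.
have sumT (s : seq (vertex d)) n : uniq s -> \sum_(z <- s) green_sum a theta y n z <= T.
  move=> us; rewrite /green_sum exchange_big/=; apply: le_trans (geo n).
  apply: ler_sum => k _; rewrite -mulr_sumr ler_wpM2l ?(ltW kap_gt0)//.
  rewrite -mulr_sumr -[leRHS]mulr1 ler_wpM2l ?exprn_ge0 ?(ltW th0)//.
  rewrite -(lsum_heat a k y); apply: ler_lsum_seq => //; first exact: fsupp_heat.
  exact: (heat_ge0 d_gt0 (elliptic01 lambda_gt0 ea)).
have gT n z : green_sum a theta y n z <= T.
  by have := sumT [:: z] n isT; rewrite big_seq1.
pose g z := limn (green_sum a theta y ^~ z).
have Gg z : green_sum a theta y ^~ z @ \oo --> g z.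
  exact: (green_sum_cvg ea (ltW th0) (gT ^~ z)).
have g0 z : 0 <= g z.
  apply: limr_ge; first exact: Gg.
  by apply: nearW => n; apply: green_sum_ge0 => //; exact: ltW.
have heat0 z : (fun n => theta ^+ n * heat a n y z) @ \oo --> (0 : R).
  apply: (@squeeze_cvgr _ _ _ _ (fun=> 0) (fun n => theta ^+ n)).
  - apply: nearW => n; rewrite mulr_ge0 ?exprn_ge0 ?(ltW th0)//=.
      by rewrite ler_piMr ?exprn_ge0 ?(ltW th0)//; exact: heat_le1.
    exact: (heat_ge0 d_gt0 (elliptic01 lambda_gt0 ea)).
  - exact: cvg_cst.
  - by apply: cvg_expr; rewrite gtr0_norm.
have gP z : T^-1 * g z + elliptic_op a g z = (z == y)%:R.
  by rewrite -thE; apply: (green_limP d_gt0 thN0 Gg heat0).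
have gs : summable [set: vertex d] (EFin \o g).
  apply: (@le_lt_trans _ _ T%:E); last exact: ltry.
  apply: ge_ereal_sup => _ [A [finA _] <-]; rewrite fsbig_finite//=.
  under eq_bigr do rewrite (ger0_norm (g0 _)).
  rewrite sumEFin lee_fin.
  have h := @cvgn_sum R (vertex d) (finmap.enum_fset (fset_set A)) (fun z n => green_sum a theta y n z) g Gg.
  rewrite -(cvg_lim (@Rhausdorff R) h); apply: limr_le.
    by apply/cvg_ex; eexists; exact: h.
  by apply: nearW => n; apply: sumT; exact: finmap.fset_uniq.
suff -> : massive_green a T y = g by exact: Gg.
apply: xget_unique; first by split.
move=> g' [g's g'P]; apply/funext => z; apply/eqP; rewrite -subr_eq0; apply/eqP.
have gbd (h : vertex d -> R) : summable [set: vertex d] (EFin \o h) ->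
    exists B, forall w, `|h w| <= B.
  move=> hs; exists (fine (\esum_(w in [set: vertex d]) `|(h w)%:E|)%E) => w.
  rewrite -lee_fin fineK; last first.
    by move: hs; rewrite summableE.
  apply: esum_ge; exists [set w]; first by split.
  by rewrite fsbig_set1.
have [B gB] := gbd _ gs; have [B' g'B] := gbd _ g's.
apply: (@harmonic_bounded R d a d_gt0 (elliptic01 lambda_gt0 ea) theta (fun z => g' z - g z) (B' + B)).
- by rewrite th0 th1.
- by move=> w; apply: le_trans (ler_normB _ _) _; exact: lerD.
move=> w; apply: (harmonic_walk d_gt0 thN0) => {}w; rewrite thE.
have -> : (fun z => g' z - g z) = (fun z => g' z + (-1) * g z).
  by apply/funext => v; rewrite mulN1r.
by rewrite elliptic_opDZ; have := g'P w; have := gP w; lra.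
Qed.

End GreenIdentification.

(** * Convergence of the gradient of the Green function *)

Section AbelLimit.
Variables (R : realType) (c : R^nat) (B : R).
Hypothesis cB : forall n, \sum_(0 <= k < n) `|c k| <= B.

Let A n : R := \sum_(0 <= k < n) `|c k|.

Let A_nd m n : (m <= n)%N -> A m <= A n.
Proof.
move=> mn; rewrite /A (@big_cat_nat _ _ _ m 0%N n)//= lerDl.
by apply: sumr_ge0.
Qed.

(** Among the first [N] terms, Bernoulli's inequality gives [1 - theta^k <= N (1 - theta)]; the
    later ones use only [1 - theta^k <= 1]. *)
Lemma abel_partial (theta : R) N m : 0 <= theta <= 1 ->
  \sum_(0 <= k < N + m) `|(1 - theta ^+ k.+1) * c k| <=
  N%:R * (1 - theta) * A (N + m)%N + (A (N + m)%N - A N).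
Proof.
move=> /andP[th0 th1].
have th k : 0 <= 1 - theta ^+ k <= 1.
  by rewrite subr_ge0 exprn_ile1//= lerBlDr lerDl exprn_ge0.
have thk k : (k <= N)%N -> 1 - theta ^+ k <= N%:R * (1 - theta).
  move=> kN; apply: (@le_trans _ _ (k%:R * (1 - theta))); last first.
    by rewrite ler_wpM2r ?subr_ge0// ler_nat.
  have := @bernoulli_le R (1 - theta) k; rewrite subKr.
  by move=> /(_ ltac:(lra)); lra.
have NT : 0 <= N%:R * (1 - theta) by rewrite mulr_ge0// subr_ge0.
have h1 n : (n <= N)%N -> \sum_(0 <= k < n) `|(1 - theta ^+ k.+1) * c k| <= N%:R * (1 - theta) * A n.
  move=> nN; rewrite /A mulr_sumr; rewrite !big_nat; apply: ler_sum => k /andP[_ kn].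
  have /andP[t0 _] := th k.+1.
  by rewrite normrM ger0_norm// ler_wpM2r// thk//; exact: leq_trans kn nN.
elim: m => [|m IH]; first by rewrite addn0 subrr addr0; exact: h1.
rewrite addnS big_nat_recr//= [A _.+1]/A big_nat_recr//= -/(A (N + m)).
have /andP[t0 t1] := th (N + m).+1.
rewrite normrM ger0_norm//; have := ler_piMl (normr_ge0 (c (N + m)%N)) t1.
have := mulr_ge0 NT (normr_ge0 (c (N + m)%N)).
move: IH; move: (\sum_(0 <= k < N + m) _) => S.
lra.
Qed.

(** Abel's theorem for an absolutely convergent series: [N] is fixed so that the tail is at most
    [eps / 2], then [T > 2 N B / eps] makes the head at most [eps / 2], because
    [1 - theta <= 1 / T]. *)
Lemma abel_lim : (fun T => limn (series (fun k => (1 + T^-1)^-1 ^+ k.+1 * c k))) @ +oo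
  --> limn (series c).
Proof.
have Acvg : cvgn A by exact: (is_cvg_normed_series cB).
have B0 : 0 <= B by apply: le_trans (cB 0); rewrite big_nil.
have ccvg : cvgn (series c) by exact: normed_cvg (is_cvg_normed_series cB).
suff H (eps : R) : 0 < eps -> \forall T \near +oo,
    `|limn (series c) - limn (series (fun k => (1 + T^-1)^-1 ^+ k.+1 * c k))| <= eps.
  by apply/cvgrPdist_le.
move=> eps0.
have eps2 : 0 < eps / 2 by rewrite divr_gt0.
have [N _ /(_ N (leqnn N)) /= AN] := (cvgrPdist_le _ _).1 Acvg _ eps2.
near=> T; have T0 : 0 < T by near: T; exact: nbhs_pinfty_gt.
have TB : 2 * N%:R * B / eps < T by near: T; apply: nbhs_pinfty_gt; rewrite num_real.
set theta := (1 + T^-1)^-1.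
have iT : 0 < T^-1 by rewrite invr_gt0.
have th0 : 0 <= theta by rewrite invr_ge0; lra.
have th1 : theta <= 1 by rewrite invf_le1; lra.
have thT : 1 - theta <= T^-1.
  rewrite lerBlDr; have -> : 1 = (1 + T^-1) * theta by rewrite mulfV//; lra.
  by rewrite mulrDl mul1r addrC lerD2r ler_piMr// ltW.
have thetacB n : \sum_(0 <= k < n) `|theta ^+ k.+1 * c k| <= B.
  apply: le_trans (cB n); apply: ler_sum => k _.
  by rewrite normrM ger0_norm ?exprn_ge0// ler_piMl// exprn_ile1.
have tcvg : cvgn (series (fun k => theta ^+ k.+1 * c k)).
  exact: normed_cvg (is_cvg_normed_series thetacB).
pose D := series (fun k => (1 - theta ^+ k.+1) * c k).
have Dl : D @ \oo --> limn (series c) - limn (series (fun k => theta ^+ k.+1 * c k)).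
  rewrite (_ : D = fun n => series c n - series (fun k => theta ^+ k.+1 * c k) n).
    exact: cvgB.
  apply/funext => n; rewrite /D /series/= -sumrB; apply: eq_bigr => k _.
  by rewrite mulrBl mul1r.
rewrite -(cvg_lim (@Rhausdorff R) Dl) /D; apply: norm_lim_series_le => n.
apply: (@le_trans _ _ (\sum_(0 <= k < N + n) `|(1 - theta ^+ k.+1) * c k|)).
  rewrite [leRHS](@big_cat_nat _ _ _ n)//= ?leq_addl// lerDl.
  by apply: sumr_ge0.
apply: le_trans (abel_partial _ _ _) _; first by rewrite th0.
rewrite [leRHS](splitr eps) lerD//.
  apply: (@le_trans _ _ (N%:R * T^-1 * B)).
    apply: ler_pM; rewrite ?mulr_ge0 ?subr_ge0 ?sumr_ge0//; last exact: cB.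
    by rewrite ler_wpM2l.
  move: TB; rewrite ltr_pdivrMr// => TB.
  rewrite mulrAC ler_pdivrMr// mulrAC ler_pdivlMr//; lra.
apply: le_trans AN; apply: le_trans (ler_norm _); rewrite lerD2r.
exact: (nondecreasing_cvgn_le A_nd Acvg).
Unshelve. all: by end_near. Qed.

End AbelLimit.

Section GradGreen.
Variables (R : realType) (d : nat) (lambda : R).
Hypotheses (d_gt1 : (2 <= d)%N) (lambda_gt0 : 0 < lambda).
Variable a : edge d -> R.
Hypothesis ea : forall e, lambda <= a e <= 1.
Local Notation kap := (kappa R d).

Let d_gt0 : (0 < d)%N := ltnW d_gt1.

Lemma grad_green_sum theta y n e : grad (green_sum a theta y n) e =
  kap * series (fun k => theta ^+ k.+1 * grad (heat a k y) e) n.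
Proof.
rewrite /grad !green_sumE -mulrBr /series/= -sumrB; congr (_ * _).
by apply: eq_bigr => k _; rewrite mulrBr.
Qed.

(** Both branches of the definition lead to the same series. In dimension 2 the available kernel
    bound, of order [1 / n], is not summable, so the absolute convergence of the gradients is
    assumed here and feeds Abel's theorem. *)
Lemma grad_greenE e y (B : R) :
  (forall n, \sum_(0 <= k < n) `|grad (heat a k y) e| <= B) ->
  grad_green a e y = kap * limn (series (fun k => grad (heat a k y) e)).
Proof.
pose c k := grad (heat a k y) e; rewrite -/c => cB.
have {}cB n : \sum_(0 <= k < n) `|c k| <= B by exact: cB.
have ccvg : cvgn (series c) by exact: normed_cvg (is_cvg_normed_series cB).
rewrite /grad_green; case: ifPn => d3.
  have h1 : (fun n => grad (green_sum a 1 y n) e) @ \oo --> grad (decaying_green a y) e.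
    by apply: cvgB; exact: (decaying_green_cvg d_gt0 lambda_gt0).
  have h2 : (fun n => grad (green_sum a 1 y n) e) @ \oo --> kap * limn (series c).
    under eq_fun do rewrite grad_green_sum.
    apply: cvgMr; rewrite (_ : (fun k => _) = c)//.
    by apply/funext => k; rewrite expr1n mul1r.
  exact: cvg_unique h1 h2.
apply: cvg_lim => //.
have k0 : 0 < kap by exact: kappa_gt0.
(* The mass [1 / T] corresponds to [theta = (1 + kap / T)^-1], so the limit of [abel_lim] is taken
   along [T / kap]. *)
have lim_scaled : (fun T : R => limn (series (fun k => (1 + (T / kap)^-1)^-1 ^+ k.+1 * c k))) @ +oo
    --> limn (series c).
  apply: (cvg_comp (fun T => T / kap) _ _ (abel_lim cB)).
  apply: (gt0_cvgMly (f := id)); first by rewrite invr_gt0.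
  by move=> S.
have E (T : R) : 0 < T -> grad (massive_green a T y) e =
    kap * limn (series (fun k => (1 + (T / kap)^-1)^-1 ^+ k.+1 * c k)).
  move=> T0; set theta := (1 + (T / kap)^-1)^-1.
  have thE : theta = (1 + kap / T)^-1 by rewrite /theta invf_div.
  have h1 : (fun n => grad (green_sum a theta y n) e) @ \oo --> grad (massive_green a T y) e.
    by rewrite thE; apply: cvgB; exact: (massive_green_cvg d_gt0 lambda_gt0).
  have th0 : 0 <= theta by rewrite thE invr_ge0 addr_ge0// divr_ge0// ltW.
  have th1 : theta <= 1.
    by rewrite thE invf_le1 ?lerDl ?divr_ge0 ?(ltW T0) ?(ltW k0)// ltr_pwDl// divr_ge0 ?(ltW T0) ?(ltW k0).
  have thetacB n : \sum_(0 <= k < n) `|theta ^+ k.+1 * c k| <= B.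
    apply: le_trans (cB n); apply: ler_sum => k _.
    by rewrite normrM ger0_norm ?exprn_ge0// ler_piMl// exprn_ile1.
  have h2 : (fun n => grad (green_sum a theta y n) e) @ \oo -->
      kap * limn (series (fun k => theta ^+ k.+1 * c k)).
    under eq_fun do rewrite grad_green_sum.
    by apply: cvgMr; exact: normed_cvg (is_cvg_normed_series thetacB).
  exact: cvg_unique h1 h2.
have h : (fun T : R => kap * limn (series (fun k => (1 + (T / kap)^-1)^-1 ^+ k.+1 * c k))) @ +oo
    --> kap * limn (series c) by apply: cvgMr.
apply: cvg_trans h; apply: near_eq_cvg.
near=> T; rewrite E//; near: T; exact: nbhs_pinfty_gt.
Unshelve. all: by end_near. Qed.

End GradGreen.

(** * Pointwise bounds by series over time *)

(* The lower integral of a nonmeasurable nonnegative function is monotone too,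
   so that the measurability of the Green function never has to be proved. *)
Lemma le_integral_nonneg dp (T : measurableType dp) (R : realType)
    (mu : {measure set T -> \bar R}) (f g : T -> \bar R) :
  (forall x, (0 <= f x)%E) -> (forall x, (f x <= g x)%E) ->
  (\int[mu]_x f x <= \int[mu]_x g x)%E.
Proof.
move=> f0 fg; rewrite !ge0_integralTE//; last by move=> x; exact: le_trans (fg x).
by apply: le_ereal_sup => _ [h hf <-]; exists h => // x; exact: le_trans (hf x) (fg x).
Qed.

Lemma weighted_CS (R : realFieldType) (b w : nat -> R) n : (forall k, 0 < w k) ->
  (\sum_(0 <= k < n) b k) ^+ 2 <=
  (\sum_(0 <= k < n) w k) * \sum_(0 <= k < n) (b k ^+ 2 / w k).
Proof.
move=> w0; elim: n => [|n IH]; first by rewrite !big_nil expr0n mul0r.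
rewrite !big_nat_recr//=.
have Q0 : 0 <= \sum_(0 <= k < n) (b k ^+ 2 / w k).
  by apply: sumr_ge0 => k _; rewrite divr_ge0 ?sqr_ge0// ltW.
have A0 : 0 <= \sum_(0 <= k < n) w k by apply: sumr_ge0 => k _; exact: ltW.
have := w0 n; move: IH Q0 A0; move: (\sum_(0 <= k < n) b k) (b n) (w n).
move: (\sum_(0 <= k < n) _) (\sum_(0 <= k < n) _) => Q A S x v SAQ Q0 A0 v0.
set t := x ^+ 2 / v; have t0 : 0 <= t by rewrite divr_ge0 ?sqr_ge0// ltW.
have tv : t * v = x ^+ 2 by rewrite mulfVK// lt0r_neq0.
have h : 2 * (S * x) <= A * t + v * Q.
  have R0 : 0 <= A * t + v * Q := addr_ge0 (mulr_ge0 A0 t0) (mulr_ge0 (ltW v0) Q0).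
  apply: ler_normlW; rewrite -ler_sqr ?nnegrE//.
  rewrite real_normK ?num_real//.
  have -> : (2 * (S * x)) ^+ 2 = 4 * (S ^+ 2 * (t * v)) by rewrite tv; ring.
  have : S ^+ 2 * (t * v) <= A * Q * (t * v) by rewrite tv ler_wpM2r ?sqr_ge0.
  by have := sqr_ge0 (A * t - v * Q); lra.
by have := tv; lra.
Qed.

Lemma nneseries_le_cst (R : realType) (F : nat -> R) (B : R) : (forall k, 0 <= F k) ->
  (forall n, \sum_(0 <= k < n) F k <= B) ->
  (\sum_(0 <= k <oo) (F k)%:E <= B%:E)%E.
Proof.
move=> F0 FB; apply: lime_le.
  by apply: is_cvg_nneseries => k _ _; rewrite lee_fin.
by apply: nearW => n; rewrite sumEFin lee_fin.
Qed.

Lemma le_nneseries_fin (R : realType) (F : nat -> R) n : (forall k, 0 <= F k) ->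
  (\sum_(0 <= k <oo) (F k)%:E < +oo)%E ->
  \sum_(0 <= k < n) F k <= fine (\sum_(0 <= k <oo) (F k)%:E)%E.
Proof.
move=> F0 Ffin; rewrite -lee_fin fineK; last first.
  rewrite ge0_fin_numE//; apply: nneseries_ge0 => k _ _; rewrite lee_fin//.
by rewrite -sumEFin; apply: nneseries_lim_ge => k _ _; rewrite lee_fin.
Qed.

Lemma mule_add_pinfty (R : realType) (eps : R) (x y : \bar R) :
  0 < eps -> (0 <= x)%E -> (0 <= y)%E -> ~~ ((x < +oo)%E && (y < +oo)%E) ->
  (eps%:E * (x + y) = +oo)%E.
Proof.
by move: x y => [x||] [y||] //= eps0 _ _; rewrite ?ltry// gt0_muley ?lte_fin.
Qed.

Section GreenSeriesBounds.
Variables (R : realType) (d : nat) (lambda : R).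
Hypothesis (lambda_gt0 : 0 < lambda).
Variable a : edge d.+2 -> R.
Hypothesis ea : forall e, lambda <= a e <= 1.
Implicit Types (x y : vertex d.+2) (e b : edge d.+2).
Local Notation kap := (kappa R d.+2).

(** Each square is divided by the size expected of its root, as in [annealed_sqr_grad_heat].
    Cauchy-Schwarz in time and the expectation of this series then each produce the sum of
    [sum_root_profile], which plays the part of Minkowski's inequality in L2 of the probability
    space. *)
Definition green_energy e y : \bar R :=
  (\sum_(0 <= k <oo) (grad (heat a k y) e ^+ 2 /
     (rootS R k / profile R k (e.1 - y)))%:E)%E.

Definition mixed_series e b : \bar R :=
  (\sum_(0 <= k <oo)
    (`|grad (heat a k (b.1 + basis b.2)) e - grad (heat a k b.1) e|)%:E)%E.

Let time_weight_gt0 k x : 0 < rootS R k / profile R k x.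
Proof. by rewrite divr_gt0 ?rootS_gt0 ?profile_gt0. Qed.

Let kap_gt0 : 0 < kap. Proof. exact: kappa_gt0. Qed.

Lemma green_energy_ge0 e y : (0 <= green_energy e y)%E.
Proof.
by apply: nneseries_ge0 => k _ _; rewrite lee_fin divr_ge0 ?sqr_ge0// ltW.
Qed.

Lemma mixed_series_ge0 e b : (0 <= mixed_series e b)%E.
Proof. by apply: nneseries_ge0 => k _ _; rewrite lee_fin. Qed.

Let decay x : R := 8 / Num.sqrt (bracket2 R x) ^+ d.+1.

Lemma sum_grad_heat_le e y n : (green_energy e y < +oo)%E ->
  \sum_(0 <= k < n) `|grad (heat a k y) e| <=
  Num.sqrt (decay (e.1 - y) * fine (green_energy e y)).
Proof.
move=> Hfin.
have S0 : 0 <= \sum_(0 <= k < n) `|grad (heat a k y) e| by exact: sumr_ge0.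
rewrite -[leLHS]ger0_norm// -sqrtr_sqr ler_wsqrtr//.
apply: le_trans (weighted_CS _ _ (fun k => time_weight_gt0 k (e.1 - y))) _.
apply: ler_pM.
- by apply: sumr_ge0 => k _; exact: ltW.
- by apply: sumr_ge0 => k _; rewrite divr_ge0 ?sqr_ge0// ltW.
- exact: sum_root_profile.
under eq_bigr do rewrite real_normK ?num_real//.
apply: (@le_nneseries_fin R (fun k => grad (heat a k y) e ^+ 2 /
  (rootS R k / profile R k (e.1 - y)))) => // k.
by rewrite divr_ge0 ?sqr_ge0// ltW.
Qed.

(** Where the energy is infinite the positive prefactor makes the right side [+oo]; elsewhere the
    gradient series converges absolutely and represents the Green gradient. *)
Lemma sqr_grad_green_le e y :
  ((`|grad_green a e y| ^+ 2)%:E <=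
    (kap ^+ 2 * decay (e.1 - y))%:E * green_energy e y)%E.
Proof.
have D0 : 0 < decay (e.1 - y) by rewrite divr_gt0// exprn_gt0// sqrtr_gt0 bracket2_gt0.
have K0 : 0 < kap ^+ 2 * decay (e.1 - y) by rewrite mulr_gt0// exprn_gt0.
have [Hfin|] := ltP (green_energy e y) +oo%E; last first.
  by rewrite leye_eq => /eqP ->; rewrite gt0_muley ?lte_fin// leey.
have Hfn : green_energy e y \is a fin_num by rewrite ge0_fin_numE// green_energy_ge0.
rewrite -(fineK Hfn) -EFinM lee_fin.
set h := fine _; have h0 : 0 <= h by rewrite fine_ge0// green_energy_ge0.
have B n := sum_grad_heat_le n Hfin.
rewrite (grad_greenE (isT : (2 <= d.+2)%N) lambda_gt0 ea B) normrM exprMn.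
rewrite (gtr0_norm kap_gt0) -(mulrA (kap ^+ 2)) ler_wpM2l ?sqr_ge0//.
rewrite -(@sqr_sqrtr _ (_ * h)) ?mulr_ge0 ?(ltW D0)//.
by rewrite lerXn2r ?nnegrE ?sqrtr_ge0//; exact: norm_lim_series_le.
Qed.

(* The summand with [eps] is infinite where one of the series defining the two
   gradients fails to converge absolutely. *)
Lemma mixed_grad_green_le e b (eps : R) : 0 < eps ->
  ((`|mixed_grad_green a e b|)%:E <=
    kap%:E * mixed_series e b +
    eps%:E * (green_energy e (b.1 + basis b.2)%R + green_energy e b.1))%E.
Proof.
move=> eps0.
have H10 := green_energy_ge0 e (b.1 + basis b.2).
have H20 := green_energy_ge0 e b.1.
have M0 : (0 <= kap%:E * mixed_series e b)%E.
  by apply: mule_ge0; [rewrite lee_fin ltW|exact: mixed_series_ge0].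
have [/andP[B1 B2]|] := boolP ((green_energy e (b.1 + basis b.2)%R < +oo)%E &&
    (green_energy e b.1 < +oo)%E); last first.
  move=> /(mule_add_pinfty eps0 H10 H20) ->.
  by rewrite addey ?leey// gt_eqF// (lt_le_trans (ltNyr 0)).
have N0 : (0 <= eps%:E * (green_energy e (b.1 + basis b.2)%R + green_energy e b.1))%E.
  by apply: mule_ge0; [rewrite lee_fin ltW|exact: (adde_ge0 H10 H20)].
apply: (@le_trans _ _ (kap%:E * mixed_series e b)%E); last exact: leeDl.
have [Hfin|] := ltP (mixed_series e b) +oo%E; last first.
  by rewrite leye_eq => /eqP ->; rewrite gt0_muley ?lte_fin// leey.
have Hfn : mixed_series e b \is a fin_num by rewrite ge0_fin_numE// mixed_series_ge0.
rewrite -(fineK Hfn) -EFinM lee_fin.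
have {}B1 n := sum_grad_heat_le n B1; have {}B2 n := sum_grad_heat_le n B2.
rewrite /mixed_grad_green (grad_greenE (isT : (2 <= d.+2)%N) lambda_gt0 ea B1).
rewrite (grad_greenE (isT : (2 <= d.+2)%N) lambda_gt0 ea B2) -mulrBr normrM.
rewrite (gtr0_norm kap_gt0) ler_wpM2l ?(ltW kap_gt0)//.
pose D := series (fun k => grad (heat a k (b.1 + basis b.2)) e - grad (heat a k b.1) e).
have Dl : D @ \oo --> limn (series (fun k => grad (heat a k (b.1 + basis b.2)) e))
    - limn (series (fun k => grad (heat a k b.1) e)).
  rewrite (_ : D = fun n => series (fun k => grad (heat a k (b.1 + basis b.2)) e) n
    - series (fun k => grad (heat a k b.1) e) n).
    by apply: cvgB; apply: normed_cvg;
      [exact: is_cvg_normed_series B1|exact: is_cvg_normed_series B2].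
  by apply/funext => n; rewrite /D /series/= -sumrB.
rewrite -(cvg_lim (@Rhausdorff R) Dl) /D; apply: norm_lim_series_le => n.
exact: le_nneseries_fin.
Qed.

End GreenSeriesBounds.

(** * Comparison of the midpoint distances with the lattice bracket *)

Section Distances.
Variables (R : realType) (d : nat).
Implicit Types (x y : vertex d) (e b : edge d).

Lemma bracket2E x : bracket2 R x = 1 + \sum_(i < d) (x 0 i)%:~R ^+ 2.
Proof. by []. Qed.

Lemma basisE i j : ((basis i : vertex d) 0 j)%:~R = (i == j)%:R :> R.
Proof. by rewrite !mxE eqxx eq_sym /=; case: (i == j). Qed.

Lemma midpointE e j : midpoint R e 0 j = (e.1 0 j)%:~R + (e.2 == j)%:R / 2.
Proof.
rewrite /midpoint /point_of !mxE rmorphD -[in RHS](basisE e.2 j) !mxE.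
by field.
Qed.

Lemma sum_delta_sqr i : \sum_(j < d) ((i == j)%:R : R) ^+ 2 = 1.
Proof.
rewrite (bigD1 i)//= eqxx expr1n big1 ?addr0// => j ji.
by rewrite eq_sym (negbTE ji) expr0n.
Qed.

Lemma dist_edge_vertex_le e y :
  dist_edge_vertex R e y + 1 <= 3 * Num.sqrt (bracket2 R (e.1 - y)).
Proof.
have D1 : 1 <= Num.sqrt (bracket2 R (e.1 - y)).
  by rewrite -[leLHS]sqrtr1 ler_wsqrtr// bracket2_ge1.
suff : dist_edge_vertex R e y <= 2 * Num.sqrt (bracket2 R (e.1 - y)) by lra.
have -> : (2 : R) = Num.sqrt (2 ^+ 2) by rewrite sqrtr_sqr ger0_norm.
rewrite -sqrtrM ?sqr_ge0// ler_wsqrtr//.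
apply: (@le_trans _ _ (\sum_(i < d) (2 * ((e.1 - y) 0 i)%:~R ^+ 2 + (e.2 == i)%:R ^+ 2))).
  apply: ler_sum => i _.
  have -> : (midpoint R e - point_of R y) 0 i =
      (e.1 0 i)%:~R - (y 0 i)%:~R + (e.2 == i)%:R / 2.
    by rewrite mxE midpointE /point_of !mxE; ring.
  rewrite 2!mxE rmorphB; move: (_ - _) ((_ == _)%:R : R) => p q.
  by have := sqr_ge0 (p - q / 2); have := sqr_ge0 q; lra.
rewrite big_split/= -mulr_sumr sum_delta_sqr bracket2E.
have : 0 <= \sum_(i < d) ((e.1 - y) 0 i)%:~R ^+ 2 :> R.
  by apply: sumr_ge0 => i _; exact: sqr_ge0.
lra.
Qed.

Lemma dist_edge_edge_le e b :
  dist_edge_edge R e b + 1 <= 3 * Num.sqrt (bracket2 R (e.1 - b.1)).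
Proof.
have D1 : 1 <= Num.sqrt (bracket2 R (e.1 - b.1)).
  by rewrite -[leLHS]sqrtr1 ler_wsqrtr// bracket2_ge1.
suff : dist_edge_edge R e b <= 2 * Num.sqrt (bracket2 R (e.1 - b.1)) by lra.
have -> : (2 : R) = Num.sqrt (2 ^+ 2) by rewrite sqrtr_sqr ger0_norm.
rewrite -sqrtrM ?sqr_ge0// ler_wsqrtr//.
apply: (@le_trans _ _ (\sum_(i < d) (2 * ((e.1 - b.1) 0 i)%:~R ^+ 2 +
    ((e.2 == i)%:R ^+ 2 + (b.2 == i)%:R ^+ 2)))).
  apply: ler_sum => i _.
  have -> : (midpoint R e - midpoint R b) 0 i =
      (e.1 0 i)%:~R - (b.1 0 i)%:~R + ((e.2 == i)%:R - (b.2 == i)%:R) / 2.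
    by rewrite mxE midpointE mxE midpointE; field.
  rewrite 2!mxE rmorphB; move: (_ - _) ((e.2 == _)%:R : R) ((b.2 == _)%:R : R) => p q r.
  by have := sqr_ge0 (p - (q - r) / 2); have := sqr_ge0 (q + r); lra.
rewrite !big_split/= -mulr_sumr !sum_delta_sqr bracket2E.
have : 0 <= \sum_(i < d) ((e.1 - b.1) 0 i)%:~R ^+ 2 :> R.
  by apply: sumr_ge0 => i _; exact: sqr_ge0.
lra.
Qed.

Lemma decay_le (D r : R) n : 0 <= r -> r + 1 <= 3 * D ->
  (D ^+ n)^-1 <= 3 ^+ n * (r + 1) ^ (- n%:Z).
Proof.
move=> r0 rD; have D0 : 0 < D by lra.
have r1 : 0 < r + 1 by lra.
rewrite -exprnN -[leLHS]mul1r ler_pdivrMr ?exprn_gt0// mulrAC ler_pdivlMr ?exprn_gt0//.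
by rewrite mul1r -exprMn lerXn2r ?nnegrE ?mulr_ge0// ltW.
Qed.

End Distances.

(** * Annealed bounds on the Green function *)

Section AnnealedGreen.
Variables (R : realType) (d : nat) (lambda : R) (lambda01 : 0 < lambda < 1).
Local Notation Om := (Omega d.+2 lambda01).
Implicit Types (x y : vertex d.+2) (e b : edge d.+2).

Let time_weight_gt0 k x : 0 < rootS R k / profile R k x.
Proof. by rewrite divr_gt0 ?rootS_gt0 ?profile_gt0. Qed.

Let energy_term e y k (a : Om) :=
  grad (heat (coef a) k y) e ^+ 2 / (rootS R k / profile R k (e.1 - y)).

Let measurable_energy_term e y k : measurable_fun setT (energy_term e y k).
Proof.
apply: measurable_funM => //; apply: measurable_funX; exact: measurable_grad_heat.
Qed.

Let mixed_term e b k (a : Om) :=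
  `|grad (heat (coef a) k (b.1 + basis b.2)) e - grad (heat (coef a) k b.1) e|.

Let measurable_mixed_term e b k : measurable_fun setT (mixed_term e b k).
Proof.
apply: measurableT_comp; first exact: normr_measurable.
by apply: measurable_funB; exact: measurable_grad_heat.
Qed.

Let energy_term_ge0 e y k a : 0 <= energy_term e y k a.
Proof. by rewrite /energy_term divr_ge0 ?sqr_ge0// ltW. Qed.

Lemma measurable_green_energy e y :
  measurable_fun setT (fun a : Om => green_energy (coef a) e y).
Proof.
apply: ge0_emeasurable_sum => [k a _ _|k _]; first by rewrite lee_fin; exact: energy_term_ge0.
by apply/measurable_EFinP; exact: measurable_energy_term.
Qed.

Lemma measurable_mixed_series e b :
  measurable_fun setT (fun a : Om => mixed_series (coef a) e b).
Proof.
apply: ge0_emeasurable_sum => [k a _ _|k _]; first by rewrite lee_fin.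
by apply/measurable_EFinP; exact: measurable_mixed_term.
Qed.

Lemma integral_green_energy_le : exists2 C : R, 0 < C &
  forall P : probability Om R, stationary P -> forall e y,
  (\int[P]_a green_energy (coef a) e y <=
    (C * (8 / Num.sqrt (bracket2 R (e.1 - y)) ^+ d.+1))%:E)%E.
Proof.
have [C C0 HC] := annealed_sqr_grad_heat lambda01 (isT : (0 < d.+2)%N).
exists C => // P stP e y; rewrite integral_nneseries//; last 2 first.
- by move=> k; apply/measurable_EFinP; exact: measurable_energy_term.
- by move=> k a _; rewrite lee_fin; exact: energy_term_ge0.
pose w k : R := rootS R k / profile R k (e.1 - y).
have w0 k : 0 < w k by exact: time_weight_gt0.
apply: (@le_trans _ _ (\sum_(0 <= k <oo) (C * w k)%:E)%E).
  apply: lee_nneseries => k _.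
    by move=> _; apply: integral_ge0 => a _; rewrite lee_fin; exact: energy_term_ge0.
  under eq_integral do rewrite mulrC.
  rewrite integral_scale; last 3 first.
  - by apply: measurable_funX; exact: measurable_grad_heat.
  - by move=> a; exact: sqr_ge0.
  - by rewrite invr_ge0 ltW.
  apply: le_trans (lee_wpmul2l _ (HC P stP k e y)) _; first by rewrite lee_fin invr_ge0 ltW.
  by rewrite -EFinM lee_fin -/(w k) mulrCA ler_wpM2l ?(ltW C0)// expr2 mulKf// lt0r_neq0.
apply: nneseries_le_cst => [k|n]; first by rewrite mulr_ge0// ltW.
by rewrite -mulr_sumr ler_wpM2l ?(ltW C0)//; exact: sum_root_profile.
Qed.

Lemma integral_mixed_series_le : exists2 C : R, 0 < C &
  forall P : probability Om R, stationary P -> forall e b,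
  (\int[P]_a mixed_series (coef a) e b <=
    (C * (4 / Num.sqrt (bracket2 R (e.1 - b.1)) ^+ d.+2))%:E)%E.
Proof.
have [C C0 HC] := annealed_mixed_grad_heat lambda01 (isT : (0 < d.+2)%N).
exists C => // P stP e b; rewrite integral_nneseries//; last first.
  by move=> k; apply/measurable_EFinP; exact: measurable_mixed_term.
apply: (@le_trans _ _ (\sum_(0 <= k <oo) (C * (profile R k (e.1 - b.1))^-1)%:E)%E).
  apply: lee_nneseries => k _; last exact: HC.
  by move=> _; apply: integral_ge0 => a _; rewrite lee_fin.
apply: nneseries_le_cst => [k|n].
  by rewrite mulr_ge0 ?invr_ge0 ?(ltW C0)// ltW// profile_gt0.
by rewrite -mulr_sumr ler_wpM2l ?(ltW C0)//; exact: sum_inv_profile.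
Qed.

Let lambda_gt0 : 0 < lambda. Proof. by case/andP: lambda01. Qed.
Let kap_gt0 : 0 < kappa R d.+2. Proof. exact: kappa_gt0. Qed.
Let D x := Num.sqrt (bracket2 R x).

Let D_ge1 x : 1 <= D x.
Proof. by rewrite -[leLHS]sqrtr1 ler_wsqrtr// bracket2_ge1. Qed.

Lemma annealed_grad_green : exists2 C : R, 0 < C &
  forall P : probability Om R, stationary P -> forall e y,
  (\int[P]_a (`|grad_green (coef a) e y| ^+ 2)%:E <=
    ((C / D (e.1 - y) ^+ d.+1) ^+ 2)%:E)%E.
Proof.
have [C C0 HC] := integral_green_energy_le.
pose K := kappa R d.+2 ^+ 2 * 8 * C * 8.
have K0 : 0 < K by rewrite /K !mulr_gt0// exprn_gt0.
exists (Num.sqrt K) => [|P stP e y]; first by rewrite sqrtr_gt0.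
set c := kappa R d.+2 ^+ 2 * (8 / D (e.1 - y) ^+ d.+1).
have c0 : 0 <= c by rewrite mulr_ge0 ?sqr_ge0// divr_ge0// exprn_ge0// sqrtr_ge0.
apply: (@le_trans _ _ (\int[P]_a (c%:E * green_energy (coef a) e y))%E).
  apply: le_integral_nonneg => a; first by rewrite lee_fin sqr_ge0.
  exact: (sqr_grad_green_le lambda_gt0 (coefP a)).
rewrite ge0_integralZl//; last 2 first.
- exact: measurable_green_energy.
- by move=> a _; exact: green_energy_ge0.
apply: le_trans (lee_wpmul2l _ (HC P stP e y)) _; first by rewrite lee_fin.
rewrite -EFinM lee_fin expr_div_n sqr_sqrtr ?(ltW K0)// -/(D _) /c /K.
have : D (e.1 - y) ^+ d.+1 != 0 by rewrite expf_neq0// lt0r_neq0// (lt_le_trans ltr01).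
move: (D _ ^+ _) (kappa _ _) => p k p0; rewrite le_eqVlt; apply/orP; left; apply/eqP.
by field.
Qed.

Lemma annealed_mixed_grad_green : exists2 C : R, 0 < C &
  forall P : probability Om R, stationary P -> forall e b,
  (\int[P]_a (`|mixed_grad_green (coef a) e b|)%:E <=
    (C / D (e.1 - b.1) ^+ d.+2)%:E)%E.
Proof.
have [C1 C10 H1] := integral_green_energy_le.
have [C2 C20 H2] := integral_mixed_series_le.
exists (kappa R d.+2 * (C2 * 4) + (C1 * 8 + C1 * 8)) => [|P stP e b].
  by rewrite addr_gt0 ?mulr_gt0// addr_gt0 ?mulr_gt0.
set p := D (e.1 - b.1) ^+ d.+2.
have p0 : 0 < p by rewrite exprn_gt0// (lt_le_trans ltr01 (D_ge1 _)).
(* The decay of the energy is discarded: the required order will come from the small factor in front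
   of it. *)
have H1' y : (\int[P]_a green_energy (coef a) e y <= (C1 * 8)%:E)%E.
  apply: le_trans (H1 P stP e y) _; rewrite lee_fin ler_wpM2l ?(ltW C10)//.
  have Dy := exprn_ege1 d.+1 (D_ge1 (e.1 - y)).
  by rewrite ler_piMr// invf_le1// (lt_le_trans ltr01).
have mH y : measurable_fun setT (fun a : Om => green_energy (coef a) e y).
  exact: measurable_green_energy.
have mM : measurable_fun setT (fun a : Om => mixed_series (coef a) e b).
  exact: measurable_mixed_series.
have k0 : (0 <= (kappa R d.+2)%:E)%E by rewrite lee_fin ltW.
have q0 : (0 <= (p^-1)%:E)%E by rewrite lee_fin invr_ge0 ltW.
(* The free parameter of [mixed_grad_green_le] is set to [p^-1], the target decay, so the bounded
   expected energies contribute at the right order. *)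
apply: (@le_trans _ _ (\int[P]_a ((kappa R d.+2)%:E * mixed_series (coef a) e b +
   (p^-1)%:E * (green_energy (coef a) e (b.1 + basis b.2)%R + green_energy (coef a) e b.1)))%E).
  apply: le_integral_nonneg => a; first by rewrite lee_fin.
  by apply: (mixed_grad_green_le lambda_gt0 (coefP a)); rewrite invr_gt0.
rewrite ge0_integralD//; last 4 first.
- by move=> a _; rewrite mule_ge0// mixed_series_ge0.
- by apply: measurable_funeM.
- by move=> a _; rewrite mule_ge0// adde_ge0// green_energy_ge0.
- by apply: measurable_funeM; exact: emeasurable_funD.
rewrite ge0_integralZl//; last by move=> a _; exact: mixed_series_ge0.
rewrite ge0_integralZl//; last 2 first.
- exact: emeasurable_funD.
- by move=> a _; rewrite adde_ge0// green_energy_ge0.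
rewrite ge0_integralD//; last 2 first.
- by move=> a _; exact: green_energy_ge0.
- by move=> a _; exact: green_energy_ge0.
apply: (@le_trans _ _ ((kappa R d.+2)%:E * (C2 * (4 / p))%:E +
    (p^-1)%:E * ((C1 * 8)%:E + (C1 * 8)%:E))%E).
  by apply: leeD; apply: lee_wpmul2l => //; [exact: H2|exact: leeD].
rewrite -(EFinD (C1 * 8)) -!EFinM -EFinD lee_fin le_eqVlt; apply/orP; left; apply/eqP.
by field; rewrite lt0r_neq0.
Qed.

End AnnealedGreen.

Theorem proposition1p2 (R : realType) (d : nat) (d_ge2 : (2 <= d)%N)
    (lambda : R) (lambda01 : 0 < lambda < 1) :
  exists C : R,
    forall P : probability (Omega d lambda01) R, stationary P ->
      (forall (e : edge d) (y : vertex d),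
         ('E_P[fun a => (`|grad_green (coef a) e y| ^+ 2)%R] `^ 2^-1
            <= (C * (dist_edge_vertex R e y + 1) ^ (1 - d%:Z))%:E)%E)
      /\
      (forall e b : edge d,
         ('E_P[fun a => (`|mixed_grad_green (coef a) e b|)%R]
            <= (C * (dist_edge_edge R e b + 1) ^ (- d%:Z))%:E)%E).
Proof.
(* From here on the dimension is [d.+2], so the exponents become [- d.+1] and [- d.+2]. *)
case: d d_ge2 lambda01 => [|[|d]]// _ lambda01.
have [C1 C10 H1] := annealed_grad_green d lambda01.
have [C2 C20 H2] := annealed_mixed_grad_green d lambda01.
(* The powers of 3 come from comparing distance plus one with three times the bracket; the sum of
   the two constants serves both bounds. *)
exists (C1 * 3 ^+ d.+1 + C2 * 3 ^+ d.+2) => P stP.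
have s0 : 0 <= C1 * 3 ^+ d.+1 by rewrite mulr_ge0 ?exprn_ge0// ltW.
have t0 : 0 <= C2 * 3 ^+ d.+2 by rewrite mulr_ge0 ?exprn_ge0// ltW.
split=> [e y|e b].
- have r0 : 0 <= dist_edge_vertex R e y by exact: sqrtr_ge0.
  set r := dist_edge_vertex R e y in r0 *.
  have -> : 1 - d.+2%:Z = - d.+1%:Z by lia.
  set Dv := Num.sqrt (bracket2 R (e.1 - y)).
  have D0 : 0 <= C1 / Dv ^+ d.+1 by rewrite divr_ge0 ?exprn_ge0 ?sqrtr_ge0// ltW.
  have I0 : (0 <= 'E_P[fun a => (`|grad_green (coef a) e y| ^+ 2)%R])%E.
    by rewrite unlock; apply: integral_ge0 => a _; rewrite lee_fin sqr_ge0.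
  apply: (@le_trans _ _ (((C1 / Dv ^+ d.+1) ^+ 2)%:E `^ 2^-1)%E).
    apply: gt0_ler_poweR; rewrite ?invr_ge0// ?in_itv/= ?leey ?andbT//.
      by rewrite lee_fin sqr_ge0.
    by rewrite unlock; exact: H1.
  rewrite poweR_EFin powR12_sqrt ?sqr_ge0// sqrtr_sqr ger0_norm// lee_fin.
  apply: (@le_trans _ _ (C1 * 3 ^+ d.+1 * (r + 1) ^ (- d.+1%:Z))).
    rewrite -mulrA ler_wpM2l ?(ltW C10)//; apply: decay_le => //.
    exact: dist_edge_vertex_le.
  by rewrite ler_wpM2r ?exprz_ge0 ?addr_ge0// lerDl.
have r0 : 0 <= dist_edge_edge R e b by exact: sqrtr_ge0.
rewrite unlock; apply: le_trans (H2 P stP e b) _; rewrite lee_fin.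
set r := dist_edge_edge R e b in r0 *.
apply: (@le_trans _ _ (C2 * 3 ^+ d.+2 * (r + 1) ^ (- d.+2%:Z))).
  rewrite -mulrA ler_wpM2l ?(ltW C20)//; apply: decay_le => //.
  exact: dist_edge_edge_le.
by rewrite ler_wpM2r ?exprz_ge0 ?addr_ge0// lerDr.
Qed.
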